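(* For the metaplectic spinors on $\mathbb CP^1=SU(2)/U(1)$ and $l,j\ge0$, let $\Gamma_{l,j}\subset\Gamma(E_l)$ denote the eigenspace of $P|_{E_l}$ with eigenvalue $\lambda_{l,j}=\frac18(4(l+j+1)^2-3(2l+1)^2-1)$. Then $$\mathscr D:\Gamma_{l,j}\to\Gamma_{l-1,j+1},\qquad\bar{\mathscr D}:\Gamma_{l,j}\to\Gamma_{l+1,j-1}.$$ Furthermore, these maps are isomorphisms except for the trivial cases of $l=0$ for the first map and $j=0$ for the second. Then for $N=0,1,\dots$, the space $$\Gamma_N:=\bigoplus_{l+j=N}\Gamma_{l,j}$$ is a $2(N+1)^2$-dimensional representation of the algebra generated by $\{P,H,D,\tilde D\}$.
   Context: Convention: $\Gamma_{l,j}=0$ if $l<0$ or $j<0$. $G=SU(2)$, $T=U(1)$ the diagonal torus with Lie algebra $\mathfrak t$, $\alpha$ the positive root. $g_0$ is minus the Killing form, and $\{E,F\}$ is a $g_0$-orthonormal basis of $\mathfrak t^\perp$ such that $Z=\frac12(E-iF)$, $\bar Z=\frac12(E+iF)$ are root vectors for $\alpha$ and $-\alpha$. $JE=F$, $JF=-E$ and $\omega_0(X,Y)=g_0(JX,Y)$ define the Kähler structure on $\mathbb CP^1=G/T$. Canonical quantization: $\sigma(E)=ix$, $\sigma(F)=d/dx$ on functions on $\mathbb R$, extended complex-linearly. $E_l^0$ is the line spanned by the Hermite function $h_l(x)=e^{x^2/2}\frac{d^l}{dx^l}e^{-x^2}$. $T$ acts on $E_l^0$, through the metaplectic representation composed with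 the lift of the adjoint action to the double cover of $U(\mathfrak t^\perp)$, with weight $(2l+1)\varpi$, where $\varpi=\alpha/2$ is the fundamental weight. The metaplectic spinor bundle is $\bigoplus_{l\ge0}E_l$ with $E_l=G\times_TE_l^0$; sections of $E_l$ are smooth $\phi:G\to E_l^0$ with $\phi(gt)=t^{-1}\cdot\phi(g)$ for $t\in T$. $H=\frac12(\sigma(E)^2+\sigma(F)^2)$ acts on $E_l$ as $-(l+\frac12)$. With $X\cdot\phi$ denoting differentiation along the left-invariant vector field $X$ (extended complex-linearly), the symplectic Dirac operators are $D\phi=\sigma(E)F\cdot\phi-\sigma(F)E\cdot\phi$ and $\tilde D\phi=\sigma(E)E\cdot\phi+\sigma(F)F\cdot\phi$. The symplectic Dolbeault operators are $\mathscr D=D+i\tilde D=4i\,\sigma(\bar Z)Z$ and $\bar{\mathscr D}=D-i\tilde D=-4i\,\sigma(Z)\bar Z$, and $P=i[\tilde D,D]=\frac12[\mathscr D,\bar{\mathscr D}]$, which preserves each $\Gamma(E_l)$. *)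

(* Defs.v *)
From HB Require Import structures.
From mathcomp Require Import all_boot all_order all_algebra complex.
From mathcomp Require Import sesquilinear spectral.
From mathcomp Require Import all_classical all_reals all_analysis.

Set Implicit Arguments.
Unset Strict Implicit.
Unset Printing Implicit Defensive.
From mathcomp Require Import ring lra.
Import Order.TTheory GRing.Theory Num.Theory numFieldNormedType.Exports.
Local Open Scope classical_set_scope.
Local Open Scope ring_scope.
Local Open Scope complex_scope.
Local Open Scope sesquilinear_scope.

Section SU2.
Variable R : realType.
Local Notation C := R[i].

Definition is_SU2 (g : 'M[C]_2) : bool := (g \is unitarymx) && (\det g == 1).
Definition SU2 : Type := {g : 'M[C]_2 | is_SU2 g}.

Definition is_su2 (X : 'M[C]_2) : bool := (X ^t* == - X) && (\tr X == 0).
Definition su2 : Type := {X : 'M[C]_2 | is_su2 X}.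

Lemma is_SU2_mul (g h : SU2) : is_SU2 (val g *m val h).
Proof.
case/andP: (valP g) => gU /eqP gd; case/andP: (valP h) => hU /eqP hd.
by rewrite /is_SU2 mul_unitarymx //= det_mulmx gd hd mulr1.
Qed.
Definition SU2_mul (g h : SU2) : SU2 := exist is_SU2 _ (is_SU2_mul g h).

Lemma is_SU2_inv (g : SU2) : is_SU2 ((val g) ^t*).
Proof.
case/andP: (valP g) => gU /eqP gd; rewrite /is_SU2 trmxC_unitary gU /=.
by rewrite det_map_mx det_tr gd rmorph1.
Qed.
Definition SU2_inv (g : SU2) : SU2 := exist is_SU2 _ (is_SU2_inv g).

Definition expmx (X : 'M[C]_2) : 'M[C]_2 :=
  lim (series (fun n => (n`!%:R : C)^-1 *: X ^+ n) @ \oo).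

Lemma cvg_real_complex (u : nat -> R) (l : R) :
  u @ \oo --> l -> (fun n => (u n)%:C : C^o) @ \oo --> (l%:C : C^o).
Proof.
move=> ul; apply/cvgrPdist_lt => e e0.
have er : e = (complex.Re e)%:C.
  by move: e0; case: e => a b; rewrite ltcE /= => /andP[/eqP ->].
have e0' : 0 < complex.Re e by rewrite er ltcR in e0.
move/cvgrPdist_lt : ul => /(_ _ e0'); apply: filterS => n.
by rewrite er -rmorphB normc_def /= expr0n addr0 sqrtr_sqr ltcR.
Qed.
Lemma mx22P (A B : 'M[C]_2) : A 0 0 = B 0 0 -> A 0 1 = B 0 1 ->
  A 1 0 = B 1 0 -> A 1 1 = B 1 1 -> A = B.
Proof.
move=> e00 e01 e10 e11; apply/matrixP => i j.
have H (k : 'I_2) : k = 0 \/ k = 1.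
  by case: k => [[|[|//]] kP]; [left|right]; apply: val_inj.
by case: (H i) => ->; case: (H j) => ->.
Qed.

Lemma det22 (A : 'M[C]_2) : \det A = A 0 0 * A 1 1 - A 0 1 * A 1 0.
Proof.
rewrite (expand_det_row _ 0) !big_ord_recl big_ord0 /= addr0.
rewrite /cofactor !det_mx11 !mxE /= expr0 expr1 mul1r mulN1r mulrN.
by congr (_ * A _ _ - A _ _ * A _ _); apply: val_inj.
Qed.

Lemma mul22 (A B : 'M[C]_2) i j : (A *m B) i j = A i 0 * B 0 j + A i 1 * B 1 j.
Proof.
rewrite mxE !big_ord_recl big_ord0 addr0.
by congr (_ + A i _ * B _ _); apply: val_inj.
Qed.

Lemma tr22 (A : 'M[C]_2) : \tr A = A 0 0 + A 1 1.
Proof.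
rewrite /mxtrace !big_ord_recl big_ord0 addr0.
by congr (_ + A _ _); apply: val_inj.
Qed.

Lemma su2_shape (X : 'M[C]_2) : is_su2 X ->
  exists t : R, [/\ X *m X = - (t ^+ 2)%:C *: 1%:M, \det X = (t ^+ 2)%:C
    & t = 0 -> X = 0].
Proof.
case/andP => /eqP XA; rewrite tr22 => /eqP Xtr.
have e i j : conjc (X j i) = - X i j.
  by have /matrixP/(_ i j) := XA; rewrite !mxE.
move: (e 0 0) (e 0 1) (e 1 1) Xtr.
case E00 : (X 0 0) => [p a]; case E01 : (X 0 1) => [b c].
case E10 : (X 1 0) => [b' c']; case E11 : (X 1 1) => [q d].
move=> /eqP + /eqP + /eqP + /eqP; rewrite !eq_complex /=.
move=> /andP[/eqP pE _] /andP[/eqP bE /eqP cE] /andP[/eqP qE _].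
move=> /andP[/eqP pqE /eqP adE].
have p0 : p = 0 by lra.
have q0 : q = 0 by lra.
have dE : d = - a by lra.
have {}bE : b' = - b by lra.
have {}cE : c' = c by lra.
move: E00 E10 E11; rewrite {}p0 {}q0 {}dE {}bE {}cE => E00 E10 E11.
exists (Num.sqrt (a ^+ 2 + b ^+ 2 + c ^+ 2)).
have nn : 0 <= a ^+ 2 + b ^+ 2 + c ^+ 2 by rewrite !addr_ge0 ?sqr_ge0.
rewrite sqr_sqrtr //; split.
- by apply: mx22P; rewrite mul22 !mxE ?E00 ?E01 ?E10 ?E11 /=; simpc;
    congr (_ +i* _); ring.
- by rewrite det22 E00 E01 E10 E11; simpc; congr (_ +i* _); ring.
- move/eqP; rewrite sqrtr_eq0 => le0.
  have [a0 b0 c0] : [/\ a = 0, b = 0 & c = 0].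
    have := sqr_ge0 a; have := sqr_ge0 b; have := sqr_ge0 c => h1 h2 h3.
    by split; apply/eqP; rewrite -sqrf_eq0; apply/eqP; lra.
  by apply: mx22P; rewrite !mxE ?E00 ?E01 ?E10 ?E11 ?a0 ?b0 ?c0 ?oppr0.
Qed.

Lemma su2_pow (X : 'M[C]_2) (t : R) n : X *m X = - (t ^+ 2)%:C *: 1%:M ->
  t != 0 ->
  (n`!%:R : C)^-1 *: X ^+ n =
    (cos_coeff t n)%:C *: 1%:M + (sin_coeff t n / t)%:C *: X.
Proof.
move=> XX t0.
have E k : X ^+ k.*2 = ((- 1) ^+ k * t ^+ k.*2)%:C *: 1%:M.
  elim: k => [|k IH]; first by rewrite !expr0 mul1r scale1r.
  rewrite doubleS !exprS mulrA -[X * X]/(X *m X) XX IH.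
  rewrite -[_ * _ in LHS]/(_ *m _) -scalemxAl mul1mx scalerA.
  by rewrite -!rmorphN -!rmorphM /=; congr (_%:C *: _); ring.
rewrite /cos_coeff /sin_coeff /=.
rewrite -[n in RHS]odd_double_half -[n in LHS]odd_double_half.
case: (odd n); rewrite ?add0n ?add1n /= ?odd_double /=.
- rewrite exprS E -[X * _]/(X *m _) -scalemxAr mulmx1 !mul0r scale0r add0r.
  rewrite scalerA doubleK -[_%:R in LHS](rmorph_nat (real_complex R)) -fmorphV -rmorphM.
  by congr (_%:C *: _); rewrite exprS; field; rewrite t0 pnatr_eq0 -lt0n fact_gt0.
- rewrite E !mul0r scale0r addr0 scalerA doubleK.
  rewrite -[_%:R in LHS](rmorph_nat (real_complex R)) -fmorphV -rmorphM.
  by congr (_%:C *: _); rewrite mul1r mulrC.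
Qed.

Lemma expmx_su2E (X : 'M[C]_2) (t : R) : X *m X = - (t ^+ 2)%:C *: 1%:M ->
  t != 0 -> expmx X = (cos t)%:C *: 1%:M + (sin t / t)%:C *: X.
Proof.
move=> XX t0; rewrite /expmx; apply: (@cvg_lim _ (@norm_hausdorff _ (matrix C 2 2))).
rewrite (_ : series _ = fun n => (series (cos_coeff t) n)%:C *: 1%:M +
    (series (sin_coeff t) n / t)%:C *: X); last first.
  apply/funext => n; rewrite /series /= mulr_suml !rmorph_sum /= !scaler_suml.
  by rewrite -big_split /=; apply: eq_bigr => k _; exact: su2_pow.
by apply: (@cvgD _ (matrix C 2 2));
  apply: (@cvgZr_tmp _ (matrix C 2 2)); apply: cvg_real_complex;
  [|apply: cvgMr_tmp]; rewrite unlock;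
  [exact: is_cvg_series_cos_coeff|exact: is_cvg_series_sin_coeff].
Qed.

Lemma expmx_su2 (X : 'M[C]_2) : is_su2 X -> is_SU2 (expmx X).
Proof.
move=> Xsu; have [t [XX dX X0]] := su2_shape Xsu.
case/andP: (Xsu) => /eqP XA /eqP Xtr.
have [t0|t0] := eqVneq t 0.
  rewrite (X0 t0) (_ : expmx 0 = 1%:M).
    by rewrite /is_SU2 det1 eqxx andbT; apply/unitarymxP; rewrite mul1mx trmx1 map_mx1.
  rewrite /expmx; apply: (@cvg_lim _ (@norm_hausdorff _ (matrix C 2 2))).
  apply: cvg_near_cst; exists 1%N => // -[//|n] _.
  rewrite /series /= big_nat_recl // big1 ?addr0.
    by rewrite expr0 invr1 scale1r.
  by move=> k _; rewrite expr0n scaler0.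
rewrite (expmx_su2E XX t0) /is_SU2.
set c := cos t; set s := sin t / t.
have cs : c ^+ 2 + s ^+ 2 * t ^+ 2 = 1.
  by rewrite -(cos2Dsin2 t) /c /s; field.
have csC : c%:C ^+ 2 + s%:C ^+ 2 * (t ^+ 2)%:C = 1.
  by rewrite -!rmorphXn -rmorphM -rmorphD cs.
have NE : (- s)%:C = - s%:C by exact: rmorphN.
apply/andP; split.
  apply/unitarymxP.
  have -> : (c%:C *: 1%:M + s%:C *: X) ^t* = c%:C *: 1%:M + (- s)%:C *: X.
    apply/matrixP => i j; have /matrixP/(_ i j) := XA; rewrite !mxE => XAij.
    have cR (x : R) : conjc (x%:C) = x%:C by exact: conjc_real.
    have cD (x y : C) : conjc (x + y) = conjc x + conjc y by exact: rmorphD.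
    have cM (x y : C) : conjc (x * y) = conjc x * conjc y by exact: rmorphM.
    have cn n : conjc (n%:R : C) = n%:R by exact: (rmorph_nat conjc).
    have XAij' : conjc (X j i) = - X i j by [].
    rewrite -[LHS]/(conjc _) cD !cM XAij' [i == j]eq_sym.
    by rewrite !cR cn rmorphN mulrN mulNr.
  move/matrixP: XX => XX; move: (XX 0 0) (XX 0 1) (XX 1 0) (XX 1 1).
  rewrite !mul22 !mxE /= !mulr1 !mulr0 => x00 x01 x10 x11.
  apply: mx22P; rewrite mul22 !mxE /= !mulr1 !mulr0 !add0r NE.
  - transitivity (c%:C ^+ 2 - s%:C ^+ 2 * (X 0 0 * X 0 0 + X 0 1 * X 1 0)).
      ring.
    by rewrite x00 mulrN opprK.
  - transitivity (- s%:C ^+ 2 * (X 0 0 * X 0 1 + X 0 1 * X 1 1)); first ring.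
    by rewrite x01 mulr0.
  - transitivity (- s%:C ^+ 2 * (X 1 0 * X 0 0 + X 1 1 * X 1 0)); first ring.
    by rewrite x10 mulr0.
  - transitivity (c%:C ^+ 2 - s%:C ^+ 2 * (X 1 0 * X 0 1 + X 1 1 * X 1 1)).
      ring.
    by rewrite x11 mulrN opprK.
move: dX Xtr; rewrite !det22 tr22 !mxE /= !mulr1 !mulr0 !add0r => dX Xtr.
have x11 : X 1 1 = - X 0 0 by apply/eqP; rewrite -addr_eq0 addrC Xtr.
rewrite -csC -dX x11; apply/eqP; ring.
Qed.

Definition SU2_exp (X : su2) : SU2 := exist is_SU2 _ (expmx_su2 (valP X)).

Lemma is_su2_scale (s : R) (X : su2) : is_su2 (s%:C *: val X).
Proof.
case/andP: (valP X) => /eqP XA /eqP Xtr; apply/andP; split; last first.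
  by rewrite mxtraceZ Xtr mulr0.
apply/eqP/matrixP => i j; have /matrixP/(_ i j) := XA; rewrite !mxE => XAij.
have XAij' : conjc (val X j i) = - val X i j by [].
have cM (x y : C) : conjc (x * y) = conjc x * conjc y by exact: rmorphM.
rewrite -[LHS]/(conjc _) cM XAij' mulrN; congr (- (_ * _)); exact: conjc_real.
Qed.
Definition su2_scale (s : R) (X : su2) : su2 :=
  exist is_su2 _ (is_su2_scale s X).

Definition in_T (t : SU2) : Prop := is_diag_mx (val t).
Definition in_t (A : su2) : Prop := is_diag_mx (val A).

(* The positive root, on the diagonal matrices of the complexified algebra. *)
Definition alpha (A : 'M[C]_2) : C := A 0 0 - A 1 1.

Definition ad (X Y : 'M[C]_2) : 'M[C]_2 := X *m Y - Y *m X.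

(* The trace is taken over gl_2(C) = sl_2(C) + centre. Since ad X \o ad Y kills
   the centre and takes values in sl_2(C), it is also the trace over sl_2(C),
   and hence, for X and Y in su(2), the trace over the real Lie algebra su(2). *)
Definition killing (X Y : 'M[C]_2) : C :=
  \tr (lin_mx (fun A : 'M[C]_2 => ad X (ad Y A))).

Definition g0 (X Y : su2) : C := - killing (val X) (val Y).

Definition root_vector (b : 'M[C]_2 -> C) (Z : 'M[C]_2) : Prop :=
  Z != 0 /\ forall A : su2, in_t A -> ad (val A) Z = b (val A) *: Z.

(* The complexification of su(2) is realized inside 'M[C]_2. The orthogonal
   complement of t is a plane, so an orthonormal pair in it is a basis. *)
Definition adapted_basis (E F : su2) : Prop :=
  [/\ forall A : su2, in_t A -> g0 E A = 0 /\ g0 F A = 0,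
      [/\ g0 E E = 1, g0 F F = 1 & g0 E F = 0],
      root_vector alpha (2^-1 *: (val E - 'i *: val F)) &
      root_vector (fun A => - alpha A) (2^-1 *: (val E + 'i *: val F))].

(* C^infinity: every iterated directional derivative is Frechet differentiable
   at every point. *)
Definition smooth (U : normedModType R) (f : U -> R) : Prop :=
  forall (vs : seq U) (x : U), differentiable (foldr (fun v h => 'D_v h) f vs) x.

(* SU(2) is a closed submanifold of the real vector space
   M_2(C) = M_2(R) + i M_2(R): its smooth functions are the restrictions of the
   smooth functions on that space. *)
Definition re_im (g : SU2) : 'M[R]_2 * 'M[R]_2 :=
  (map_mx (@complex.Re R) (val g), map_mx (@complex.Im R) (val g)).

Definition smooth_SU2 (f : SU2 -> C) : Prop :=
  exists u v : 'M[R]_2 * 'M[R]_2 -> R,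
    [/\ smooth u, smooth v & forall g, f g = u (re_im g) +i* v (re_im g)].

Definition cderive (f : R -> C) (x : R) : C :=
  derive1 (fun y => complex.Re (f y)) x +i* derive1 (fun y => complex.Im (f y)) x.

Definition sigmaE (v : R -> C) : R -> C := fun x => 'i * x%:C * v x.
Definition sigmaF (v : R -> C) : R -> C := cderive v.

Definition hermite (l : nat) : R -> C :=
  fun x => (expR (x ^+ 2 / 2) * derive1n l (fun y : R => expR (- y ^+ 2)) x)%:C.

(* Spinor fields as functions on SU(2) with values in functions on the line. *)
Definition spinor : Type := SU2 -> R -> C.
HB.instance Definition _ := GRing.Lmodule.on spinor.

(* The fundamental weight alpha / 2 exponentiates to the character
   t |-> t 0 0 of T, so this is the action of T with weight 2 l + 1 times it.
   It is the metaplectic one: for t = diag(e^(i a), e^(-i a)), Ad t rotates the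
   complement of t by 2 a, and exp(- 2 i a H) acts on E_l^0, where
   H = - (l + 1/2), as (t 0 0)^(2 l + 1). *)
Definition T_act (l : nat) (t : SU2) (v : R -> C) : R -> C :=
  (val t 0 0) ^+ (2 * l + 1) *: v.

Definition sections (l : nat) : set spinor :=
  [set phi | (exists2 f : SU2 -> C, smooth_SU2 f &
                forall g, phi g = f g *: hermite l) /\
             forall g t, in_T t ->
               phi (SU2_mul g t) = T_act l (SU2_inv t) (phi g)].

(* Differentiation along the left-invariant vector field of X. *)
Definition lieder (X : su2) (phi : spinor) : spinor := fun g x =>
  cderive (fun s => phi (SU2_mul g (SU2_exp (su2_scale s X))) x) 0.

Definition Dirac (E F : su2) (phi : spinor) : spinor := fun g =>
  sigmaE (lieder F phi g) - sigmaF (lieder E phi g).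

Definition Dirac_tilde (E F : su2) (phi : spinor) : spinor := fun g =>
  sigmaE (lieder E phi g) + sigmaF (lieder F phi g).

Definition Dolbeault (E F : su2) (phi : spinor) : spinor :=
  Dirac E F phi + 'i *: Dirac_tilde E F phi.

Definition Dolbeault_bar (E F : su2) (phi : spinor) : spinor :=
  Dirac E F phi - 'i *: Dirac_tilde E F phi.

Definition opP (E F : su2) (phi : spinor) : spinor :=
  'i *: (Dirac_tilde E F (Dirac E F phi) - Dirac E F (Dirac_tilde E F phi)).

Definition opH (phi : spinor) : spinor := fun g =>
  2^-1 *: (sigmaE (sigmaE (phi g)) + sigmaF (sigmaF (phi g))).

Definition lambda (l j : nat) : C :=
  8^-1 * (4 * (l + j + 1)%N%:R ^+ 2 - 3 * (2 * l + 1)%N%:R ^+ 2 - 1).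

Definition Gamma (E F : su2) (l j : int) : set spinor :=
  match l, j with
  | Posz l', Posz j' =>
      [set phi | sections l' phi /\ opP E F phi = lambda l' j' *: phi]
  | _, _ => [set 0]
  end.

Definition Gamma_components (E F : su2) (N : nat) : set ('I_N.+1 -> spinor) :=
  [set psi | forall l : 'I_N.+1, Gamma E F (l : nat) (N - l)%N (psi l)].

Arguments Gamma_components E F N _ : clear implicits.

Definition Gamma_sum (E F : su2) (N : nat) : set spinor :=
  [set \sum_l psi l | psi in Gamma_components E F N].

End SU2.
Arguments Gamma_components {R} E F N _.

Section linear.
Variables (K : pzRingType) (V : lmodType K).

Definition linear_on (A : set V) (f : V -> V) : Prop :=
  forall (a : K) (u v : V), A u -> A v -> f (a *: u + v) = a *: f u + f v.

Definition linear_iso (A B : set V) (f : V -> V) : Prop :=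
  linear_on A f /\ set_bij A B f.

(* A is a subspace with a basis b of d vectors. *)
Definition has_dim (A : set V) (d : nat) : Prop :=
  exists b : 'I_d -> V,
    set_bij [set: 'rV[K]_d] A (fun c => \sum_i c 0 i *: b i).

Inductive generated_algebra (S : set (V -> V)) : (V -> V) -> Prop :=
| Gen_in a of S a : generated_algebra S a
| Gen_id : generated_algebra S id
| Gen_lin (k : K) a b of generated_algebra S a & generated_algebra S b :
    generated_algebra S (fun u => k *: a u + b u)
| Gen_mul a b of generated_algebra S a & generated_algebra S b :
    generated_algebra S (a \o b).

(* The elements of the algebra act on A by restriction. *)
Definition is_representation (Alg : set (V -> V)) (A : set V) : Prop :=
  forall a, Alg a -> (forall u, A u -> A (a u)) /\ linear_on A a.

End linear.

(* Main.v *)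
Require Import Defs.
From HB Require Import structures.
From mathcomp Require Import all_boot all_order all_algebra complex.
From mathcomp Require Import sesquilinear spectral.
From mathcomp Require Import all_classical all_reals all_analysis.
From mathcomp Require Import ring lra.
Set Implicit Arguments.
Unset Strict Implicit.
Unset Printing Implicit Defensive.
Import Order.TTheory GRing.Theory Num.Theory numFieldNormedType.Exports.
Local Open Scope classical_set_scope.
Local Open Scope ring_scope.
Local Open Scope complex_scope.

(** A section of [E_l] is [f h_l], with [h_l] the Hermite function and [f] a
    smooth function on SU(2) of weight [- (2 l + 1)] under right translation by
    the torus. Write [raise] and [lower] for the derivatives of such functions
    along the root vectors [Z] and [Z-bar]. The recurrences of the Hermite
    functions give
      [Dolbeault (f h_l) = 4 l (raise f) h_(l-1)] and
      [Dolbeault_bar (f h_l) = - 2 (lower f) h_(l+1)],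
    and, since the bracket of [E] and [F] lies in the Lie algebra of the torus,
    [raise \o lower - lower \o raise] is the scalar [- m / 8] on functions of
    weight [m] ([raise_lower]). Hence [P] acts on sections of [E_l] as
    [- 4 raise \o lower - l (2 l + 1) / 2], so that its eigenvalue
    [lambda l j] corresponds to the eigenvalue
    [mu l j = - ((l + j + 1) ^ 2 - (l + 1) ^ 2) / 8] of [raise \o lower]
    ([GammaP]). The commutator turns eigenfunctions into eigenfunctions along
    the ladder, and between [(l + 1, j)] and [(l, j + 1)] both composites of
    [raise] and [lower] are multiplication by [mu l (j + 1) <> 0]; this is why
    the Dolbeault operators are isomorphisms ([Dolbeault_iso],
    [Dolbeault_bar_iso]).

    At the end [j = 0] of the ladder, [u = lower f] satisfies [raise u = 0] and
    has negative weight. Such a function vanishes, by a maximum principle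
    ([raise_weight_lt0]): if [raise u = 0] and [u] has weight [m], then
    [raise (lower |u|^2) = - (m / 8) |u|^2 + |lower u|^2], whereas the left-hand
    side is a quarter of [E^2 + F^2] applied to [|u|^2], which is at most zero
    where [|u|^2] is maximal; SU(2) being compact, a maximum exists. The complex
    conjugate statement concerns functions of positive weight killed by
    [lower].

    Going down the ladder, [Gamma l j] is isomorphic to [Gamma N 0] for
    [N = l + j], and this is the space of functions of weight [- n] killed by
    [lower], with [n = 2 N + 1]. It contains the [n + 1] independent functions
    [g01 ^ k * g11 ^ (n - k)]. They span it: for [f] in this space
    [raise^(n+1) f] has positive weight and is killed by [lower], hence is
    zero; it follows that a suitable positive combination [chain_norm] of the
    [|raise^k f|^2], [k <= n], is killed by all left-invariant fields. As SU(2)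
    is covered by one-parameter subgroups, this combination is constant, and so
    [f] is determined by the [n + 1] values of [raise^k f] at the identity
    ([chain_inj], [lowest_weight_coord]). Thus [Gamma l j] has dimension
    [2 (l + j + 1)], and since the Hermite functions are linearly independent
    the [N + 1] spaces with [l + j = N] add up to dimension [2 (N + 1) ^ 2].

    Two points concern the setting rather than the geometry. The operators on
    spinor fields are defined through limits that need not exist, so they are
    linear only on well-behaved fields; the finite sums of fields [f h_l]
    ([tame]) are preserved by all of them. And the left-invariant field of [X]
    is the restriction of the linear vector field [x |-> x X] on the space of
    matrices, so that the bracket relation of left-invariant fields comes from
    the symmetry of second derivatives ([along_comm], [lieD_bracket]). *)

(** * Smooth functions on a normed space *)

Section Smooth.
Variables (R : realType) (U : normedModType R).
Implicit Types f g u : U -> R.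

Lemma smooth_differentiable f x : smooth f -> differentiable f x.
Proof. by move=> /(_ [::]). Qed.

Lemma smooth_derive f v : smooth f -> smooth ('D_v f).
Proof. by move=> fs vs x; have := fs (rcons vs v) x; rewrite foldr_rcons. Qed.

(** [smooth] speaks of all iterated derivatives; a class of differentiable
    functions closed under directional derivatives is an invariant that gives
    them all at once. *)
Lemma smooth_coind (P : (U -> R) -> Prop) :
  (forall f, P f -> (forall x, differentiable f x) /\ forall v, P ('D_v f)) ->
  forall f, P f -> smooth f.
Proof.
move=> PP f Pf vs; elim/last_ind: vs f Pf => [|vs v IH] f Pf x.
  by case: (PP f Pf).
by rewrite foldr_rcons; apply: IH; case: (PP f Pf).
Qed.

(** The Leibniz rule turns a product into a sum of products, so the
    invariant for [smooth_coind] has to contain sums and products together. *)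
Inductive smooth_alg : (U -> R) -> Prop :=
| Smooth_in f of smooth f : smooth_alg f
| Smooth_add f g of smooth_alg f & smooth_alg g : smooth_alg (f \+ g)
| Smooth_mul f g of smooth_alg f & smooth_alg g : smooth_alg (f \* g).

Lemma smooth_algP f : smooth_alg f -> smooth f.
Proof.
apply: smooth_coind => {}f.
elim=> {f} [f fs|f g _ [fd fv] _ [gd gv]|f g fa [fd fv] ga [gd gv]].
- by split=> [x|v]; [exact: smooth_differentiable|apply/Smooth_in/smooth_derive].
- split=> [x|v]; first exact: differentiableD.
  rewrite (_ : 'D_v _ = 'D_v f \+ 'D_v g); first exact: Smooth_add.
  by apply/funext => x; rewrite deriveD //; apply: diff_derivable.
- split=> [x|v]; first exact: differentiableM.
  rewrite (_ : 'D_v _ = (f \* 'D_v g) \+ (g \* 'D_v f)).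
    by apply: Smooth_add; apply: Smooth_mul.
  by apply/funext => x; rewrite deriveM //; apply: diff_derivable.
Qed.

Lemma smoothD f g : smooth f -> smooth g -> smooth (f \+ g).
Proof. by move=> fs gs; apply/smooth_algP/Smooth_add; apply: Smooth_in. Qed.

Lemma smoothM f g : smooth f -> smooth g -> smooth (f \* g).
Proof. by move=> fs gs; apply/smooth_algP/Smooth_mul; apply: Smooth_in. Qed.

Lemma smooth_cst (c : R) : smooth (cst c : U -> R).
Proof.
apply: (@smooth_coind (fun f => exists c, f = cst c)); last by exists c.
move=> f [{}c ->]; split=> [x|v]; first exact: differentiable_cst.
by exists 0; apply/funext => x; rewrite derive_cst.
Qed.

Lemma smoothZ (c : R) f : smooth f -> smooth (fun x => c * f x).
Proof. by move=> fs; apply: smoothM fs; exact: smooth_cst. Qed.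

Lemma smoothN f : smooth f -> smooth (\- f).
Proof.
move=> fs; rewrite (_ : \- f = fun x => -1 * f x); first exact: smoothZ.
by apply/funext => x; rewrite mulN1r.
Qed.

Lemma smooth_sum (I : Type) (r : seq I) (F : I -> U -> R) :
  (forall i, smooth (F i)) -> smooth (fun x => \sum_(i <- r) F i x).
Proof.
move=> Fs; elim: r => [|i r IH].
  rewrite (_ : (fun _ => _) = cst 0); first exact: smooth_cst.
  by apply/funext => x; rewrite big_nil.
rewrite (_ : (fun _ => _) = F i \+ fun x => \sum_(i <- r) F i x).
  exact: smoothD.
by apply/funext => x; rewrite big_cons.
Qed.

Lemma derive_linear (f : {linear U -> R^o}) (v x : U) :
  continuous f -> 'D_v (f : U -> R) x = f v.
Proof.
by move=> fc; rewrite deriveE ?diff_lin //; exact: linear_differentiable.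
Qed.

Lemma smooth_linear (f : {linear U -> R^o}) : continuous f -> smooth (f : U -> R).
Proof.
move=> fc; apply: (@smooth_coind (fun g => g = f \/ exists c, g = cst c));
  last by left.
move=> g [->|[c ->]]; (split=> [x|v]; last right).
- exact: linear_differentiable.
- by exists (f v); apply/funext => x; rewrite derive_linear.
- exact: differentiable_cst.
- by exists 0; apply/funext => x; rewrite derive_cst.
Qed.

End Smooth.

(** * Symmetry of second derivatives *)

Section Schwarz.
Variables (R : realType) (U : normedModType R).

Lemma derive_along (u : U -> R) (x v : U) (s : R) :
  differentiable u (x + s *: v) ->
  is_derive s 1 (fun r : R => u (x + r *: v)) ('D_v u (x + s *: v)).
Proof.
move=> ud.
have ld : is_diff s (fun r : R => x + r *: v) (fun r => r *: v).
  have := @is_diffD R R^o U (cst x) (fun r : R => r *: v) 0 (fun r => r *: v) s.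
  by rewrite add0r; apply; apply: is_diff_scalel.
have ud' : is_diff (x + s *: v) u ('d u (x + s *: v)) by exact: differentiableP.
have [cd ce] := @is_diff_comp _ _ _ _ _ _ u _ s ld ud'.
apply: DeriveDef; first exact: diff_derivable.
by rewrite deriveE // ce /= scale1r deriveE.
Qed.

(** A one-parameter subgroup of SU(2) moves a point of the matrix space along
    such a curve, with [c] and [d] trigonometric functions. *)
Lemma derive_along_curve (u : U -> R) (x y : U) (c d : R -> R) (dc dd : R) :
  is_derive (0 : R) 1 c dc -> is_derive (0 : R) 1 d dd ->
  differentiable u (c 0 *: x + d 0 *: y) ->
  is_derive (0 : R) 1 (fun s : R => u (c s *: x + d s *: y))
    ('D_(dc *: x + dd *: y) u (c 0 *: x + d 0 *: y)).
Proof.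
move=> [/derivable1_diffP c1 c2] [/derivable1_diffP d1 d2] ud.
have lin (h : R -> R) (w : U) : differentiable h 0 ->
    differentiable (fun s : R => h s *: w) 0 /\
    'd (fun s : R => h s *: w) 0 1 = 'D_1 h 0 *: w.
  by move=> hd; split; [exact: differentiableZl|rewrite (diffZl w hd) -deriveE].
have [cx cxE] := lin c x c1; have [dy dyE] := lin d y d1.
have gd : differentiable (fun s : R => c s *: x + d s *: y) 0.
  exact: differentiableD.
apply: DeriveDef; first exact/diff_derivable/differentiable_comp.
rewrite deriveE; last exact: differentiable_comp.
rewrite (diff_comp gd ud) deriveE // -c2 -d2 -cxE -dyE /=.
by rewrite (diffD cx dy).
Qed.

(** The mean value theorem for [s |-> u (x + h w + s v) - u (x + s v)]
    reduces the second difference to two values of ['D_v u], which are then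
    expanded to first order at [x]. The second difference is symmetric in
    [v] and [w]. *)
Lemma second_difference (u : U -> R) (x v w : U) (e : R) :
  (forall y, differentiable u y) -> differentiable ('D_v u) x -> 0 < e ->
  \forall h \near 0^'+,
    `|u (x + h *: v + h *: w) - u (x + h *: v) - u (x + h *: w) + u x
       - h ^+ 2 * 'D_w ('D_v u) x| <= h ^+ 2 * e.
Proof.
move=> ud pd e0.
set p := 'D_v u in pd *.
(* [h * K] bounds the vectors at which ['D_v u] is expanded, and [K] collects
   the constants of the two error terms. *)
pose K := 2 * `|v| + `|w| + 1.
have K0 : 0 < K by rewrite ltr_wpDl // addr_ge0 // mulr_ge0.
pose d := e / K.
have d0 : 0 < d by rewrite divr_gt0.
have near0 : \forall y \near (0 : U), `|p (x + y) - p x - 'd p x y| <= d * `|y|.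
  have /eqaddoP H := diff_locally pd.
  have := H _ d0; apply: filterS => y /=.
  by rewrite !fctE /= [y + x]addrC opprD addrA.
have /nbhs_ballP[r /= r0 rP] := near0.
near=> h.
have h0 : 0 < h by near: h; exact: nbhs_right_gt.
have hs (s : R) : 0 <= s -> s <= h -> `|p (x + (s *: v)) - p x - 'd p x (s *: v)| <= d * (h * `|v|).
  move=> s0 sh; apply: (@le_trans _ _ (d * `|s *: v|)).
    apply: rP; rewrite -ball_normE /= sub0r normrN normrZ ger0_norm //.
    apply: (@le_lt_trans _ _ (h * K)).
      rewrite ler_pM // /K; have := normr_ge0 v; have := normr_ge0 w; lra.
    rewrite -ltr_pdivlMr //; near: h; apply: nbhs_right_lt; exact: divr_gt0.
  by rewrite normrZ ger0_norm // ler_pM2l // ler_wpM2r.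
have hw (s : R) : 0 <= s -> s <= h ->
    `|p (x + (s *: v + h *: w)) - p x - 'd p x (s *: v + h *: w)|
      <= d * (h * (`|v| + `|w|)).
  move=> s0 sh.
  have nb : `|s *: v + h *: w| <= h * (`|v| + `|w|).
    rewrite (le_trans (ler_normD _ _)) // !normrZ !ger0_norm ?(ltW h0) //.
    by rewrite mulrDr lerD2r ler_wpM2r.
  apply: (@le_trans _ _ (d * `|s *: v + h *: w|)).
    apply: rP; rewrite -ball_normE /= sub0r normrN.
    apply: (le_lt_trans nb); apply: (@le_lt_trans _ _ (h * K)).
      rewrite ler_pM2l // /K; have := normr_ge0 v; have := normr_ge0 w; lra.
    rewrite -ltr_pdivlMr //; near: h; apply: nbhs_right_lt; exact: divr_gt0.
  by rewrite ler_pM2l.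
pose G (s : R) := u (x + h *: w + s *: v) - u (x + s *: v).
have Gd (s : R) : is_derive s 1 G (p (x + h *: w + s *: v) - p (x + s *: v)).
  by apply: is_deriveB; apply: derive_along.
have Gc : {within `[0, h], continuous G}.
  apply: continuous_subspaceT => s; apply: differentiable_continuous.
  by apply/derivable1_diffP; case: (Gd s).
have [s sI sE] := MVT h0 (fun s _ => Gd s) Gc.
move: sI; rewrite in_itv /= => /andP[/ltW s0 /ltW sh].
have -> : u (x + h *: v + h *: w) - u (x + h *: v) - u (x + h *: w) + u x
  = G h - G 0.
  by rewrite /G scale0r !addr0 [x + h *: w + _]addrAC; ring.
rewrite sE subr0 deriveE //.
have lD : 'd p x (s *: v + h *: w) = 'd p x (s *: v) + h * 'd p x w.
  rewrite linearD; congr (_ + _); exact: linearZ.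
have := hw _ s0 sh; have := hs _ s0 sh; rewrite lD.
rewrite [s *: v + _]addrC [x + (_ + _)]addrA.
set A := p (x + h *: w + s *: v); set B := p (x + s *: v); set Cc := 'd p x (s *: v).
move=> H1 H2.
have -> : (A - B) * h - h ^+ 2 * 'd p x w =
  h * ((A - p x - (Cc + h * 'd p x w)) - (B - p x - Cc)) by ring.
rewrite normrM gtr0_norm // expr2 -mulrA ler_pM2l //.
apply: (le_trans (ler_normB _ _)).
apply: (le_trans (lerD H2 H1)).
have -> : e = d * K by rewrite /d divfK // gt_eqF.
rewrite (_ : _ + _ = h * (d * (2 * `|v| + `|w|))); last by ring.
by rewrite !ler_pM2l // lerDl.
Unshelve. all: by end_near.
Qed.

Lemma derive_comm (u : U -> R) (x v w : U) :
  smooth u -> 'D_w ('D_v u) x = 'D_v ('D_w u) x.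
Proof.
move=> us; apply/eqP; rewrite -subr_eq0 -normr_eq0 eq_le normr_ge0 andbT.
apply/ler_addgt0Pl => e e0; rewrite addr0.
have ud y : differentiable u y by exact: smooth_differentiable.
have pd v' : differentiable ('D_v' u) x.
  exact/smooth_differentiable/smooth_derive.
have e2 : 0 < e / 2 by rewrite divr_gt0.
have H1 := second_difference w ud (pd v) e2.
have H2 := second_difference v ud (pd w) e2.
suff /filter_ex[] : \forall h \near (0 : R)^'+,
    `|'D_w ('D_v u) x - 'D_v ('D_w u) x| <= e by [].
move: (nbhs_right_gt (0 : R)) H1 H2; apply: filterS3 => h h0.
have h20 : 0 < h ^+ 2 by rewrite exprn_gt0.
rewrite [x + h *: w + _]addrAC.
set A := u _; set B := u (x + _); set Cc := u (x + _); set D := u x.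
set X := 'D_w _ _; set Y := 'D_v _ _ => H1 H2.
rewrite -(ler_pM2l h20) -[X in X * _ <= _](gtr0_norm h20) -normrM.
rewrite (_ : h ^+ 2 * (X - Y) = (A - Cc - B + D - h ^+ 2 * Y)
   - (A - B - Cc + D - h ^+ 2 * X)); last by ring.
rewrite (le_trans (ler_normB _ _)) // (le_trans (lerD H2 H1)) //.
by rewrite -mulrDr -splitr.
Qed.

End Schwarz.

(** * Linear vector fields *)

Section LinearFields.
Variables (R : realType) (V : normedModType R) (J : finType).
Variables (coord : J -> {linear V -> R^o}) (basis : J -> V).
Hypothesis coord_continuous : forall c, continuous (coord c).
Hypothesis basis_expand : forall x, x = \sum_c coord c x *: basis c.
Implicit Types (c : J) (x v w : V) (u : V -> R).

Lemma smooth_linearV (f : {linear V -> R^o}) : smooth (f : V -> R).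
Proof.
rewrite (_ : (f : V -> R) = fun x => \sum_c f (basis c) * coord c x).
  apply: smooth_sum => c; apply: smoothZ.
  exact: (@smooth_linear R V (coord c) (coord_continuous (c:=c))).
apply/funext => x; rewrite {1}(basis_expand x) linear_sum.
by apply: eq_bigr => c _; rewrite linearZ /= mulrC.
Qed.

Lemma derive_linearV (f : {linear V -> R^o}) v x : 'D_v (f : V -> R) x = f v.
Proof.
apply: (@derive_linear R V f) => y.
exact/differentiable_continuous/smooth_differentiable/smooth_linearV.
Qed.

Lemma derive_expand u v x : differentiable u x ->
  'D_v u x = \sum_c coord c v * 'D_(basis c) u x.
Proof.
move=> ud; rewrite deriveE // {1}(basis_expand v) linear_sum.
by apply: eq_bigr => c _; rewrite linearZ deriveE.
Qed.

Lemma deriveDr u v w x : differentiable u x ->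
  'D_(v + w) u x = 'D_v u x + 'D_w u x.
Proof. by move=> ud; rewrite !deriveE // linearD. Qed.

Lemma deriveZr u (a : R) v x : differentiable u x ->
  'D_(a *: v) u x = a * 'D_v u x.
Proof. by move=> ud; rewrite !deriveE // linearZ. Qed.

Lemma deriveBr u v w x : differentiable u x ->
  'D_(v - w) u x = 'D_v u x - 'D_w u x.
Proof. by move=> ud; rewrite !deriveE // linearB. Qed.

Lemma derive_sum_seq (I : Type) (r : seq I) (F : I -> V -> R) v x :
  (forall i, differentiable (F i) x) ->
  differentiable (fun y => \sum_(i <- r) F i y) x /\
  'D_v (fun y => \sum_(i <- r) F i y) x = \sum_(i <- r) 'D_v (F i) x.
Proof.
move=> Fd; elim: r => [|i r [IHd IHe]].
  rewrite (_ : (fun _ => _) = cst 0); last by apply/funext => y; rewrite big_nil.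
  by split; [exact: differentiable_cst|rewrite derive_cst big_nil].
rewrite (_ : (fun _ => _) = F i \+ fun y => \sum_(i <- r) F i y); last first.
  by apply/funext => y; rewrite big_cons.
split; first exact: differentiableD.
by rewrite deriveD ?IHe ?big_cons //; apply: diff_derivable.
Qed.

Definition along (A : V -> V) u : V -> R := fun x => 'D_(A x) u x.

Lemma alongE (A : V -> V) u : smooth u ->
  along A u = fun x => \sum_c coord c (A x) * 'D_(basis c) u x.
Proof.
move=> us; apply/funext => x.
by rewrite /along derive_expand //; exact: smooth_differentiable.
Qed.

Lemma smooth_along (A : {linear V -> V}) u : smooth u -> smooth (along A u).
Proof.
move=> us; rewrite alongE //; apply: smooth_sum => c; apply: smoothM.
  exact: (smooth_linearV (coord c \o A)).
exact: smooth_derive.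
Qed.

(** The second term is the second derivative of [u] in the directions [A x] and
    [w]; by its symmetry it disappears from commutators. *)
Lemma derive_along_field (A : {linear V -> V}) u w x : smooth u ->
  'D_w (along A u) x =
    'D_(A w) u x + \sum_c coord c (A x) * 'D_w ('D_(basis c) u) x.
Proof.
move=> us; have ud y : differentiable u y by exact: smooth_differentiable.
rewrite alongE // (derive_expand (A w)) // -big_split /=.
have cd c : differentiable (coord c \o A : V -> R) x.
  exact/smooth_differentiable/(smooth_linearV (coord c \o A)).
have dd c : differentiable ('D_(basis c) u) x.
  exact/smooth_differentiable/smooth_derive.
have := @derive_sum_seq _ (index_enum J)
  (fun c => (coord c \o A : V -> R) \* 'D_(basis c) u) w x.
case=> [c|_ ->]; first exact: differentiableM.
apply: eq_bigr => c _; rewrite deriveM; [|exact: diff_derivable..].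
rewrite (derive_linearV (coord c \o A)) addrC.
by congr (_ + _); exact: mulrC.
Qed.

Lemma second_derive_sym u v w x : smooth u ->
  \sum_c coord c v * 'D_w ('D_(basis c) u) x =
  \sum_c coord c w * 'D_v ('D_(basis c) u) x.
Proof.
move=> us; pose D2 c d : R := 'D_(basis d) ('D_(basis c) u) x.
have D2C c d : D2 c d = D2 d c by exact: derive_comm.
have E y z : \sum_c coord c y * 'D_z ('D_(basis c) u) x =
    \sum_c \sum_d coord c y * (coord d z * D2 c d).
  apply: eq_bigr => c _; rewrite (derive_expand z) ?mulr_sumr //.
  exact/smooth_differentiable/smooth_derive.
apply: (etrans (E v w)); apply: (etrans _ (esym (E w v))).
clearbody D2; rewrite exchange_big /=; apply: eq_bigr => c _.
by apply: eq_bigr => d _; rewrite mulrCA D2C.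
Qed.

Lemma along_comm (A B : {linear V -> V}) u x : smooth u ->
  along A (along B u) x - along B (along A u) x = 'D_(B (A x) - A (B x)) u x.
Proof.
move=> us; have ud : differentiable u x by exact: smooth_differentiable.
have cancel (p q a b S T r : R) :
    p = a + S -> q = b + T -> S = T -> r = a - b -> p - q = r.
  by move=> -> -> -> ->; rewrite opprD addrACA subrr addr0.
exact: cancel (derive_along_field B (A x) x us) (derive_along_field A (B x) x us)
  (second_derive_sym (B x) (A x) x us) (deriveBr (B (A x)) (A (B x)) ud).
Qed.

End LinearFields.

(** * The space of pairs of matrices *)

Section Ambient.
Variable R : realType.
Local Notation V := ('M[R]_2 * 'M[R]_2)%type.
Local Notation J := (bool * 'I_2 * 'I_2)%type.
Implicit Types (c : J) (x v w : V) (u : V -> R).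

Definition coordV c x : R := (if c.1.1 then x.1 else x.2) c.1.2 c.2.
Definition basisV c : V :=
  if c.1.1 then (delta_mx c.1.2 c.2, 0) else (0, delta_mx c.1.2 c.2).

Fact coordV_is_linear c : linear (coordV c : V -> R^o).
Proof. by move=> a x y; rewrite /coordV; case: c.1.1; rewrite /= !mxE. Qed.
HB.instance Definition _ c :=
  GRing.isLinear.Build R V R^o _ (coordV c) (coordV_is_linear c).

Lemma coordV_basis c d : coordV c (basisV d) = (c == d)%:R.
Proof.
case: c d => [[a i] j] [[b k] l]; rewrite /coordV /basisV /= !xpair_eqE.
by case: a; case: b; rewrite /= !mxE.
Qed.

Lemma coordV_inj x y : (forall c, coordV c x = coordV c y) -> x = y.
Proof.
case: x y => [x1 x2] [y1 y2] xy; congr pair; apply/matrixP => i j.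
  exact: (xy (true, i, j)).
exact: (xy (false, i, j)).
Qed.

Lemma basisV_expand x : x = \sum_c coordV c x *: basisV c.
Proof.
apply: coordV_inj => c; rewrite linear_sum (bigD1 c) //= big1 => [|d dc].
  by rewrite linearZ /= coordV_basis eqxx addr0 [RHS]mulr1.
by rewrite linearZ /= coordV_basis eq_sym (negPf dc) [LHS]mulr0.
Qed.

Lemma coordV_continuous c : continuous (coordV c).
Proof.
move=> x; rewrite /coordV; case: c.1.1.
  apply: (@continuous_comp _ _ _ fst (fun M : 'M[R]_2 => M c.1.2 c.2)).
    exact: cvg_fst.
  exact: coord_continuous.
apply: (@continuous_comp _ _ _ snd (fun M : 'M[R]_2 => M c.1.2 c.2)).
  exact: cvg_snd.
exact: coord_continuous.
Qed.

(** Right multiplication by [X] on the space of complex matrices, split into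
    real and imaginary parts as in [re_im]. *)
Definition rmulmx (X : 'M[R[i]]_2) (x : V) : V :=
  let X1 := map_mx (@complex.Re R) X in let X2 := map_mx (@complex.Im R) X in
  (x.1 *m X1 - x.2 *m X2, x.1 *m X2 + x.2 *m X1).

Fact rmulmx_is_linear X : linear (rmulmx X).
Proof.
move=> a x y; rewrite /rmulmx; congr pair => /=.
  by rewrite !mulmxDl -!scalemxAl opprD scalerBr addrACA.
by rewrite !mulmxDl -!scalemxAl scalerDr addrACA.
Qed.
HB.instance Definition _ X :=
  GRing.isLinear.Build R V V _ (rmulmx X) (rmulmx_is_linear X).

End Ambient.

(** * Complex-valued functions of a real variable *)

Section ComplexDerivative.
Variable R : realType.
Local Notation C := R[i].
Implicit Types (f g : R -> C) (x : R) (d e c : C).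

Definition is_cderive f x d : Prop :=
  is_derive x 1 (fun y => complex.Re (f y)) (complex.Re d) /\
  is_derive x 1 (fun y => complex.Im (f y)) (complex.Im d).

Lemma is_cderiveE f x d : is_cderive f x d -> cderive f x = d.
Proof. by case: d => a b [[_ fa] [_ fb]]; rewrite /cderive !derive1E fa fb. Qed.

Lemma is_cderive_eq f x d e : is_cderive f x d -> d = e -> is_cderive f x e.
Proof. by move=> fd <-. Qed.

Lemma ReD (c d : C) : complex.Re (c + d) = complex.Re c + complex.Re d.
Proof. by case: c d => [a b] [a' b']. Qed.

Lemma ImD (c d : C) : complex.Im (c + d) = complex.Im c + complex.Im d.
Proof. by case: c d => [a b] [a' b']. Qed.

Lemma ReM (c d : C) : complex.Re (c * d) =
  complex.Re c * complex.Re d - complex.Im c * complex.Im d.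
Proof. by case: c d => [a b] [a' b']. Qed.

Lemma ImM (c d : C) : complex.Im (c * d) =
  complex.Re c * complex.Im d + complex.Im c * complex.Re d.
Proof. by case: c d => [a b] [a' b']. Qed.

Lemma is_cderive_cst x c : is_cderive (fun=> c) x 0.
Proof. by split; apply: is_derive_cst. Qed.

Lemma is_cderiveD f g x d e : is_cderive f x d -> is_cderive g x e ->
  is_cderive (fun y => f y + g y) x (d + e).
Proof.
move=> [f1 f2] [g1 g2]; split.
  by under eq_fun do rewrite ReD; rewrite ReD; apply: is_deriveD.
by under eq_fun do rewrite ImD; rewrite ImD; apply: is_deriveD.
Qed.

Lemma is_cderiveM f g x d e : is_cderive f x d -> is_cderive g x e ->
  is_cderive (fun y => f y * g y) x (d * g x + f x * e).
Proof.
move=> [f1 f2] [g1 g2]; split.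
  under eq_fun do rewrite ReM.
  apply: (@is_derive_eq _ _ _ _ _ _ _ _ (is_deriveB (is_deriveM f1 g1) (is_deriveM f2 g2))).
  by rewrite ReD !ReM /GRing.scale /=; ring.
under eq_fun do rewrite ImM.
apply: (@is_derive_eq _ _ _ _ _ _ _ _ (is_deriveD (is_deriveM f1 g2) (is_deriveM f2 g1))).
by rewrite ImD !ImM /GRing.scale /=; ring.
Qed.

Lemma is_cderiveZ f x c d : is_cderive f x d ->
  is_cderive (fun y => c * f y) x (c * d).
Proof.
move=> fd; apply: is_cderive_eq (is_cderiveM (is_cderive_cst x c) fd) _.
by rewrite mul0r add0r.
Qed.

Lemma is_cderiveX f x d n : is_cderive f x d ->
  is_cderive (fun y => f y ^+ n) x (n%:R * f x ^+ n.-1 * d).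
Proof.
move=> fd; elim: n => [|n IH].
  by apply: is_cderive_eq (is_cderive_cst x 1) _; rewrite !mul0r.
under eq_fun do rewrite exprS.
apply: is_cderive_eq (is_cderiveM fd IH) _.
rewrite -[n.+1%:R]natr1; case: n {IH} => [|n /=]; first by rewrite /= !expr0; ring.
by rewrite exprS; ring.
Qed.

Lemma is_cderive_conj f x d : is_cderive f x d ->
  is_cderive (fun y => conjc (f y)) x (conjc d).
Proof.
move=> [f1 f2]; split.
  rewrite (_ : (fun _ => _) = fun y => complex.Re (f y)).
    by case: d f1 {f2}.
  by apply/funext => y; case: (f y).
rewrite (_ : (fun _ => _) = \- (fun y => complex.Im (f y))).
  by case: d f2 {f1} => a b /= f2; apply: is_deriveN.
by apply/funext => y /=; case: (f y).
Qed.

Lemma is_cderive_real (h : R -> R) x (a : R) : is_derive x 1 h a ->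
  is_cderive (fun y => (h y)%:C) x a%:C.
Proof. by move=> hd; split=> //=; apply: is_derive_cst. Qed.

Lemma is_derive_translate (h : R -> R) (s a : R) :
  is_derive (0 : R) 1 (fun r => h (s + r)) a -> is_derive s 1 h a.
Proof.
move=> hd.
have {}hd : is_derive (0 : R) 1 (fun r : R => h (r *: 1 + s)) a.
  by under eq_fun do rewrite /GRing.scale /= mulr1 addrC.
case: (hd) => hd1 hd2; apply: DeriveDef; first exact/derivable1P.
rewrite -hd2 /derive.
suff -> : (fun k : R => k^-1 *: (((fun r : R => h (r%:A + s)) \o shift 0) k%:A
    - h (0%:A + s))) = (fun k => k^-1 *: ((h \o shift s) k%:A - h s)) by [].
by apply/funext => r; rewrite /= addr0 scale0r add0r [(r%:A)%:A]mulr1.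
Qed.

Lemma is_derive_compR (h k : R -> R) (x dh dk : R) :
  is_derive x 1 h dh -> is_derive (h x) 1 k dk ->
  is_derive x 1 (fun y => k (h y)) (dk * dh).
Proof.
move=> [h1 h2] [k1 k2]; apply: DeriveDef.
  by apply/derivable1_diffP/differentiable_comp; apply/derivable1_diffP.
by rewrite -derive1E (derive1_comp h1 k1) !derive1E h2 k2.
Qed.

Lemma is_cderive_translate f (s : R) d :
  is_cderive (fun r => f (s + r)) 0 d -> is_cderive f s d.
Proof. by move=> [h1 h2]; split; apply: is_derive_translate. Qed.

Lemma is_cderive0_cst f : (forall x, is_cderive f x 0) -> forall x y, f x = f y.
Proof.
move=> f0 x y; apply/eqP; rewrite eq_complex; apply/andP; split; apply/eqP.
  by apply: (@is_derive_0_is_cst R (fun y => complex.Re (f y))) => z;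
    case: (f0 z).
by apply: (@is_derive_0_is_cst R (fun y => complex.Im (f y))) => z; case: (f0 z).
Qed.

End ComplexDerivative.

(** * One-parameter subgroups of SU(2) *)

Section Exponential.
Variable R : realType.
Local Notation C := R[i].
Implicit Types (X Y : su2 R) (g h t : SU2 R).

Lemma SU2_eq g h : val g = val h -> g = h.
Proof. exact: val_inj. Qed.

Lemma expmx0 : expmx 0 = 1%:M :> 'M[C]_2.
Proof.
rewrite /expmx; apply: (@cvg_lim _ (@norm_hausdorff _ (matrix C 2 2))).
apply: cvg_near_cst; exists 1%N => // -[//|n] _.
rewrite /series /= big_nat_recl // big1 ?addr0.
  by rewrite expr0 invr1 scale1r.
by move=> k _; rewrite expr0n scaler0.
Qed.

Lemma SU2_expE X (tau : R) : val X *m val X = - (tau ^+ 2)%:C *: 1%:M ->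
  (tau = 0 -> val X = 0) -> forall s, val (SU2_exp (su2_scale s X)) =
     (cos (s * tau))%:C *: 1%:M + (sin (s * tau) / tau)%:C *: val X.
Proof.
move=> XX X0 s /=; have [t0|t0] := eqVneq tau 0.
  by rewrite (X0 t0) !scaler0 expmx0 t0 mulr0 cos0 scale1r addr0.
have [->|s0] := eqVneq s 0.
  by rewrite scale0r expmx0 mul0r cos0 sin0 mul0r scale1r scale0r addr0.
rewrite (@expmx_su2E _ _ (s * tau)).
- rewrite scalerA -rmorphM; congr (_ + _%:C *: _); field.
  by rewrite s0 t0.
- by rewrite -scalemxAl -scalemxAr XX !scalerA; congr (_ *: _);
    rewrite -!rmorphN -!rmorphM /=; congr (_%:C); ring.
- by rewrite mulf_neq0.
Qed.

(** [tau] is the angular velocity of the one-parameter group of [X]. If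
    [tau = 0] then [X = 0], and the formula holds with [sin (s * tau) / tau = 0]. *)
Lemma SU2_exp_trig X : exists tau : R,
  [/\ val X *m val X = - (tau ^+ 2)%:C *: 1%:M, tau = 0 -> val X = 0 &
   forall s, val (SU2_exp (su2_scale s X)) =
     (cos (s * tau))%:C *: 1%:M + (sin (s * tau) / tau)%:C *: val X].
Proof.
have [tau [XX _ X0]] := su2_shape (valP X); exists tau; split=> //.
exact: SU2_expE.
Qed.

Lemma SU2_exp0 X : val (SU2_exp (su2_scale 0 X)) = 1%:M.
Proof. by rewrite /= scale0r expmx0. Qed.

Lemma SU2_expD X s r : SU2_exp (su2_scale (s + r) X) =
  SU2_mul (SU2_exp (su2_scale s X)) (SU2_exp (su2_scale r X)).
Proof.
have [tau [XX X0 E]] := SU2_exp_trig X; apply: SU2_eq.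
rewrite [RHS](_ : _ = val (SU2_exp (su2_scale s X)) *m val (SU2_exp (su2_scale r X))) //.
rewrite !E mulmxDl !mulmxDr -!scalemxAl -!scalemxAr !mul1mx.
rewrite mulmx1 XX !scalerA mulrDl cosD sinD.
have [t0|t0] := eqVneq tau 0.
  rewrite (X0 t0) t0 !mulr0 cos0 sin0 !mul0r !scaler0 !addr0 subr0 mulr1.
  rewrite rmorph1.
  by rewrite mulr1 add0r scale0r addr0.
rewrite -!rmorphN -!rmorphM [X in _ = _ + X]addrC addrACA -!scalerDl -!rmorphD /=.
by congr (_%:C *: _ + _%:C *: _); field.
Qed.

End Exponential.

(** * Left-invariant vector fields on SU(2) *)

Section LeftInvariant.
Variable R : realType.
Local Notation C := R[i].
Local Notation V := ('M[R]_2 * 'M[R]_2)%type.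
Implicit Types (X Y : su2 R) (g h t : SU2 R) (f k : SU2 R -> C) (u v : V -> R).

Definition lieD X f g : C :=
  cderive (fun s => f (SU2_mul g (SU2_exp (su2_scale s X)))) 0.

Lemma map_Re_mul (A B : 'M[C]_2) : map_mx (@complex.Re R) (A *m B) =
  map_mx (@complex.Re R) A *m map_mx (@complex.Re R) B -
  map_mx (@complex.Im R) A *m map_mx (@complex.Im R) B.
Proof.
apply/matrixP => i j; rewrite !mxE.
rewrite -sumrB (big_morph _ (@ReD R) (erefl : complex.Re (0 : C) = 0)).
by apply: eq_bigr => k _; rewrite ReM !mxE.
Qed.

Lemma map_Im_mul (A B : 'M[C]_2) : map_mx (@complex.Im R) (A *m B) =
  map_mx (@complex.Re R) A *m map_mx (@complex.Im R) B +
  map_mx (@complex.Im R) A *m map_mx (@complex.Re R) B.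
Proof.
apply/matrixP => i j; rewrite !mxE.
rewrite -big_split (big_morph _ (@ImD R) (erefl : complex.Im (0 : C) = 0)).
by apply: eq_bigr => k _; rewrite ImM !mxE.
Qed.

Lemma rmulmx_mul (A B : 'M[C]_2) (x : V) :
  rmulmx B (rmulmx A x) = rmulmx (A *m B) x.
Proof.
case: x => x1 x2; rewrite /rmulmx /= map_Re_mul map_Im_mul.
rewrite !mulmxDl !mulmxBr !mulmxDr !mulNmx !mulmxA; congr pair.
  by rewrite !opprD addrACA; congr (_ + _); exact: addrC.
by rewrite addrACA; congr (_ + _); exact: addrC.
Qed.

Lemma rmulmx_comb (a b : R) (A B : 'M[C]_2) (x : V) :
  rmulmx (a%:C *: A + b%:C *: B) x = a *: rmulmx A x + b *: rmulmx B x.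
Proof.
have E1 : map_mx (@complex.Re R) (a%:C *: A + b%:C *: B) =
    a *: map_mx (@complex.Re R) A + b *: map_mx (@complex.Re R) B.
  by apply/matrixP => i j; rewrite !mxE ReD !ReM /= !mul0r !subr0.
have E2 : map_mx (@complex.Im R) (a%:C *: A + b%:C *: B) =
    a *: map_mx (@complex.Im R) A + b *: map_mx (@complex.Im R) B.
  by apply/matrixP => i j; rewrite !mxE ImD !ImM /= !mul0r !addr0.
rewrite /rmulmx E1 E2 !mulmxDr -!scalemxAr; congr pair => /=.
  by rewrite !scalerBr opprD addrACA.
by rewrite !scalerDr addrACA.
Qed.

Lemma re_im_mul g h : re_im (SU2_mul g h) = rmulmx (val h) (re_im g).
Proof. by rewrite /re_im /rmulmx /= map_Re_mul map_Im_mul. Qed.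

Lemma rmulmx1 (x : V) : rmulmx 1%:M x = x.
Proof.
have E1 : map_mx (@complex.Re R) (1%:M : 'M[C]_2) = 1%:M.
  by apply/matrixP => i j; rewrite !mxE; case: (i == j).
have E2 : map_mx (@complex.Im R) (1%:M : 'M[C]_2) = 0.
  by apply/matrixP => i j; rewrite !mxE; case: (i == j).
by rewrite /rmulmx E1 E2 !mulmx1 !mulmx0 subr0 add0r; case: x.
Qed.

Lemma is_derive_curve u g X : differentiable u (re_im g) ->
  is_derive (0 : R) 1 (fun s => u (re_im (SU2_mul g (SU2_exp (su2_scale s X)))))
    ('D_(rmulmx (val X) (re_im g)) u (re_im g)).
Proof.
move=> ud; have [tau [_ X0 E]] := SU2_exp_trig X.
under eq_fun do rewrite re_im_mul E rmulmx_comb rmulmx1.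
set x := re_im g; set y := rmulmx _ x.
have md : is_derive (0 : R) 1 (fun s : R => s * tau) tau.
  have := is_deriveM (is_derive_id (0 : R) 1) (is_derive_cst tau (0 : R) 1).
  by move=> /is_derive_eq; apply; rewrite scaler0 add0r; exact: mulr1.
have cd : is_derive (0 : R) 1 (fun s : R => cos (s * tau)) 0.
  apply: is_derive_eq (is_derive_compR md (is_derive_cos _)) _.
  by rewrite mul0r sin0 oppr0 mul0r.
have sd : is_derive (0 : R) 1 (fun s : R => sin (s * tau) / tau) (tau / tau).
  have := is_deriveM (is_derive_compR md (is_derive_sin _))
    (is_derive_cst tau^-1 (0 : R) 1).
  move=> /is_derive_eq; apply; rewrite scaler0 add0r mul0r cos0 mul1r.
  exact: mulrC.
have yE : 0 *: x + (tau / tau) *: y = y.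
  rewrite scale0r add0r; have [t0|t0] := eqVneq tau 0.
    by rewrite /y (X0 t0) /rmulmx !map_mx0 !mulmx0 subr0 addr0 scaler0.
  by rewrite divff // scale1r.
have xE : cos (0 * tau) *: x + (sin (0 * tau) / tau) *: y = x.
  by rewrite mul0r cos0 sin0 mul0r scale1r scale0r addr0.
have := derive_along_curve cd sd; rewrite -/x in ud.
by move=> /(_ _ u x y); rewrite xE yE; apply.
Qed.

Lemma smooth_is_cderive f g X : smooth_SU2 f ->
  is_cderive (fun s => f (SU2_mul g (SU2_exp (su2_scale s X)))) 0 (lieD X f g).
Proof.
move=> [u [v [us vs fE]]].
have D : is_cderive (fun s => f (SU2_mul g (SU2_exp (su2_scale s X)))) 0
    ('D_(rmulmx (val X) (re_im g)) u (re_im g) +i*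
     'D_(rmulmx (val X) (re_im g)) v (re_im g)).
  by split; under eq_fun do rewrite fE /=;
    apply: is_derive_curve; apply: smooth_differentiable.
by rewrite /lieD (is_cderiveE D).
Qed.

(** In the matrix space, the left-invariant field of [X] is the linear vector
    field of right multiplication by [X]. *)
Lemma lieDE (u v : V -> R) f X g : smooth u -> smooth v ->
  (forall g, f g = u (re_im g) +i* v (re_im g)) ->
  lieD X f g = along (rmulmx (val X)) u (re_im g) +i*
               along (rmulmx (val X)) v (re_im g).
Proof.
move=> us vs fE; apply: is_cderiveE.
by split; under eq_fun do rewrite fE /=;
  apply: is_derive_curve; apply: smooth_differentiable.
Qed.

Lemma smooth_SU2_cst (c : C) : smooth_SU2 (fun=> c).
Proof.
by case: c => a b; exists (cst a), (cst b); split=> //; apply: smooth_cst.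
Qed.

Lemma smooth_SU2D f k : smooth_SU2 f -> smooth_SU2 k ->
  smooth_SU2 (fun g => f g + k g).
Proof.
move=> [u [v [us vs fE]]] [p [q [ps qs kE]]].
exists (u \+ p), (v \+ q); split=> [||g]; [exact: smoothD..|].
by rewrite fE kE.
Qed.

Lemma smooth_SU2M f k : smooth_SU2 f -> smooth_SU2 k ->
  smooth_SU2 (fun g => f g * k g).
Proof.
move=> [u [v [us vs fE]]] [p [q [ps qs kE]]].
exists ((u \* p) \+ (\- (v \* q))), ((u \* q) \+ (v \* p)); split=> [||g].
- by apply: smoothD; [exact: smoothM|apply/smoothN/smoothM].
- by apply: smoothD; apply: smoothM.
- by rewrite fE kE.
Qed.

Lemma smooth_SU2Z (c : C) f : smooth_SU2 f -> smooth_SU2 (fun g => c * f g).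
Proof. by apply: smooth_SU2M; exact: smooth_SU2_cst. Qed.

Lemma smooth_SU2_conj f : smooth_SU2 f -> smooth_SU2 (fun g => conjc (f g)).
Proof.
move=> [u [v [us vs fE]]]; exists u, (\- v); split=> //; first exact: smoothN.
by move=> g; rewrite fE.
Qed.

Lemma smooth_SU2X f n : smooth_SU2 f -> smooth_SU2 (fun g => f g ^+ n).
Proof.
move=> fs; elim: n => [|n IH]; first exact: (smooth_SU2_cst 1).
by under eq_fun do rewrite exprS; exact: smooth_SU2M.
Qed.

Lemma smooth_SU2_sum (I : Type) (r : seq I) (F : I -> SU2 R -> C) :
  (forall i, smooth_SU2 (F i)) -> smooth_SU2 (fun g => \sum_(i <- r) F i g).
Proof.
move=> Fs; elim: r => [|i r IH].
  by under eq_fun do rewrite big_nil; exact: smooth_SU2_cst.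
by under eq_fun do rewrite big_cons; exact: smooth_SU2D.
Qed.

Lemma smooth_SU2_coef (i j : 'I_2) : smooth_SU2 (fun g : SU2 R => val g i j).
Proof.
exists (coordV (true, i, j)), (coordV (false, i, j)).
split=> [||g]; [exact: (smooth_linear (@coordV_continuous R _))..|].
by rewrite /coordV /= !mxE; case: (\val g i j).
Qed.

Lemma smooth_lieD X f : smooth_SU2 f -> smooth_SU2 (lieD X f).
Proof.
move=> [u [v [us vs fE]]].
exists (along (rmulmx (val X)) u), (along (rmulmx (val X)) v).
split=> [||g]; last exact: lieDE.
- exact: (smooth_along (@coordV_continuous R) (@basisV_expand R)).
- exact: (smooth_along (@coordV_continuous R) (@basisV_expand R)).
Qed.

Lemma lieDD X f k g : smooth_SU2 f -> smooth_SU2 k ->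
  lieD X (fun g => f g + k g) g = lieD X f g + lieD X k g.
Proof.
by move=> fs ks; apply: is_cderiveE; apply: is_cderiveD; apply: smooth_is_cderive.
Qed.

Lemma lieDZ X (c : C) f g : smooth_SU2 f ->
  lieD X (fun g => c * f g) g = c * lieD X f g.
Proof.
by move=> fs; apply: is_cderiveE; apply: is_cderiveZ; apply: smooth_is_cderive.
Qed.

Lemma lieDM X f k g : smooth_SU2 f -> smooth_SU2 k ->
  lieD X (fun g => f g * k g) g = lieD X f g * k g + f g * lieD X k g.
Proof.
move=> fs ks; apply: is_cderiveE.
apply: is_cderive_eq
  (is_cderiveM (smooth_is_cderive g X fs) (smooth_is_cderive g X ks)) _.
by rewrite (_ : SU2_mul g _ = g) //; apply: SU2_eq => /=;
  rewrite scale0r expmx0 mulmx1.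
Qed.

Lemma lieD_conj X f g : smooth_SU2 f ->
  lieD X (fun g => conjc (f g)) g = conjc (lieD X f g).
Proof.
move=> fs; apply: is_cderiveE; apply: is_cderive_conj.
exact: smooth_is_cderive.
Qed.

Lemma lieD_cst X (c : C) g : lieD X (fun=> c) g = 0.
Proof. exact/is_cderiveE/is_cderive_cst. Qed.

(** One-parameter subgroups are homomorphisms, so a derivative at time [s] is a
    derivative at time [0] from a translated base point. *)
Lemma is_cderive_flow f g X s : smooth_SU2 f ->
  is_cderive (fun s => f (SU2_mul g (SU2_exp (su2_scale s X)))) s
    (lieD X f (SU2_mul g (SU2_exp (su2_scale s X)))).
Proof.
move=> fs; apply: is_cderive_translate.
have mulA (a b c : SU2 R) : SU2_mul a (SU2_mul b c) = SU2_mul (SU2_mul a b) c.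
  by apply: SU2_eq => /=; rewrite mulmxA.
under eq_fun do rewrite SU2_expD mulA.
exact: smooth_is_cderive.
Qed.

Lemma lieD_comb (a b : R) X Y W f g : smooth_SU2 f ->
  val W = a%:C *: val X + b%:C *: val Y ->
  lieD W f g = a%:C * lieD X f g + b%:C * lieD Y f g.
Proof.
move=> [u [v [us vs fE]]] WE; rewrite !(lieDE _ _ us vs fE) /along WE rmulmx_comb.
have E (w : V -> R) (x y z : V) : smooth w ->
    'D_(a *: y + b *: z) w x = a * 'D_y w x + b * 'D_z w x.
  by move=> ws; rewrite deriveDr ?deriveZr //; exact: smooth_differentiable.
have C2 (p q r s : R) : (a * p + b * q) +i* (a * r + b * s) =
    a%:C * (p +i* r) + b%:C * (q +i* s) by simpc.
by rewrite (E u _ _ _ us) (E v _ _ _ vs); exact: C2.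
Qed.

(** Commutators of linear fields reverse the order of the linear maps, and right
    multiplications compose in reverse order; the two reversals cancel. *)
Lemma lieD_bracket X Y W f g : smooth_SU2 f -> val W = ad (val X) (val Y) ->
  lieD X (lieD Y f) g - lieD Y (lieD X f) g = lieD W f g.
Proof.
move=> [u [v [us vs fE]]] WE.
have sa (Z : su2 R) (w : V -> R) : smooth w -> smooth (along (rmulmx (val Z)) w).
  exact: (smooth_along (@coordV_continuous R) (@basisV_expand R)).
rewrite (lieDE X g (sa Y _ us) (sa Y _ vs) (fun g => lieDE Y g us vs fE)).
rewrite (lieDE Y g (sa X _ us) (sa X _ vs) (fun g => lieDE X g us vs fE)).
rewrite (lieDE W g us vs fE).
have rm (x : V) : rmulmx (val Y) (rmulmx (val X) x) -
    rmulmx (val X) (rmulmx (val Y) x) = rmulmx (val W) x.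
  rewrite !rmulmx_mul WE /ad.
  have := rmulmx_comb 1 (-1) (val X *m val Y) (val Y *m val X) x.
  by rewrite rmorphN rmorph1 !scale1r !scaleN1r => ->.
have E (w : V -> R) : smooth w -> along (rmulmx (val X)) (along (rmulmx (val Y)) w) (re_im g)
    - along (rmulmx (val Y)) (along (rmulmx (val X)) w) (re_im g)
    = along (rmulmx (val W)) w (re_im g).
  move=> ws; rewrite [RHS]/along -rm.
  exact: (along_comm (@coordV_continuous R) (@basisV_expand R)
    (rmulmx (val X)) (rmulmx (val Y)) (re_im g) ws).
by rewrite -(E u us) -(E v vs).
Qed.

End LeftInvariant.

(** * Adapted bases and weights *)

Section Weights.
Variable R : realType.
Local Notation C := R[i].
Implicit Types (X Y : su2 R) (g h t : SU2 R) (f k : SU2 R -> C).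

Lemma conjcD (x y : C) : conjc (x + y) = conjc x + conjc y.
Proof. exact: rmorphD. Qed.
Lemma conjcN (x : C) : conjc (- x) = - conjc x.
Proof. exact: rmorphN. Qed.
Lemma conjcM (x y : C) : conjc (x * y) = conjc x * conjc y.
Proof. exact: rmorphM. Qed.
Lemma conjci : conjc ('i : C) = - 'i.
Proof. by rewrite /= ; apply/eqP; rewrite eq_complex /= oppr0 !eqxx. Qed.

Lemma is_su2P (X : 'M[C]_2) : conjc (X 0 0) = - X 0 0 -> conjc (X 1 0) = - X 0 1 ->
  conjc (X 1 1) = - X 1 1 -> X 0 0 + X 1 1 = 0 -> is_su2 X.
Proof.
move=> e00 e10 e11 e; apply/andP; split; last by rewrite tr22 e.
have e01 : conjc (X 0 1) = - X 1 0 by rewrite -[X 0 1]opprK -e10 conjcN conjcK.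
by apply/eqP; apply: mx22P; rewrite !mxE.
Qed.

Lemma adE (A B : 'M[C]_2) i j : ad A B i j =
  A i 0 * B 0 j + A i 1 * B 1 j - (B i 0 * A 0 j + B i 1 * A 1 j).
Proof. by rewrite /ad [LHS]mxE [X in _ + X]mxE !mul22. Qed.

(** The matrices orthogonal to the diagonal torus in su(2); both vectors of an
    adapted basis have this form, by [adapted_basisP]. *)
Definition offdiag (c : C) : 'M[C]_2 :=
  \matrix_(i, j) if i == j then 0 else if i == 0 then c else - conjc c.

Lemma offdiagE c : [/\ offdiag c 0 0 = 0, offdiag c 0 1 = c,
  offdiag c 1 0 = - conjc c & offdiag c 1 1 = 0].
Proof. by rewrite !mxE. Qed.

Lemma is_su2_offdiag c : is_su2 (offdiag c).
Proof.
have [e00 e01 e10 e11] := offdiagE c.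
apply: is_su2P; rewrite ?e00 ?e01 ?e10 ?e11 ?addr0 ?conjc0 ?oppr0 //.
by rewrite conjcN conjcK.
Qed.
Definition su2_offdiag c : su2 R := exist (@is_su2 R) _ (is_su2_offdiag c).

(** The bracket of the two vectors of an adapted basis, see [bracket_EF]. *)
Definition diagT : 'M[C]_2 :=
  \matrix_(i, j) if i == j then (if i == 0 then 'i / 4 else - ('i / 4)) else 0.

Lemma diagTE : [/\ diagT 0 0 = 'i / 4, diagT 0 1 = 0,
  diagT 1 0 = 0 & diagT 1 1 = - ('i / 4)].
Proof. by rewrite !mxE. Qed.

Lemma conjc_i4 : conjc ('i / 4 : C) = - ('i / 4).
Proof. by rewrite conjcM conjci conjc_inv conjc_nat mulNr. Qed.

Lemma is_su2_diagT : is_su2 diagT.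
Proof.
have [e00 e01 e10 e11] := diagTE.
apply: is_su2P; rewrite ?e00 ?e01 ?e10 ?e11 ?subrr ?conjc0 ?oppr0 //.
  exact: conjc_i4.
by rewrite conjcN conjc_i4.
Qed.
Definition su2_T : su2 R := exist (@is_su2 R) _ is_su2_diagT.

Lemma mxtrace_lin_mx (f : 'M[C]_2 -> 'M[C]_2) :
  \tr (lin_mx f) = \sum_i \sum_j f (delta_mx i j) i j.
Proof.
rewrite /mxtrace pair_big /=.
rewrite (reindex (uncurry (@mxvec_index 2 2))) /=; last exact: curry_mxvec_bij.
apply: eq_bigr => -[i j] _ /=.
by rewrite !mxE /= vec_mx_delta mxvecE.
Qed.

(** With [X = offdiag c], [X ^ 2] is scalar and [X] has zero diagonal, so
    all four diagonal coefficients of [ad X \o ad X] on elementary matrices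
    equal [- 2 |c| ^ 2]. *)
Lemma killing_offdiag (c : C) : killing (offdiag c) (offdiag c) = - (8 * (c * conjc c)).
Proof.
have [e00 e01 e10 e11] := offdiagE c.
have sq : offdiag c *m offdiag c = - (c * conjc c) *: 1%:M.
  by apply: mx22P; rewrite mul22 ?e00 ?e01 ?e10 ?e11 !mxE /=; ring.
rewrite /killing mxtrace_lin_mx.
have E i j : ad (offdiag c) (ad (offdiag c) (delta_mx i j)) i j = - (2 * (c * conjc c)).
  rewrite /ad mulmxBr mulmxBl !mulmxA sq -[delta_mx i j *m _ *m _]mulmxA sq.
  rewrite -!scalemxAl -scalemxAr mul1mx mulmx1.
  have -> : offdiag c *m delta_mx i j *m offdiag c = \matrix_(k, l) (offdiag c k i * offdiag c j l).
    apply/matrixP => k l; rewrite mxE mxE (bigD1 j) //= big1 ?addr0; last first.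
      move=> m mj; rewrite mxE big1 ?mul0r // => n _.
      by rewrite [delta_mx _ _ _ _]mxE (negPf mj) andbF mulr0.
    rewrite mxE (bigD1 i) //= big1 ?addr0; last first.
      by move=> m mi; rewrite [delta_mx _ _ _ _]mxE (negPf mi) mulr0.
    by rewrite [delta_mx _ _ _ _]mxE !eqxx mulr1.
  by rewrite !mxE !eqxx /=; ring.
under eq_bigr do under eq_bigr do rewrite E.
by rewrite !sumr_const !card_ord; ring.
Qed.

(** Tested on the single element [su2_T], the root conditions kill the diagonals
    of [E] and [F] and tie their off-diagonal entries by a factor ['i]; the
    length of [E] then fixes the modulus of the remaining entry. *)
Lemma adapted_basisP (E F : su2 R) : adapted_basis E F ->
  exists b : C, [/\ 8 * (b * conjc b) = 1, E = su2_offdiag b & F = su2_offdiag ('i * b)].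
Proof.
move=> [_ [gE _ _] [_ rZ] [_ rZb]].
have [d00 d01 d10 d11] := diagTE.
have tT : in_t su2_T.
  apply/is_diag_mxP => i j ij; rewrite mxE; case: eqP => // eij.
  by rewrite eij eqxx in ij.
have i0 : ('i : C) != 0 by rewrite eq_complex /= oner_eq0 andbF.
have n2 : (2 : C) != 0 by rewrite pnatr_eq0.
have aT : alpha (val su2_T) = 'i / 2 by rewrite /alpha d00 d11; field.
have a0 : alpha (val su2_T) != 0 by rewrite aT mulf_neq0 // invr_eq0.
have zero (x : C) : (alpha (val su2_T)) * x = 0 -> x = 0.
  by move/eqP; rewrite mulf_eq0 (negPf a0) => /eqP.
have rE (Z : 'M[C]_2) (c : C) : ad (val su2_T) Z = c *: Z ->
    [/\ c * Z 0 0 = 0, c * Z 1 1 = 0, c * Z 0 1 = 'i / 2 * Z 0 1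
     & c * Z 1 0 = - ('i / 2) * Z 1 0].
  move=> /matrixP H; move: (H 0 0) (H 0 1) (H 1 0) (H 1 1).
  rewrite !adE d00 d01 d10 d11 ![(c *: Z) _ _]mxE => <- <- <- <-.
  by split; field.
have [z00 z11 _ z10] := rE _ _ (rZ su2_T tT).
have [w00 w11 w01 _] := rE _ _ (rZb su2_T tT).
have zE i j : (2^-1 *: (val E - 'i *: val F)) i j =
    2^-1 * (val E i j - 'i * val F i j) by rewrite !mxE.
have wE i j : (2^-1 *: (val E + 'i *: val F)) i j =
    2^-1 * (val E i j + 'i * val F i j) by rewrite !mxE.
move: z00 z11 z10 w00 w11 w01; rewrite !zE !wE aT {zE wE} => z00 z11 z10 w00 w11 w01.
have canc (x : C) : 'i / 2 * (2^-1 * x) = 0 -> x = 0.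
  by move/eqP; rewrite !mulf_eq0 invr_eq0 (negPf i0) (negPf n2) /= => /eqP.
have cancN (x : C) : - ('i / 2) * (2^-1 * x) = 0 -> x = 0.
  by rewrite mulNr => /eqP; rewrite oppr_eq0 => /eqP/canc.
have canc2 (x : C) : 'i / 2 * (2^-1 * x) = - ('i / 2) * (2^-1 * x) -> x = 0.
  move=> H; apply: canc; apply: (mulfI n2); rewrite mulr0.
  by rewrite mulr_natl mulr2n {1}H mulNr addNr.
have lin (x y : C) : x - 'i * y = 0 -> x + 'i * y = 0 -> x = 0 /\ y = 0.
  move=> h1 h2; have x0 : x = 0.
    apply: (mulfI n2); rewrite mulr0 -[RHS]addr0 -{1}h1 -h2; ring.
  split=> //; apply: (mulfI i0); by move: h2; rewrite x0 add0r mulr0.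
have [E00 F00] := lin _ _ (canc _ z00) (cancN _ w00).
have [E11 F11] := lin _ _ (canc _ z11) (cancN _ w11).
have E10F := canc2 _ z10; have E01F := canc2 _ (esym w01).
have su (X : su2 R) i j : conjc (val X j i) = - val X i j.
  by case/andP: (valP X) => /eqP/matrixP/(_ i j); rewrite !mxE.
pose b := val E 0 1.
have EE : val E = offdiag b.
  have [e00 e01 e10 e11] := offdiagE b.
  apply: mx22P; rewrite ?e00 ?e01 ?e10 ?e11 //.
  by rewrite /b su opprK.
have F01 : val F 0 1 = 'i * b.
  apply: (mulfI i0); rewrite mulrA -expr2 sqr_i mulN1r.
  by apply/eqP; rewrite -addr_eq0 addrC; apply/eqP.
have FE : val F = offdiag ('i * b).
  have [e00 e01 e10 e11] := offdiagE ('i * b).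
  apply: mx22P; rewrite ?e00 ?e01 ?e10 ?e11 //.
  by rewrite -F01 su opprK.
exists b; split; [|exact: val_inj..].
by move: gE; rewrite /g0 EE killing_offdiag opprK.
Qed.

Lemma TP t : in_T t -> [/\ val t 0 1 = 0, val t 1 0 = 0,
  val t 1 1 = conjc (val t 0 0) & val t 0 0 * conjc (val t 0 0) = 1].
Proof.
move=> /is_diag_mxP tD.
have t01 : val t 0 1 = 0 by exact: tD.
have t10 : val t 1 0 = 0 by exact: tD.
have [/unitarymxP/matrixP/(_ 0 0) tU /eqP tdet] := andP (valP t).
rewrite det22 t01 mul0r subr0 in tdet.
rewrite mul22 t01 mul0r addr0 !mxE /= in tU.
have tU' : val t 0 0 * conjc (val t 0 0) = 1 by [].
split=> //; rewrite -[RHS]mul1r -tdet -[RHS]mulrA [val t 1 1 * _]mulrC mulrA.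
by rewrite tU' mul1r.
Qed.

Lemma T_neq0 t : in_T t -> val t 0 0 != 0.
Proof.
by case/TP=> _ _ _ tU; apply: contra_eq_neq tU => ->; rewrite mul0r eq_sym oner_eq0.
Qed.

(** [f] has weight [m] under right translation by the torus, [m] counting
    multiples of the fundamental weight. *)
Definition has_weight (m : int) f : Prop :=
  forall g t, in_T t -> f (SU2_mul g t) = val t 0 0 ^ m * f g.

Lemma has_weightM m n f k : has_weight m f -> has_weight n k ->
  has_weight (m + n) (fun g => f g * k g).
Proof.
move=> fm kn g t tT; rewrite fm // kn // expfzDr ?T_neq0 //; ring.
Qed.

Lemma has_weightD m f k : has_weight m f -> has_weight m k ->
  has_weight m (fun g => f g + k g).
Proof. by move=> fm km g t tT; rewrite fm // km // mulrDr. Qed.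

Lemma has_weightZ m c f : has_weight m f -> has_weight m (fun g => c * f g).
Proof. by move=> fm g t tT; rewrite fm // mulrCA. Qed.

Lemma has_weight_conj m f : has_weight m f ->
  has_weight (- m) (fun g => conjc (f g)).
Proof.
move=> fm g t tT; rewrite fm // conjcM; congr (_ * _).
have [_ _ _ tU] := TP tT.
have tE : conjc (val t 0 0) = (val t 0 0)^-1.
  by apply: (mulfI (T_neq0 tT)); rewrite tU divff // T_neq0.
rewrite -exprz_inv -tE; apply: (rmorphXz conjc).
by rewrite unitfE T_neq0.
Qed.

Lemma SU2_exp_conj X Y t : val t *m val X = val Y *m val t ->
  forall s, SU2_mul t (SU2_exp (su2_scale s X)) =
            SU2_mul (SU2_exp (su2_scale s Y)) t.
Proof.
move=> XY s; have [tau [XX X0 XE]] := SU2_exp_trig X.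
have tu : val t \in unitmx by apply: unitarymx_unit; case/andP: (valP t).
have Y2 : val Y *m val Y = - (tau ^+ 2)%:C *: 1%:M.
  apply: (can_inj (mulmxK tu)); rewrite -!mulmxA -XY mulmxA -XY -mulmxA XX.
  by rewrite -scalemxAl -scalemxAr mul1mx mulmx1.
have Y0 : tau = 0 -> val Y = 0.
  by move=> /X0 X00; apply: (can_inj (mulmxK tu)); rewrite -XY X00 mulmx0 mul0mx.
apply: SU2_eq; change (val t *m val (SU2_exp (su2_scale s X)) =
  val (SU2_exp (su2_scale s Y)) *m val t); rewrite XE (SU2_expE Y2 Y0).
by rewrite mulmxDr mulmxDl -!scalemxAr -!scalemxAl mulmx1 mul1mx XY.
Qed.

(** Right translation by [t] carries the one-parameter subgroup of [X] to
    that of [Y = Ad t X]. *)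
Lemma lieD_weight m f X Y g t : smooth_SU2 f -> has_weight m f -> in_T t ->
  val t *m val X = val Y *m val t ->
  lieD X f (SU2_mul g t) = val t 0 0 ^ m * lieD Y f g.
Proof.
move=> fs fm tT XY; apply: is_cderiveE.
have E s : f (SU2_mul (SU2_mul g t) (SU2_exp (su2_scale s X))) =
    val t 0 0 ^ m * f (SU2_mul g (SU2_exp (su2_scale s Y))).
  rewrite -fm //; congr f; apply: SU2_eq.
  have /(congr1 val) /= := SU2_exp_conj XY s.
  by rewrite -!mulmxA => ->.
by under eq_fun do rewrite E; apply: is_cderiveZ; exact: smooth_is_cderive.
Qed.

Lemma mx_combE (a b : C) (A B : 'M[C]_2) i j :
  (a *: A + b *: B) i j = a * A i j + b * B i j.
Proof. by rewrite !mxE. Qed.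

Lemma lieD_offdiag (p q : R) c f g : smooth_SU2 f ->
  lieD (su2_offdiag ((p +i* q) * c)) f g =
  p%:C * lieD (su2_offdiag c) f g + q%:C * lieD (su2_offdiag ('i * c)) f g.
Proof.
move=> fs; apply: lieD_comb => //=.
have [e00 e01 e10 e11] := offdiagE ((p +i* q) * c).
have [c00 c01 c10 c11] := offdiagE c.
have [i00 i01 i10 i11] := offdiagE ('i * c).
have pq : p +i* q = p%:C + q%:C * 'i by simpc.
apply: mx22P; rewrite mx_combE.
- by rewrite e00 c00 i00 !mulr0 addr0.
- by rewrite e01 c01 i01 pq; ring.
- by rewrite e10 c10 i10 pq !conjcM conjcD conjcM !conjc_real conjci; ring.
- by rewrite e11 c11 i11 !mulr0 addr0.
Qed.

Lemma SU2_exp_T s : val (SU2_exp (su2_scale s su2_T)) =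
  (cos (s / 4))%:C *: 1%:M + (sin (s / 4) / 4^-1)%:C *: diagT.
Proof.
have [d00 d01 d10 d11] := diagTE.
apply: (@SU2_expE _ su2_T 4^-1); last first.
  by move/eqP; rewrite invr_eq0 pnatr_eq0.
have i2 : ('i / 4 : C) * ('i / 4) = - ((4^-1 : R) ^+ 2)%:C.
  rewrite rmorphXn fmorphV rmorph_nat mulrACA -['i * 'i]expr2 sqr_i.
  by field.
apply: mx22P; rewrite mul22 ?d00 ?d01 ?d10 ?d11 !mxE /= ?mulr1 ?mulr0.
- by rewrite i2 addr0.
- by rewrite mul0r addr0.
- by rewrite mul0r addr0.
- by rewrite mulrNN i2 add0r.
Qed.

(** Along the one-parameter subgroup of [su2_T] the entry [t 0 0] of the torus
    element is [exp ('i * s / 4)]. *)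
Lemma lieD_T m f g : smooth_SU2 f -> has_weight m f ->
  lieD su2_T f g = m%:~R * ('i / 4) * f g.
Proof.
move=> fs fm; have [d00 d01 d10 d11] := diagTE.
pose e s := cos (s / 4) +i* sin (s / 4) : C.
have eE s : val (SU2_exp (su2_scale s su2_T)) 0 0 = e s.
  rewrite SU2_exp_T mx_combE mxE d00 mulr1.
  rewrite /e invrK rmorphM rmorph_nat /=.
  rewrite (_ : cos (s / 4) +i* sin (s / 4) =
    (cos (s / 4))%:C + (sin (s / 4))%:C * 'i); last by simpc.
  by field.
have eT s : in_T (SU2_exp (su2_scale s su2_T)).
  apply/is_diag_mxP => i j ij; rewrite SU2_exp_T mx_combE !mxE.
  have {}ij : (i == j) = false by apply/negP => /eqP eij; rewrite eij eqxx in ij.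
  by rewrite ij !mulr0 addr0.
have md (a : R) : is_derive (0 : R) 1 (fun s : R => s * a) a.
  have := is_deriveM (is_derive_id (0 : R) 1) (is_derive_cst a (0 : R) 1).
  by move=> /is_derive_eq; apply; rewrite scaler0 add0r; exact: mulr1.
have cd : is_derive (0 : R) 1 (fun s : R => cos (s / 4)) 0.
  apply: is_derive_eq (is_derive_compR (md _) (is_derive_cos _)) _.
  by rewrite mul0r sin0 oppr0 mul0r.
have sd : is_derive (0 : R) 1 (fun s : R => sin (s / 4)) 4^-1.
  apply: is_derive_eq (is_derive_compR (md _) (is_derive_sin _)) _.
  by rewrite mul0r cos0 mul1r.
have ed : is_cderive e 0 ('i / 4).
  apply: is_cderive_eq (_ : is_cderive e 0 (0 +i* 4^-1)) _; first by split.
  rewrite -(rmorph_nat (real_complex R) 4) -fmorphV.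
  by simpc.
have e0 : e 0 = 1 by rewrite /e mul0r cos0 sin0.
have en s : e s * conjc (e s) = 1.
  rewrite /e /=; simpc; rewrite -!expr2 cos2Dsin2; congr (_ +i* _); ring.
have em : is_cderive (fun s => e s ^ m) 0 (m%:~R * ('i / 4)).
  case: m {fm} => n.
    apply: is_cderive_eq (is_cderiveX n ed) _.
    by rewrite e0 expr1n mulr1.
  have eV s : e s ^ Negz n = conjc (e s) ^+ n.+1.
    rewrite NegzE -exprz_inv; congr (_ ^+ _).
    have e0' : e s != 0.
      by apply: contra_eq_neq (en s) => ->; rewrite mul0r eq_sym oner_eq0.
    by apply: (mulfI e0'); rewrite en divff.
  under eq_fun do rewrite eV.
  apply: is_cderive_eq (is_cderiveX n.+1 (is_cderive_conj ed)) _.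
  by rewrite e0 conjc1 expr1n mulr1 conjc_i4 NegzE mulrNz mulrN mulNr.
apply: is_cderiveE.
under eq_fun do rewrite fm // eE.
apply: is_cderive_eq (is_cderiveM em (is_cderive_cst _ (f g))) _.
by rewrite mulr0 addr0.
Qed.

End Weights.

(** * Compactness and maxima on SU(2) *)

Section Maxima.
Variable R : realType.
Local Notation C := R[i].
Local Notation V := ('M[R]_2 * 'M[R]_2)%type.
Implicit Types (X Y : su2 R) (g h t : SU2 R) (f k : SU2 R -> C).

Lemma SU2_shape g : [/\ val g 1 1 = conjc (val g 0 0),
  val g 0 1 = - conjc (val g 1 0) &
  val g 0 0 * conjc (val g 0 0) + val g 1 0 * conjc (val g 1 0) = 1].
Proof.
have [/unitarymxP/matrixP gU /eqP gd] := andP (valP g); rewrite det22 in gd.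
have u00 := gU 0 0; have u01 := gU 0 1; have u10 := gU 1 0; have u11 := gU 1 1.
rewrite mul22 !mxE /= in u00; rewrite mul22 !mxE /= in u01.
rewrite mul22 !mxE /= in u10; rewrite mul22 !mxE /= in u11.
move: gd u00 u01 u10 u11.
rewrite -![_^*%R]/(conjc _).
set a := val g 0 0; set b := val g 0 1; set c := val g 1 0; set d := val g 1 1.
move=> gd u00 u01 u10 u11.
have {}u00 : a * conjc a + b * conjc b = 1 := u00.
have {}u11 : c * conjc c + d * conjc d = 1 := u11.
have dE : d = conjc a.
  rewrite -[LHS]mul1r -{1}u00 -[RHS]mul1r -{1}gd mulrDl.
  have -> : a * conjc a * d + b * conjc b * d =
    conjc a * (a * d - b * c) + b * (c * conjc a + d * conjc b) by ring.
  by rewrite u10 mulr0 addr0 mulrC.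
have bE : b = - conjc c.
  rewrite -[LHS]mul1r -{1}u11 -[RHS]mul1r -{1}gd mulrDl.
  have -> : c * conjc c * b + d * conjc d * b =
    - conjc c * (a * d - b * c) + d * (a * conjc c + b * conjc d) by ring.
  by rewrite u01 mulr0 addr0 mulrC.
split=> //; rewrite -gd dE bE; ring.
Qed.

Definition mkSU2_mx (a b : C) : 'M[C]_2 :=
  \matrix_(i, j) if i == 0 then (if j == 0 then a else - conjc b)
                 else (if j == 0 then b else conjc a).

Lemma is_SU2_mk (a b : C) : a * conjc a + b * conjc b = 1 ->
  is_SU2 (mkSU2_mx a b).
Proof.
move=> ab; apply/andP; split; last first.
  by rewrite det22 !mxE /= -ab; apply/eqP; ring.
apply/unitarymxP; apply: mx22P; rewrite mul22 !mxE /= -?[_^*%R]/(conjc _)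
  ?conjcN ?conjcK.
- by rewrite -ab; ring.
- ring.
- ring.
- by rewrite -ab; ring.
Qed.

Definition mkSU2 a b ab : SU2 R := exist (@is_SU2 R) _ (@is_SU2_mk a b ab).

Lemma matrix2P (T : Type) (A B : 'M[T]_2) : A 0 0 = B 0 0 -> A 0 1 = B 0 1 ->
  A 1 0 = B 1 0 -> A 1 1 = B 1 1 -> A = B.
Proof.
move=> e00 e01 e10 e11; apply/matrixP => i j.
have H (k : 'I_2) : k = 0 \/ k = 1.
  by case: k => [[|[|//]] kP]; [left|right]; apply: val_inj.
by case: (H i) => ->; case: (H j) => ->.
Qed.

(** SU(2) is the image of the unit sphere of R^4 under this linear map, which
    makes it compact. *)
Definition embed4 (p : 'rV[R]_4) : V :=
  (p 0 (inord 0) *: (1%:M, 0) +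
   p 0 (inord 1) *: (0, \matrix_(i, j) if i == j then (-1) ^+ i else 0)) +
  (p 0 (inord 2) *: (\matrix_(i, j) if i == j then 0 else - (-1) ^+ i, 0) +
   p 0 (inord 3) *: (0, \matrix_(i, j) if i == j then 0 else 1)).

Definition sphere4 : set 'rV[R]_4 :=
  [set p | p 0 (inord 0) ^+ 2 + p 0 (inord 1) ^+ 2 +
           p 0 (inord 2) ^+ 2 + p 0 (inord 3) ^+ 2 = 1].

Lemma embed4_continuous : continuous embed4.
Proof.
move=> p; have c (k : 'I_4) (w : V) : {for p, continuous (fun p : 'rV[R]_4 => p 0 k *: w)}.
  by apply: continuousZr_tmp; exact: coord_continuous.
exact: (continuousD (continuousD (c _ _) (c _ _)) (continuousD (c _ _) (c _ _))).
Qed.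

Lemma sqr_le1 (x : R) : x ^+ 2 <= 1 -> -1 <= x <= 1.
Proof.
by rewrite -ler_norml -(@expr_le1 _ 2 `|x|) // real_normK ?num_real.
Qed.

Lemma sphere4_compact : compact sphere4.
Proof.
apply: (@subclosed_compact _ _
    [set v : 'rV[R]_4 | forall i, `[(-1 : R), 1]%classic (v ord0 i)]).
- rewrite (_ : sphere4 = (fun p => p 0 (inord 0) ^+ 2 + p 0 (inord 1) ^+ 2 +
           p 0 (inord 2) ^+ 2 + p 0 (inord 3) ^+ 2) @^-1` [set x | x = 1]) //.
  apply: preimage_closed; last exact: closed_eq.
  move=> p _.
  have c (k : 'I_4) : {for p, continuous (fun p : 'rV[R]_4 => p 0 k ^+ 2)}.
    apply: (@continuous_comp _ _ _ (fun p : 'rV[R]_4 => p 0 k) (fun x => x ^+ 2)).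
      exact: coord_continuous.
    exact: exprn_continuous.
  exact: (continuousD (continuousD (continuousD (c _) (c _)) (c _)) (c _)).
- by apply: (@rV_compact R 4 (fun=> `[(-1 : R), 1]%classic)) => i;
    exact: segment_compact.
- move=> p pS i /=; rewrite in_itv /=; apply: sqr_le1; rewrite -pS.
  have sq (k : 'I_4) : 0 <= p 0 k ^+ 2 by exact: sqr_ge0.
  have := sq (inord 0); have := sq (inord 1).
  have := sq (inord 2); have := sq (inord 3).
  have -> : i = inord i by rewrite inord_val.
  by case: i => [[|[|[|[|//]]]] iP] /=; lra.
Qed.

Lemma embed4_SU2 p : sphere4 p -> exists g, re_im g = embed4 p.
Proof.
rewrite /sphere4 /embed4 /=.
set p0 := p 0 _; set p1 := p 0 _; set p2 := p 0 _; set p3 := p 0 _ => pS.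
have ab : (p0 +i* p1) * conjc (p0 +i* p1) + (p2 +i* p3) * conjc (p2 +i* p3) = 1.
  by rewrite /=; simpc; apply/eqP; rewrite eq_complex /= -pS; apply/andP; split;
    apply/eqP; ring.
exists (mkSU2 ab); rewrite /re_im /=.
by congr pair; apply: matrix2P; rewrite !mxE /=; ring.
Qed.

Lemma SU2_embed4 g : exists2 p, sphere4 p & embed4 p = re_im g.
Proof.
have [e11 e01 ab] := SU2_shape g.
exists (\row_k nth 0 [:: complex.Re (val g 0 0); complex.Im (val g 0 0);
  complex.Re (val g 1 0); complex.Im (val g 1 0)] k).
  rewrite /sphere4 /= !mxE !inordK //=.
  move: ab; case: (val g 0 0) => a b; case: (val g 1 0) => c d /=.
  by simpc => -[<- _]; ring.
rewrite /embed4 !mxE !inordK //= /re_im.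
by congr pair; apply: matrix2P; rewrite !mxE ?e11 ?e01 /=;
  case: (sval g 0 0) => a b; case: (sval g 1 0) => c d /=; ring.
Qed.

Lemma SU2_max (u : V -> R) : continuous u ->
  exists g0, forall g, u (re_im g) <= u (re_im g0).
Proof.
move=> uc; have S0 : sphere4 !=set0.
  have one : (1 : C) * conjc 1 + 0 * conjc 0 = 1 by rewrite conjc1 conjc0; ring.
  by have [p pS _] := SU2_embed4 (mkSU2 one); exists p.
have cu : {within sphere4, continuous (u \o embed4)}.
  apply: continuous_subspaceT => p.
  by apply: continuous_comp; [exact: embed4_continuous|exact: uc].
have [p pS pmax] := EVT_max_rV S0 sphere4_compact cu.
rewrite inE in pS; have [g0 g0E] := embed4_SU2 pS.
exists g0 => g; have [q qS <-] := SU2_embed4 g.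
by rewrite g0E; apply: pmax; rewrite inE.
Qed.

(** Otherwise [h] would increase strictly just after [0]. *)
Lemma second_derivative_max (h h1 : R -> R) (d : R) :
  (forall s : R, is_derive s 1 h (h1 s)) -> is_derive (0 : R) 1 h1 d ->
  (forall s, h s <= h 0) -> d <= 0.
Proof.
move=> hd h1d hmax; rewrite leNgt; apply/negP => d0.
have h10 : h1 0 = 0.
  have [] := @derive1_at_max R h (-1) 1 0.
  - lra.
  - by move=> t _; case: (hd t).
  - by rewrite in_itv /=; apply/andP; split; lra.
  - by move=> t _.
  by move=> _; case: (hd 0) => _ <-.
have [/cvg_ex[l hl] dE] := h1d.
have {}hl : h^-1 *: (h1 (h *: (1 : R) + 0) - h1 0) @[h --> (0 : R)^'] --> d.
  by rewrite -dE /derive; apply/cvg_ex; exists l.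
have : \forall k \near (0 : R)^', 0 < k^-1 *: (h1 (k *: (1 : R) + 0) - h1 0).
  by apply: cvgr_gt d0; exact: hl.
rewrite near_withinE => /nbhs_ballP[e /= e0 eP].
have e20 : 0 < e / 2 by rewrite divr_gt0.
have hc : {within `[0, e / 2], continuous h}.
  apply: continuous_subspaceT => s; apply: differentiable_continuous.
  by apply/derivable1_diffP; case: (hd s).
have [c cI cE] := MVT e20 (fun s _ => hd s) hc.
move: cI; rewrite in_itv /= => /andP[c0 ce].
have c1 : 0 < c^-1 * h1 c.
  have := eP c; rewrite addr0 h10 subr0 /GRing.scale /= mulr1; apply.
    by rewrite -ball_normE /= sub0r normrN gtr0_norm //; lra.
  by rewrite gt_eqF.
have h1c : 0 < h1 c by rewrite pmulr_rgt0 ?invr_gt0 in c1.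
have := hmax (e / 2); rewrite -subr_le0 cE subr0.
by rewrite leNgt mulr_gt0.
Qed.

Lemma lieD_max f X g : smooth_SU2 f ->
  (forall h, complex.Re (f h) <= complex.Re (f g)) ->
  complex.Re (lieD X (lieD X f) g) <= 0.
Proof.
move=> fs fmax.
pose c s := SU2_mul g (SU2_exp (su2_scale s X)).
have c0 : c 0 = g by apply: SU2_eq; rewrite /= scale0r expmx0 mulmx1.
apply: (@second_derivative_max (fun s => complex.Re (f (c s)))
  (fun s => complex.Re (lieD X f (c s)))).
- by move=> s; case: (is_cderive_flow g X s fs).
- have [+ _] := is_cderive_flow g X 0 (smooth_lieD X fs).
  by rewrite -/(c 0) c0.
- by move=> s; rewrite c0.
Qed.

Lemma smooth_SU2_max f : smooth_SU2 f ->
  exists g0, forall g, complex.Re (f g) <= complex.Re (f g0).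
Proof.
move=> [u [v [us vs fE]]].
have [|g0 gmax] := @SU2_max u.
  by move=> x; apply/differentiable_continuous/smooth_differentiable.
by exists g0 => g; rewrite !fE /=.
Qed.

(** A Cayley-Hamilton logarithm: off the centre, [X] is the multiple of
    [g - Re (g 0 0)] with the right angular velocity. *)
Lemma SU2_exp_surj g : exists X, g = SU2_exp (su2_scale 1 X).
Proof.
have [g11 g01 ab] := SU2_shape g.
case A : (val g 0 0) ab g11 => [a a'] ab g11.
case B : (val g 1 0) ab g01 => [c d] ab g01.
have {}ab : a ^+ 2 + a' ^+ 2 + c ^+ 2 + d ^+ 2 = 1.
  by move: ab; rewrite /=; simpc => -[<- _]; ring.
have a1 : -1 <= a <= 1.
  have := sqr_ge0 a'; have := sqr_ge0 c; have := sqr_ge0 d.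
  move=> d2 c2 a2; apply: sqr_le1; lra.
pose th := acos a; have cth : cos th = a by exact: acosK.
have s2 : sin th ^+ 2 = a' ^+ 2 + c ^+ 2 + d ^+ 2.
  by have := cos2Dsin2 th; rewrite cth; lra.
have [s0|s0] := eqVneq (sin th) 0.
  move: s2; rewrite s0 expr0n /= => s2.
  have := sqr_ge0 a'; have := sqr_ge0 c; have := sqr_ge0 d => d2 c2 a2.
  have a'0 : a' = 0 by apply/eqP; rewrite -sqrf_eq0; apply/eqP; lra.
  have c0 : c = 0 by apply/eqP; rewrite -sqrf_eq0; apply/eqP; lra.
  have d0 : d = 0 by apply/eqP; rewrite -sqrf_eq0; apply/eqP; lra.
  exists (su2_scale (4 * th) (su2_T R)).
  have -> : su2_scale 1 (su2_scale (4 * th) (su2_T R)) = su2_scale (4 * th) (su2_T R).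
    by apply: val_inj; rewrite /= scale1r.
  apply: SU2_eq; rewrite SU2_exp_T mulrAC divff ?pnatr_eq0 // mul1r s0 mul0r.
  rewrite scale0r addr0 cth.
  apply: mx22P; rewrite !mxE /= ?A ?B ?g11 ?g01 ?a'0 ?c0 ?d0 /= ?mulr0 ?mulr1 //.
  - by apply/eqP; rewrite eq_complex /= !oppr0 !eqxx.
  - by rewrite oppr0.
have th0 : th != 0 by apply: contra_neq s0 => ->; rewrite sin0.
pose N : 'M[C]_2 := val g - a%:C *: 1%:M.
have [N00 N01 N10 N11] : [/\ N 0 0 = 0 +i* a', N 0 1 = - (conjc (c +i* d)),
    N 1 0 = c +i* d & N 1 1 = 0 -i* a'].
  rewrite !mxE A B g11 g01 /= !mulr0 !mulr1 !subr0; split=> //.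
  - by apply/eqP; rewrite eq_complex /= subrr subr0 !eqxx.
  - by apply/eqP; rewrite eq_complex /= subrr subr0 !eqxx.
have NN : N *m N = - (sin th ^+ 2)%:C *: 1%:M.
  have sE (r : C) i j : (r *: (1%:M : 'M[C]_2)) i j = r * (i == j)%:R.
    by rewrite !mxE.
  rewrite s2; apply: mx22P; rewrite mul22 ?N00 ?N01 ?N10 ?N11 sE /=; simpc;
    congr (_ +i* _); ring.
have NP : is_su2 N.
  apply: is_su2P; rewrite ?N00 ?N01 ?N10 ?N11 /=; simpc => //;
   congr (_ +i* _); ring.
pose X := su2_scale (th / sin th) (exist (@is_su2 R) N NP).
have XX : val X *m val X = - (th ^+ 2)%:C *: 1%:M.
  rewrite /= -scalemxAl -scalemxAr NN !scalerA -!rmorphN -!rmorphM /=.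
  by congr (_%:C *: _); field.
exists X; apply: SU2_eq; rewrite (SU2_expE XX) => [|t0]; last first.
  by rewrite t0 eqxx in th0.
rewrite mul1r cth /= scalerA -rmorphM /=.
have -> : sin th / th * (th / sin th) = 1 by field; rewrite th0 s0.
by rewrite rmorph1 scale1r addrC subrK.
Qed.

End Maxima.

(** * Ladder operators *)

Section Ladder.
Variables (R : realType) (b : R[i]).
Hypothesis b_norm : 8 * (b * conjc b) = 1.
Local Notation C := R[i].
Local Notation T := (su2_T R).
Local Notation E := (su2_offdiag b).
Local Notation F := (su2_offdiag ('i * b)).
Implicit Types (X Y : su2 R) (g h t : SU2 R) (f k : SU2 R -> C).

(** Derivatives along the root vectors [Z] and [Z-bar] for [alpha] and
    [- alpha]. *)
Definition raise f g : C := 2^-1 * (lieD E f g - 'i * lieD F f g).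
Definition lower f g : C := 2^-1 * (lieD E f g + 'i * lieD F f g).

Lemma mul_ii : 'i * 'i = -1 :> C.
Proof. by rewrite -expr2 sqr_i. Qed.

Lemma b_neq0 : b != 0.
Proof.
by apply: contra_eq_neq b_norm => ->; rewrite mul0r mulr0 eq_sym oner_eq0.
Qed.

Lemma lieDE_E f g : lieD E f g = raise f g + lower f g.
Proof. by rewrite /raise /lower; field. Qed.

Lemma lieDE_F f g : lieD F f g = 'i * (raise f g - lower f g).
Proof.
rewrite /raise /lower.
transitivity (- ('i * 'i) * lieD F f g); last by field.
by rewrite mul_ii opprK mul1r.
Qed.

Lemma smooth_raise f : smooth_SU2 f -> smooth_SU2 (raise f).
Proof.
move=> fs; apply: smooth_SU2Z.
under eq_fun do rewrite -mulNr.
apply: smooth_SU2D; [exact: smooth_lieD|apply: smooth_SU2Z; exact: smooth_lieD].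
Qed.

Lemma smooth_lower f : smooth_SU2 f -> smooth_SU2 (lower f).
Proof.
move=> fs; apply: smooth_SU2Z.
apply: smooth_SU2D; [exact: smooth_lieD|apply: smooth_SU2Z; exact: smooth_lieD].
Qed.

Lemma raiseD f k g : smooth_SU2 f -> smooth_SU2 k ->
  raise (fun g => f g + k g) g = raise f g + raise k g.
Proof. by move=> fs ks; rewrite /raise !lieDD //; ring. Qed.

Lemma lowerD f k g : smooth_SU2 f -> smooth_SU2 k ->
  lower (fun g => f g + k g) g = lower f g + lower k g.
Proof. by move=> fs ks; rewrite /lower !lieDD //; ring. Qed.

Lemma raiseZ c f g : smooth_SU2 f -> raise (fun g => c * f g) g = c * raise f g.
Proof. by move=> fs; rewrite /raise !lieDZ //; ring. Qed.

Lemma lowerZ c f g : smooth_SU2 f -> lower (fun g => c * f g) g = c * lower f g.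
Proof. by move=> fs; rewrite /lower !lieDZ //; ring. Qed.

Lemma raise0 g : raise (fun=> 0) g = 0.
Proof. by rewrite /raise !lieD_cst !mulr0 subr0 mulr0. Qed.

Lemma raiseM f k g : smooth_SU2 f -> smooth_SU2 k ->
  raise (fun g => f g * k g) g = raise f g * k g + f g * raise k g.
Proof. by move=> fs ks; rewrite /raise !lieDM //; ring. Qed.

Lemma lowerM f k g : smooth_SU2 f -> smooth_SU2 k ->
  lower (fun g => f g * k g) g = lower f g * k g + f g * lower k g.
Proof. by move=> fs ks; rewrite /lower !lieDM //; ring. Qed.

Lemma raise_conj f g : smooth_SU2 f ->
  raise (fun g => conjc (f g)) g = conjc (lower f g).
Proof.
move=> fs; rewrite /raise /lower !lieD_conj //.
by rewrite conjcM conjcD conjcM conjci conjc_inv conjc_nat mulNr.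
Qed.

Lemma lower_conj f g : smooth_SU2 f ->
  lower (fun g => conjc (f g)) g = conjc (raise f g).
Proof.
move=> fs; rewrite /raise /lower !lieD_conj //.
by rewrite conjcM conjcD conjcN conjcM conjci conjc_inv conjc_nat mulNr opprK.
Qed.

Lemma raise_sum (I : Type) (r : seq I) (H : I -> SU2 R -> C) g :
  (forall i, smooth_SU2 (H i)) ->
  raise (fun g => \sum_(i <- r) H i g) g = \sum_(i <- r) raise (H i) g.
Proof.
move=> Hs; elim: r => [|i r IH].
  by under [in LHS]eq_fun do rewrite big_nil; rewrite raise0 big_nil.
under [in LHS]eq_fun do rewrite big_cons.
by rewrite raiseD ?big_cons ?IH //; exact: smooth_SU2_sum.
Qed.

(** [Ad t] rotates the plane of [E] and [F] by the argument of [t 0 0 ^ 2]. *)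
Lemma lieD_torus f g t m : smooth_SU2 f -> has_weight m f -> in_T t ->
  let c := val t 0 0 ^+ 2 in
  lieD E f (SU2_mul g t) = val t 0 0 ^ m *
    ((complex.Re c)%:C * lieD E f g + (complex.Im c)%:C * lieD F f g) /\
  lieD F f (SU2_mul g t) = val t 0 0 ^ m *
    ((complex.Re c)%:C * lieD F f g - (complex.Im c)%:C * lieD E f g).
Proof.
move=> fs fm tT c; have [t01 t10 t11 tU] := TP tT.
have conj_off a : val t *m val (su2_offdiag a) = val (su2_offdiag (c * a)) *m val t.
  rewrite /=.
  have [e00 e01 e10 e11] := offdiagE a.
  have [c00 c01 c10 c11] := offdiagE (c * a).
  apply: mx22P; rewrite !mul22 ?e00 ?e01 ?e10 ?e11 ?c00 ?c01 ?c10 ?c11 ?t01 ?t10 ?t11.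
  - ring.
  - transitivity (val t 0 0 * conjc (val t 0 0) * val t 0 0 * a); last by rewrite /c; ring.
    by rewrite tU; ring.
  - rewrite conjcM /c rmorphXn /=.
    transitivity (- (val t 0 0 * conjc (val t 0 0) * conjc (val t 0 0) * conjc a)); last by ring.
    by rewrite tU; ring.
  - ring.
have cE : c = complex.Re c +i* complex.Im c by case: c {conj_off}.
have iiE : lieD (su2_offdiag ('i * ('i * b))) f g = - lieD E f g.
  rewrite mulrA mul_ii; have := @lieD_offdiag R (-1) 0 b f g fs.
  rewrite (_ : -1 +i* 0 = -1) ?rmorphN ?rmorph1 ?rmorph0 ?mul0r ?addr0 ?mulN1r //.
  by apply/eqP; rewrite eq_complex /= oppr0 !eqxx.
split.
  by rewrite (lieD_weight g fs fm tT (conj_off b)) {1}cE lieD_offdiag.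
rewrite (lieD_weight g fs fm tT (conj_off _)) {1}cE lieD_offdiag // iiE.
by rewrite mulrN.
Qed.

Lemma has_weight_raise m f : smooth_SU2 f -> has_weight m f ->
  has_weight (m + 2) (raise f).
Proof.
move=> fs fm g t tT; rewrite /raise.
have [-> ->] := lieD_torus g fs fm tT.
rewrite expfzDr ?T_neq0 //.
have -> : val t 0 0 ^ 2 = val t 0 0 ^+ 2 by [].
set c := val t 0 0 ^+ 2; have cE : c = (complex.Re c)%:C + 'i * (complex.Im c)%:C := complexE c.
rewrite [X in _ = _ * X * _]cE.
set p := _%:C; set q := _%:C.
transitivity (val t 0 0 ^ m * 2^-1 * (p * lieD E f g + q * lieD F f g -
  'i * p * lieD F f g + 'i * q * lieD E f g)); first by ring.
transitivity (val t 0 0 ^ m * 2^-1 * (p * lieD E f g - ('i * 'i) * q * lieD F f g -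
  'i * p * lieD F f g + 'i * q * lieD E f g)); first by rewrite mul_ii; ring.
ring.
Qed.

Lemma has_weight_lower m f : smooth_SU2 f -> has_weight m f ->
  has_weight (m - 2) (lower f).
Proof.
move=> fs fm.
have := has_weight_conj (has_weight_raise (smooth_SU2_conj fs) (has_weight_conj fm)).
rewrite opprD opprK; congr (has_weight _ _).
by apply/funext => g; rewrite raise_conj // conjcK.
Qed.

Lemma bracket_EF : val T = ad (val E) (val F).
Proof.
have [e00 e01 e10 e11] := offdiagE b.
have [f00 f01 f10 f11] := offdiagE ('i * b).
have [d00 d01 d10 d11] := diagTE R.
have bE : 'i / 4 = 2 * 'i * (b * conjc b).
  transitivity ('i / 4 * (8 * (b * conjc b))); last by field.
  by rewrite b_norm mulr1.
apply: mx22P; rewrite adE /= ?e00 ?e01 ?e10 ?e11 ?f00 ?f01 ?f10 ?f11 ?d00 ?d01 ?d10 ?d11.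
- by rewrite bE conjcM conjci; ring.
- ring.
- ring.
- by rewrite bE conjcM conjci; ring.
Qed.

Lemma lieD_lower X f g : smooth_SU2 f -> lieD X (lower f) g =
  2^-1 * (lieD X (lieD E f) g + 'i * lieD X (lieD F f) g).
Proof.
move=> fs; rewrite lieDZ ?lieDD ?lieDZ //; try exact: smooth_lieD.
  by apply: smooth_SU2Z; exact: smooth_lieD.
apply: smooth_SU2D; first exact: smooth_lieD.
by apply: smooth_SU2Z; exact: smooth_lieD.
Qed.

(** The commutator of the root vectors is a multiple of the bracket of [E] and
    [F], that is of [su2_T], which acts through the weight. *)
Lemma raise_lower m f g : smooth_SU2 f -> has_weight m f ->
  raise (lower f) g = lower (raise f) g - m%:~R / 8 * f g.
Proof.
move=> fs fm; have := lieD_bracket g fs bracket_EF.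
rewrite (lieD_T g fs fm).
have lD X := lieD_lower X g fs.
have rD X : lieD X (raise f) g =
    2^-1 * (lieD X (lieD E f) g - 'i * lieD X (lieD F f) g).
  have -> : raise f = fun g => 2^-1 * (lieD E f g + (- 'i) * lieD F f g).
    by apply/funext => h; rewrite mulNr.
  rewrite lieDZ ?lieDD ?lieDZ ?mulNr //; try exact: smooth_lieD.
    by apply: smooth_SU2Z; exact: smooth_lieD.
  apply: smooth_SU2D; first exact: smooth_lieD.
  by apply: smooth_SU2Z; exact: smooth_lieD.
rewrite [raise (lower f) g]/raise [lower (raise f) g]/lower !lD !rD.
set ee := lieD E _ g; set ef := lieD E _ g; set fe := lieD F _ g; set ff := lieD F _ g.
move=> br.
apply/eqP; rewrite -subr_eq0; apply/eqP.
transitivity ('i / 2 * (ee - fe) + m%:~R / 8 * f g); first by field.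
rewrite br; transitivity (('i * 'i + 1) / 8 * m%:~R * f g); first by field.
by rewrite mul_ii addNr !mul0r.
Qed.

End Ladder.

(** * Highest and lowest weight functions *)

Section LowestWeight.
Variables (R : realType) (b : R[i]).
Hypothesis b_norm : 8 * (b * conjc b) = 1.
Local Notation C := R[i].
Local Notation T := (su2_T R).
Local Notation E := (su2_offdiag b).
Local Notation F := (su2_offdiag ('i * b)).
Local Notation raise := (raise b).
Local Notation lower := (lower b).
Implicit Types (X Y : su2 R) (g h t : SU2 R) (f k : SU2 R -> C).

Lemma is_SU2_1 : is_SU2 (1%:M : 'M[C]_2).
Proof.
by rewrite /is_SU2 det1 eqxx andbT; apply/unitarymxP; rewrite mul1mx trmx1 map_mx1.
Qed.
Definition SU2_1 : SU2 R := exist (@is_SU2 R) _ is_SU2_1.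

Lemma mul_conjc (z : C) : z * conjc z = (complex.Re z ^+ 2 + complex.Im z ^+ 2)%:C.
Proof. by case: z => x y /=; simpc; congr (_ +i* _); ring. Qed.

Lemma laplacian_sign_absurd (x q s e f : R) : 4 * (- (x / 8) * q + s) = e + f ->
  e <= 0 -> f <= 0 -> 0 <= s -> 0 < q -> x * q <= -1 * q -> False.
Proof.
have -> : - (x / 8) * q = - (x * q) / 8 by field.
by move: (x * q) => y H1 H2 H3 H4 H5 H6; lra.
Qed.

(** A maximum principle for [rho = |f| ^ 2], which has weight [0]: [4] times
    [raise (lower rho)] is then [E ^ 2 + F ^ 2] applied to [rho], hence at most
    [0] at a maximum of [rho], whereas [raise f = 0] makes it at least
    [- (m / 2) rho] everywhere. *)
Lemma raise_weight_lt0 m f : smooth_SU2 f -> has_weight m f -> m < 0 ->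
  (forall g, raise f g = 0) -> forall g, f g = 0.
Proof.
move=> fs fm m0 rf.
have fcs := smooth_SU2_conj fs; have ls := smooth_lower b fs.
pose rho g := f g * conjc (f g).
have rs : smooth_SU2 rho by exact: smooth_SU2M.
have rw : has_weight 0 rho by rewrite -(subrr m); exact: has_weightM fm (has_weight_conj fm).
have lrho : lower rho = fun g => lower f g * conjc (f g).
  by apply/funext => g; rewrite lowerM // lower_conj // rf conjc0 mulr0 addr0.
have rf0 : raise f = fun=> 0 by apply/funext.
have lap g : raise (lower rho) g =
    - (m%:~R / 8) * rho g + lower f g * conjc (lower f g).
  rewrite lrho raiseM // raise_conj // (raise_lower b_norm g fs fm) rf0.
  rewrite /lower !lieD_cst !mulr0 addr0 mulr0 sub0r -mulNr /rho; ring.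
have lapEF g : 4 * raise (lower rho) g = lieD E (lieD E rho) g + lieD F (lieD F rho) g.
  have := lieD_bracket g rs (bracket_EF b_norm).
  rewrite (lieD_T g rs rw) !mul0r /raise !lieD_lower //.
  move: (lieD E (lieD F rho) g) (lieD E (lieD E rho) g) (lieD F (lieD E rho) g).
  move: (lieD F (lieD F rho) g) => ff ee ef fe br.
  transitivity (ef - 'i * 'i * ff + 'i * (ee - fe)); first by field.
  by rewrite br mul_ii mulN1r opprK mulr0 addr0.
have [g0 gmax] := smooth_SU2_max rs.
have ele := lieD_max E rs gmax; have fle := lieD_max F rs gmax.
pose r g := complex.Re (f g) ^+ 2 + complex.Im (f g) ^+ 2.
have r0 g : 0 <= r g by rewrite addr_ge0 ?sqr_ge0.
have rE g : complex.Re (rho g) = r g by rewrite /rho mul_conjc.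
pose s := complex.Re (lower f g0) ^+ 2 + complex.Im (lower f g0) ^+ 2.
have s0 : 0 <= s by rewrite addr_ge0 ?sqr_ge0.
have eqn : 4 * (- (m%:~R / 8) * r g0 + s) =
    complex.Re (lieD E (lieD E rho) g0) + complex.Re (lieD F (lieD F rho) g0).
  rewrite -ReD -lapEF lap /rho !mul_conjc -/(r g0) -/s.
  have -> : (m%:~R / 8 : C) = (m%:~R / 8 : R)%:C.
    by rewrite rmorphM fmorphV rmorph_nat rmorph_int.
  by rewrite -(rmorph_nat (real_complex R) 4) -rmorphN -rmorphM -rmorphD -rmorphM.
have m1 : (m%:~R : R) <= -1.
  have : m <= -1 by rewrite -ltzD1 addNr.
  by rewrite -(ler_int R) mulrNz.
have rg0 : r g0 <= 0.
  rewrite leNgt; apply/negP => rg0.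
  have : m%:~R * r g0 <= -1 * r g0 by rewrite ler_wpM2r ?(ltW rg0).
  exact: (laplacian_sign_absurd eqn ele fle s0 rg0).
move=> g; have rg : r g = 0.
  by apply/eqP; rewrite eq_le r0 andbT -(rE g) (le_trans (gmax g)) // rE.
have /eqP : f g * conjc (f g) = 0 by rewrite mul_conjc -/(r g) rg.
by rewrite mulf_eq0 conjc_eq0 orbb => /eqP.
Qed.

Lemma lower_weight_gt0 m f : smooth_SU2 f -> has_weight m f -> 0 < m ->
  (forall g, lower f g = 0) -> forall g, f g = 0.
Proof.
move=> fs fm m0 lf g; apply/eqP; rewrite -conjc_eq0; apply/eqP.
apply: (raise_weight_lt0 (smooth_SU2_conj fs) (has_weight_conj fm)).
  by rewrite oppr_lt0.
by move=> h; rewrite raise_conj // lf conjc0.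
Qed.

Section Chain.
Variables (n : nat) (f : SU2 R -> C).
Hypotheses (fs : smooth_SU2 f) (fw : has_weight (- n%:Z) f).
Hypothesis lf : forall g, lower f g = 0.

Definition chain (k : nat) : SU2 R -> C := iter k raise f.

Lemma smooth_chain (k : nat) : smooth_SU2 (chain k).
Proof. by elim: k => //= k IH; exact: smooth_raise. Qed.

Lemma weight_chain (k : nat) : has_weight (2 * k%:Z - n%:Z) (chain k).
Proof.
elim: k => [|k IH]; first by rewrite mulr0 sub0r.
rewrite (_ : 2 * k.+1%:Z - n%:Z = 2 * k%:Z - n%:Z + 2).
  exact: has_weight_raise (smooth_chain k) IH.
by rewrite intS; ring.
Qed.

Lemma lower_chain (k : nat) g :
  lower (chain k.+1) g = k.+1%:R * (k%:R - n%:R) / 8 * chain k g.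
Proof.
elim: k g => [|k IH] g.
  have := raise_lower b_norm g fs fw.
  have -> : lower f = fun=> 0 by apply/funext.
  rewrite raise0 /chain /= rmorphN /= => /esym/eqP; rewrite subr_eq0 => /eqP ->.
  by rewrite mul1r sub0r.
have := raise_lower b_norm g (smooth_chain k.+1) (weight_chain k.+1).
have -> : lower (chain k.+1) = fun g => k.+1%:R * (k%:R - n%:R) / 8 * chain k g.
  exact/funext.
rewrite raiseZ; last exact: smooth_chain.
rewrite -[raise (chain k) g]/(chain k.+1 g) -[raise (chain k.+1)]/(chain k.+2).
move=> /esym/eqP; rewrite subr_eq => /eqP ->.
by rewrite rmorphB rmorphM /= -!pmulrn -!natr1; field.
Qed.

(** The raised function has weight [n + 2 > 0] and is killed by [lower]. *)
Lemma chain_stop g : chain n.+1 g = 0.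
Proof.
apply: (lower_weight_gt0 (smooth_chain _) (weight_chain _)).
  by rewrite subr_gt0 -PoszM ltz_nat mul2n -addnn addSn ltnS leq_addr.
by move=> h; rewrite lower_chain subrr mulr0 mul0r mul0r.
Qed.

(** Up to a common factor, the inverse squares of the norms of the raised
    vectors [e_k] in the unitary representation of dimension [n + 1]. If [f]
    is the matrix coefficient [<v, g e_0>] then [raise^k f] is [<v, g e_k>],
    so that with these weights [chain_norm] is the squared norm of [v]. *)
Definition chain_weight (k : nat) : C := 8 ^+ k * (n - k)`!%:R / k`!%:R.

Definition chain_norm g : C :=
  \sum_(k < n.+1) chain_weight k * (chain k g * conjc (chain k g)).

Lemma smooth_chain_norm : smooth_SU2 chain_norm.
Proof.
apply: smooth_SU2_sum => k; apply: smooth_SU2Z; apply: smooth_SU2M.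
  exact: smooth_chain.
exact/smooth_SU2_conj/smooth_chain.
Qed.

Lemma chain_weightS (k : nat) : (k < n)%N ->
  chain_weight k.+1 * (k.+1%:R * (n%:R - k%:R)) = 8 * chain_weight k.
Proof.
move=> kn; rewrite /chain_weight exprS factS subnS -(natrB _ (ltnW kn)).
have [d dE] : exists d, (n - k)%N = d.+1.
  by exists (n - k).-1; rewrite prednK // subn_gt0.
rewrite dE /= factS !natrM; field.
by rewrite nat1r !pnatr_eq0 -lt0n fact_gt0.
Qed.

(** Each [raise^k f] contributes two terms; by [lower_chain] the second term of
    [k + 1] is a multiple of the first term of [k], and the weights make them
    cancel. At the ends the sum stops by [chain_stop] and by [lower f = 0]. *)
Lemma raise_chain_norm g : raise chain_norm g = 0.
Proof.
have cs (k : nat) := smooth_chain k.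
have ccs (k : nat) := smooth_SU2_conj (cs k).
rewrite /chain_norm raise_sum; last first.
  by move=> k; apply: smooth_SU2Z; exact: smooth_SU2M.
have telescope (a c : nat -> C) : a n = 0 -> c 0%N = 0 ->
    (forall k : nat, (k < n)%N -> a k + c k.+1 = 0) -> \sum_(k < n.+1) (a k + c k) = 0.
  move=> an c0 ac; rewrite big_split /= big_ord_recr big_ord_recl /=.
  by rewrite an c0 addr0 add0r -big_split big1 // => k _; exact: ac.
pose A (k : nat) := chain_weight k * (chain k.+1 g * conjc (chain k g)).
pose B (k : nat) := chain_weight k * (chain k g * conjc (lower (chain k) g)).
transitivity (\sum_(k < n.+1) (A k + B k)).
  apply: eq_bigr => k _; rewrite raiseZ; last exact: smooth_SU2M.
  by rewrite raiseM // raise_conj // mulrDr.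
apply: telescope.
- by rewrite /A chain_stop mul0r mulr0.
- by rewrite /B [lower _ g]lf conjc0 !mulr0.
move=> k kn; rewrite /A /B lower_chain conjcM.
rewrite !conjcM conjc_inv conjcD conjcN !conjc_nat.
move: (chain k.+1 g) (conjc (chain k g)) => x y.
transitivity ((8 * chain_weight k - chain_weight k.+1 *
  (k.+1%:R * (n%:R - k%:R))) / 8 * (x * y)).
  by field.
by rewrite chain_weightS // subrr !mul0r.
Qed.

Lemma conj_chain_norm g : conjc (chain_norm g) = chain_norm g.
Proof.
rewrite /chain_norm (big_morph _ (@conjcD R) (@conjc0 R)); apply: eq_bigr => k _.
rewrite conjcM; congr (_ * _).
  by rewrite /chain_weight -natrX !conjcM conjc_inv !conjc_nat.
by rewrite conjcM conjcK; exact: mulrC.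
Qed.

Lemma lower_chain_norm g : lower chain_norm g = 0.
Proof.
have E : chain_norm = fun g => conjc (chain_norm g).
  by apply/funext => h; rewrite conj_chain_norm.
by rewrite E (lower_conj b g smooth_chain_norm) raise_chain_norm conjc0.
Qed.

Lemma weight_chain_norm : has_weight 0 chain_norm.
Proof.
move=> g t tT; rewrite mul1r; apply: eq_bigr => k _; congr (_ * _).
have := has_weightM (weight_chain k) (has_weight_conj (weight_chain k)) g tT.
by rewrite subrr mul1r.
Qed.

(** [E], [F] and [su2_T] span su(2), and [chain_norm] has weight [0]. *)
Lemma lieD_chain_norm X g : lieD X chain_norm g = 0.
Proof.
have Ss := smooth_chain_norm.
have SE : lieD E chain_norm g = 0.
  by rewrite lieDE_E raise_chain_norm lower_chain_norm addr0.
have SF : lieD F chain_norm g = 0.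
  by rewrite lieDE_F raise_chain_norm lower_chain_norm subrr mulr0.
have ST : lieD T chain_norm g = 0.
  by rewrite (lieD_T g Ss weight_chain_norm) !mul0r.
have Soff c : lieD (su2_offdiag c) chain_norm g = 0.
  have cE : c = (complex.Re (c / b) +i* complex.Im (c / b)) * b.
    by rewrite -[LHS](divfK (b_neq0 b_norm)); case: (c / b).
  by rewrite cE lieD_offdiag // SE SF !mulr0 addr0.
have su i j : conjc (val X j i) = - val X i j.
  by case/andP: (valP X) => /eqP/matrixP/(_ i j); rewrite !mxE.
have X11 : val X 1 1 = - val X 0 0.
  by case/andP: (valP X) => _; rewrite tr22 addrC addr_eq0 => /eqP.
have [d00 d01 d10 d11] := diagTE R.
have [e00 e01 e10 e11] := offdiagE (val X 0 1).
pose x := complex.Im (val X 0 0).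
have X00 : val X 0 0 = x%:C * 'i.
  move: (su 0 0); rewrite /x; case: (val X 0 0) => p q /eqP.
  rewrite eq_complex /= => /andP[/eqP pE _].
  have -> : p = 0 by lra.
  by simpc.
have XE : val X = 1%:C *: val (su2_offdiag (val X 0 1)) + (4 * x)%:C *: val T.
  rewrite rmorph1 rmorphM rmorph_nat.
  apply: mx22P; rewrite mx_combE /= ?d00 ?d01 ?d10 ?d11 ?e00 ?e01 ?e10 ?e11.
  - by rewrite X00; field.
  - by rewrite mulr0 addr0 mul1r.
  - by rewrite mulr0 addr0 mul1r su opprK.
  - by rewrite X11 X00; field.
by rewrite (lieD_comb g Ss XE) Soff ST !mulr0 addr0.
Qed.

(** [chain_norm] is constant along one-parameter subgroups, hence on the group,
    and its term [k = 0] bounds [f]. *)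
Lemma chain_inj : (forall k : 'I_n.+1, chain k (SU2_1) = 0) ->
  forall g, f g = 0.
Proof.
move=> c1 g; have [X ->] := SU2_exp_surj g.
have flow s : is_cderive (fun s => chain_norm (SU2_exp (su2_scale s X))) s 0.
  have := is_cderive_flow (SU2_1) X s smooth_chain_norm.
  rewrite lieD_chain_norm.
  congr (is_cderive _ s 0); apply/funext => s'; congr chain_norm.
  by apply: SU2_eq; rewrite /= mul1mx.
have S1 : chain_norm (SU2_exp (su2_scale 1 X)) = 0.
  rewrite (is_cderive0_cst flow 1 0).
  have -> : SU2_exp (su2_scale 0 X) = SU2_1.
    by apply: SU2_eq; rewrite SU2_exp0.
  by rewrite /chain_norm big1 // => k _; rewrite c1 mul0r mulr0.
have ge0 (k : 'I_n.+1) : 0 <= chain_weight k * (chain k (SU2_exp (su2_scale 1 X)) *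
    conjc (chain k (SU2_exp (su2_scale 1 X)))).
  by rewrite mulr_ge0 ?mulcJ_ge0 // !mulr_ge0 ?invr_ge0 ?exprn_ge0 ?ler0n.
have /eqP := S1; rewrite psumr_eq0 // => /allP/(_ ord0 (mem_index_enum _)) /=.
rewrite /chain_weight fact0 subn0 expr0 mul1r divr1 !mulf_eq0 conjc_eq0 orbb.
by rewrite pnatr_eq0 eqn0Ngt fact_gt0 => /eqP.
Qed.

End Chain.
End LowestWeight.

(** * The space of lowest weight functions *)

Section LowestWeightBasis.
Variables (R : realType) (b : R[i]).
Hypothesis b_norm : 8 * (b * conjc b) = 1.
Local Notation C := R[i].
Local Notation raise := (raise b).
Local Notation lower := (lower b).
Implicit Types (X Y : su2 R) (g h t : SU2 R) (f : SU2 R -> C).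

Lemma lieD_coef X (i j : 'I_2) g :
  lieD X (fun g => val g i j) g = (val g *m val X) i j.
Proof.
have cs c : smooth (coordV c : _ -> R).
  exact: (smooth_linear (@coordV_continuous R c)).
rewrite (lieDE X g (cs (true, i, j)) (cs (false, i, j))); last first.
  by move=> h; rewrite /coordV /= !mxE; case: (val h i j).
rewrite /along !(derive_linearV (@coordV_continuous R) (@basisV_expand R)).
have -> : rmulmx (val X) (re_im g) =
  (map_mx (@complex.Re R) (val g *m val X), map_mx (@complex.Im R) (val g *m val X)).
  by rewrite map_Re_mul map_Im_mul.
rewrite -[LHS]/(map_mx (@complex.Re R) (val g *m val X) i j +i*
  map_mx (@complex.Im R) (val g *m val X) i j) mxE [X in _ +i* X]mxE.
by case: ((val g *m val X) i j).
Qed.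

Lemma lower_coef (i : 'I_2) g : lower (fun g => val g i 1) g = 0.
Proof.
rewrite /lower !lieD_coef !mul22 /=.
have [_ -> _ ->] := offdiagE b; have [_ -> _ ->] := offdiagE ('i * b).
transitivity (2^-1 * val g i 0 * b * (1 + 'i * 'i)); first by ring.
by rewrite mul_ii subrr mulr0.
Qed.

Lemma weight_coef (i : 'I_2) : has_weight (- 1) (fun g : SU2 R => val g i 1).
Proof.
move=> g t tT; have [t01 t10 t11 tU] := TP tT.
rewrite /= mul22 t01 mulr0 add0r t11 mulrC; congr (_ * _).
by apply: (mulfI (T_neq0 tT)); rewrite tU exprN1 divff // T_neq0.
Qed.

Lemma lowerX f (n : nat) g : smooth_SU2 f -> (forall g, lower f g = 0) ->
  lower (fun g => f g ^+ n) g = 0.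
Proof.
move=> fs lf; elim: n => [|n IH].
  by rewrite /lower !lieD_cst mulr0 addr0 mulr0.
under [in LHS]eq_fun do rewrite exprS.
rewrite lowerM ?lf ?IH ?mul0r ?mulr0 ?addr0 //; exact: smooth_SU2X.
Qed.

Lemma has_weightX m f (n : nat) : has_weight m f ->
  has_weight (m * n%:Z) (fun g => f g ^+ n).
Proof. by move=> fm g t tT; rewrite fm // exprMn -exprz_exp. Qed.

(** The matrix coefficients of the irreducible representation of dimension
    [n + 1] on homogeneous polynomials of degree [n]. *)
Definition monom (n k : nat) g : C := val g 0 1 ^+ k * val g 1 1 ^+ (n - k).

Lemma smooth_monom n k : smooth_SU2 (@monom n k).
Proof. by apply: smooth_SU2M; apply/smooth_SU2X/smooth_SU2_coef. Qed.

Lemma weight_monom n k : (k <= n)%N -> has_weight (- n%:Z) (@monom n k).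
Proof.
move=> kn; rewrite (_ : - n%:Z = (- 1) * k%:Z + (- 1) * (n - k)%N%:Z).
  by apply: has_weightM; apply/has_weightX/weight_coef.
by rewrite -mulrDr -PoszD subnKC // mulN1r.
Qed.

Lemma lower_monom n k g : lower (@monom n k) g = 0.
Proof.
have cs i : smooth_SU2 (fun g : SU2 R => val g i 1) by exact: smooth_SU2_coef.
rewrite lowerM; [|exact: smooth_SU2X..].
by rewrite !lowerX ?mul0r ?mulr0 ?addr0 // => h; exact: lower_coef.
Qed.

(** On real rotations [monom n k] is, up to a factor independent of [k], the
    [k]-th power of the tangent. *)
Lemma monom_free n (c : 'rV[C]_n.+1) :
  (forall g, \sum_(k < n.+1) c 0 k * monom n k g = 0) -> c = 0.
Proof.
move=> c0; pose p := \poly_(k < n.+1) c 0 (inord k).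
have pE (x : C) : p.[x] = \sum_(k < n.+1) c 0 k * x ^+ k.
  by rewrite horner_poly; apply: eq_bigr => k _; rewrite inord_val.
have proot (m : nat) : root p m%:R.
  (* Evaluation at the rotation of tangent [m]: up to [r ^- n] the hypothesis
     becomes [p.[m] = 0]. *)
  pose x : R := m%:R; pose r := Num.sqrt (1 + x ^+ 2).
  have r2 : r ^+ 2 = 1 + x ^+ 2 by rewrite sqr_sqrtr // addr_ge0 ?sqr_ge0.
  have r0 : r != 0 by rewrite gt_eqF // sqrtr_gt0 ltr_pwDl ?sqr_ge0.
  have ab : (r^-1)%:C * conjc (r^-1)%:C + (- (x / r))%:C * conjc (- (x / r))%:C = 1.
    rewrite !conjc_real -!rmorphM -rmorphD -[RHS](rmorph1 (real_complex R)).
    apply: (congr1 (real_complex R)).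
    transitivity ((1 + x ^+ 2) / r ^+ 2); first by field.
    by rewrite -r2 divff // expf_neq0.
  have := c0 (mkSU2 ab); rewrite /root pE => H.
  have rn0 : (r^-1)%:C ^+ n != 0 :> C.
    by rewrite expf_neq0 // eq_complex /= negb_and invr_eq0 r0.
  apply/eqP; apply: (mulfI rn0); rewrite mulr0 -[RHS]H mulr_sumr.
  have e01 : val (mkSU2 ab) 0 1 = (x / r)%:C.
    by rewrite !mxE; apply/eqP; rewrite eq_complex /= !opprK ?oppr0 !eqxx.
  have e11 : val (mkSU2 ab) 1 1 = (r^-1)%:C.
    by rewrite !mxE; apply/eqP; rewrite eq_complex /= oppr0 !eqxx.
  apply: eq_bigr => k _; rewrite /monom e01 e11 mulrCA; congr (_ * _).
  rewrite rmorphM rmorph_nat exprMn -mulrA mulrC; congr (_ * _).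
  by rewrite -exprD subnKC // -ltnS.
have p0 : p = 0.
  apply: (@roots_geq_poly_eq0 _ p [seq (m%:R : C) | m <- iota 0 (size p)]).
  - by apply/allP => _ /mapP[m _ ->]; exact: proot.
  - by rewrite map_inj_uniq ?iota_uniq // => m1 m2 /eqP; rewrite eqr_nat => /eqP.
  - by rewrite size_map size_iota.
apply/rowP => k; have := congr1 (fun q : {poly C} => q`_k) p0.
by rewrite coef_poly ltn_ord inord_val coef0 mxE.
Qed.

Definition lowest_weight (n : nat) f : Prop :=
  [/\ smooth_SU2 f, has_weight (- n%:Z) f & forall g, lower f g = 0].

Lemma lowest_weight_comb n (I : Type) (r : seq I) (a : I -> C)
    (H : I -> SU2 R -> C) : (forall i, lowest_weight n (H i)) ->
  lowest_weight n (fun g => \sum_(i <- r) a i * H i g).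
Proof.
move=> Hl; elim: r => [|i r [IH1 IH2 IH3]].
  under eq_fun do rewrite big_nil.
  split; [exact: smooth_SU2_cst|by move=> g t tT; rewrite mulr0|move=> g].
  by rewrite /lower !lieD_cst mulr0 addr0 mulr0.
under eq_fun do rewrite big_cons.
have [s w l] := Hl i; split.
- by apply: smooth_SU2D => //; exact: smooth_SU2Z.
- by apply: has_weightD => //; exact: has_weightZ.
- move=> g; rewrite lowerD ?lowerZ ?l ?IH3 ?mulr0 ?addr0 //.
  exact: smooth_SU2Z.
Qed.

Lemma chain_comb (I : Type) (r : seq I) (a : I -> C) (H : I -> SU2 R -> C) (k : nat) g :
  (forall i, smooth_SU2 (H i)) ->
  chain b (fun g => \sum_(i <- r) a i * H i g) k g =
  \sum_(i <- r) a i * chain b (H i) k g.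
Proof.
move=> Hs; elim: k g => //= k IH g.
have -> : chain b (fun g => \sum_(i <- r) a i * H i g) k =
    fun g => \sum_(i <- r) a i * chain b (H i) k g by exact/funext.
rewrite raise_sum; last by move=> i; apply/smooth_SU2Z/smooth_chain.
by apply: eq_bigr => i _; rewrite raiseZ //; exact: smooth_chain.
Qed.

(** By [chain_inj] a lowest weight function is determined by its [n + 1] numbers
    [jet]. The jets of the [n + 1] independent monomials therefore form an
    invertible matrix, which yields a combination of monomials with the jet of
    [f]. *)
Lemma lowest_weight_coord n f : lowest_weight n f ->
  exists c : 'rV[C]_n.+1, forall g, f g = \sum_(k < n.+1) c 0 k * monom n k g.
Proof.
move=> fl; have ml (k : 'I_n.+1) : lowest_weight n (monom n k).
  split; [exact: smooth_monom|apply: weight_monom; rewrite -ltnS //|].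
  exact: lower_monom.
pose jet f' : 'rV[C]_n.+1 := \row_k chain b f' k (SU2_1 R).
have jet_inj f' : lowest_weight n f' -> jet f' = 0 -> forall g, f' g = 0.
  move=> [s w l] j0; apply: (chain_inj b_norm s w l) => k.
  by have /rowP/(_ k) := j0; rewrite !mxE.
pose M := \matrix_(i < n.+1) jet (monom n i).
have jetE (c : 'rV[C]_n.+1) :
    jet (fun g => \sum_(k < n.+1) c 0 k * monom n k g) = c *m M.
  apply/rowP => k; rewrite mxE chain_comb; last by move=> i; case: (ml i).
  by rewrite mxE; apply: eq_bigr => i _; rewrite !mxE.
have Mu : M \in unitmx.
  rewrite -row_free_unit; apply: inj_row_free => c cM; apply: monom_free.
  apply: jet_inj; last by rewrite jetE.
  exact: lowest_weight_comb.
pose c := jet f *m invmx M; exists c => g.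
pose f2 g := \sum_(k < n.+1) c 0 k * monom n k g.
have f2l : lowest_weight n f2 by exact: lowest_weight_comb.
pose H (i : bool) := if i then f else f2.
pose a (i : bool) : C := if i then 1 else -1.
have Hl i : lowest_weight n (H i) by case: i.
have := jet_inj _ (lowest_weight_comb [:: true; false] a Hl) _ g.
rewrite !big_cons big_nil /a /H addr0 mul1r mulN1r => /(_ _)/eqP.
rewrite subr_eq0 => H0; apply/eqP/H0; apply/rowP => k.
rewrite mxE chain_comb; last by move=> i; case: (Hl i).
rewrite !big_cons big_nil /= addr0 mul1r mulN1r mxE.
have /rowP/(_ k) := jetE c; rewrite /c mulmxKV // !mxE => <-.
by rewrite subrr.
Qed.

End LowestWeightBasis.

(** * Hermite functions *)

Section Hermite.
Variable R : realType.
Local Notation C := R[i].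
Implicit Types (l : nat) (x : R).

Fixpoint hermite_poly l : {poly R} :=
  if l is l'.+1 then (hermite_poly l')^`() - ('X * hermite_poly l') *+ 2 else 1.

Lemma hermite_polyS l : hermite_poly l.+1 =
  (hermite_poly l)^`() - ('X * hermite_poly l) *+ 2.
Proof. by []. Qed.

Lemma is_derive_gauss (a x : R) :
  is_derive x 1 (fun y : R => expR (a * y ^+ 2)) (a * (2 * x) * expR (a * x ^+ 2)).
Proof.
have sq : is_derive x 1 (fun y : R => a * y ^+ 2) (a * (2 * x)).
  have := is_deriveZ a (is_deriveX 2 (is_derive_id x (1 : R))).
  move=> /is_derive_eq; apply.
  by rewrite expr1 /GRing.scale /= mulr1 mulr_natl.
apply: is_derive_eq (is_derive_compR sq (is_derive_expR _)) _.
exact: mulrC.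
Qed.

Lemma is_derive_poly_gauss (p : {poly R}) (a x : R) :
  is_derive x 1 (fun y : R => p.[y] * expR (a * y ^+ 2))
    ((p^`()).[x] * expR (a * x ^+ 2) + p.[x] * (a * (2 * x) * expR (a * x ^+ 2))).
Proof.
have := is_deriveM (is_derive_poly p x) (is_derive_gauss a x).
move=> /is_derive_eq; apply; rewrite /GRing.scale /= addrC; congr (_ + _).
exact: mulrC.
Qed.

Lemma derive1n_gauss l : derive1n l (fun y : R => expR (- y ^+ 2)) =
  fun x => (hermite_poly l).[x] * expR (- x ^+ 2).
Proof.
elim: l => [|l IH]; first by apply/funext => x; rewrite derive1n0 hornerC mul1r.
rewrite derive1nS IH; apply/funext => x; rewrite derive1E.
have := is_derive_poly_gauss (hermite_poly l) (-1) x.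
under eq_fun do rewrite mulN1r.
move=> [_ ->]; rewrite mulN1r /= hornerD hornerN hornerMn hornerM hornerX -mulr_natl; ring.
Qed.

Lemma hermiteE l x :
  hermite l x = ((hermite_poly l).[x] * expR (- 2^-1 * x ^+ 2))%:C.
Proof.
rewrite /hermite derive1n_gauss mulrCA -expRD; by congr ((_ * expR _)%:C); field.
Qed.

Lemma deriv_hermite_poly l :
  (hermite_poly l)^`() = - (hermite_poly l.-1 *+ (2 * l)).
Proof.
have step (A : comNzRingType) (X q r : A) (m : nat) :
    - (q *+ m) - (q - (X * r) *+ 2 + X * - (r *+ m)) *+ 2 =
    - ((q - (X * r) *+ 2) *+ (m + 2)).
  have [M mE] : exists M : A, forall y, y *+ m = M * y.
    by exists m%:R => y; rewrite mulr_natl.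
  by rewrite mulrnDr !mE !mulr2n; ring.
elim: l => [|[|l] IH]; first by rewrite mulr0n oppr0 derivC.
  by rewrite /= derivB derivMn derivM derivX derivC deriv0 mulr0 addr0 mul1r sub0r.
rewrite hermite_polyS derivB derivMn derivM derivX mul1r IH derivN derivMn.
rewrite [l.+1.-1]/= [l.+2.-1]/= [(2 * l.+2)%N]mulnS [(2 + _)%N]addnC.
by rewrite hermite_polyS step.
Qed.

Lemma hermite_rec l x :
  2 * x%:C * hermite l x = - (hermite l.+1 x + 2 * l%:R * hermite l.-1 x).
Proof.
rewrite !hermiteE hermite_polyS deriv_hermite_poly.
rewrite hornerD !hornerN !hornerMn hornerM hornerX.
rewrite -(rmorph_nat (real_complex R) 2) -(rmorph_nat (real_complex R) l).
rewrite -!rmorphM -rmorphD -rmorphN; congr (_%:C).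
move: (hermite_poly l).[x] (hermite_poly l.-1).[x] (expR _) => p q e.
by rewrite mulr2n -[q *+ (2 * l)]mulr_natl natrM; ring.
Qed.

Lemma is_cderive_hermite l x :
  is_cderive (hermite l) x (x%:C * hermite l x + hermite l.+1 x).
Proof.
have -> : hermite l = fun x => ((hermite_poly l).[x] * expR (- 2^-1 * x ^+ 2))%:C.
  by apply/funext => y; rewrite hermiteE.
apply: is_cderive_eq (is_cderive_real (is_derive_poly_gauss _ _ _)) _.
rewrite hermiteE -rmorphM -rmorphD; congr (_%:C).
rewrite /= hornerD hornerN hornerMn hornerM hornerX -mulr_natl.
by field.
Qed.

Lemma cderive_hermite l :
  cderive (hermite l) = fun x => 2^-1 * hermite l.+1 x - l%:R * hermite l.-1 x.
Proof.
apply/funext => x; rewrite (is_cderiveE (is_cderive_hermite l x)).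
have -> : x%:C * hermite l x = 2^-1 * (2 * x%:C * hermite l x) by field.
by rewrite hermite_rec; field.
Qed.

Lemma coef_hermite_poly l : (size (hermite_poly l) <= l.+1)%N /\
  (hermite_poly l)`_l = (- 2) ^+ l.
Proof.
elim: l => [|l [IHs IHc]]; first by rewrite size_poly1 coef1 expr0.
have dl k : (l <= k)%N -> ((hermite_poly l)^`())`_k = 0.
  by move=> lk; rewrite coef_deriv nth_default ?mul0rn // (leq_trans IHs).
split=> /=.
  apply/leq_sizeP => k lk; rewrite coefB coefMn coefXM.
  rewrite dl; last by rewrite (leq_trans _ lk) // ltnW.
  case: k lk => // k lk; rewrite /= nth_default ?mul0rn ?subr0 //.
  exact: leq_trans IHs lk.
by rewrite coefB coefMn coefXM dl //= IHc exprS -mulr_natl; ring.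
Qed.

(** The common Gaussian factor cancels and leaves polynomials of distinct
    degrees. *)
Lemma hermite_free n (c : 'I_n -> C) :
  (forall x, \sum_(l < n) c l * hermite l x = 0) ->
  forall l : 'I_n, c l = 0.
Proof.
move=> c0.
pose p := \sum_(l < n) c l *: map_poly (real_complex R) (hermite_poly l).
have p0 : p = 0.
  apply: (@roots_geq_poly_eq0 _ p [seq (m%:R : C) | m <- iota 0 (size p)]).
  - apply/allP => _ /mapP[m _ ->]; rewrite /root /p horner_sum.
    have e0 : (expR (- 2^-1 * (m%:R : R) ^+ 2))%:C != 0 :> C.
      by rewrite eq_complex /= negb_and gt_eqF ?expR_gt0.
    apply/eqP/(mulIf e0); rewrite mul0r -[RHS](c0 m%:R) mulr_suml.
    apply: eq_bigr => l _; rewrite hornerZ -mulrA; congr (_ * _).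
    by rewrite hermiteE -(rmorph_nat (real_complex R)) horner_map rmorphM.
  - by rewrite map_inj_uniq ?iota_uniq // => m1 m2 /eqP; rewrite eqr_nat => /eqP.
  - by rewrite size_map size_iota.
have {}p0 k : \sum_(l < n) c l * ((hermite_poly l)`_k)%:C = 0.
  have := congr1 (fun q : {poly C} => q`_k) p0.
  rewrite coef0 /p coef_sum => H; rewrite -[RHS]H.
  by apply: eq_bigr => l _; rewrite coefZ coef_map.
clear c0 p; elim: n c p0 => [|n IH] c p0 l; first by case: l.
have cn : c ord_max = 0.
  have := p0 n; rewrite big_ord_recr /= big1 ?add0r => [|k _].
    have [_ ->] := coef_hermite_poly n.
    move/eqP; rewrite mulf_eq0 => /orP[/eqP //|].
    by rewrite eq_complex /= eqxx andbT expf_eq0 oppr_eq0 pnatr_eq0 andbF.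
  have [sk _] := coef_hermite_poly k.
  by rewrite nth_default ?mulr0 // (leq_trans sk).
have [j ->|->] := unliftP ord_max l; last exact: cn.
have -> : lift ord_max j = widen_ord (leqnSn n) j.
  by apply: val_inj; rewrite /= /bump leqNgt ltn_ord.
apply: (IH (fun j => c (widen_ord (leqnSn n) j))) => k.
by have := p0 k; rewrite big_ord_recr /= cn mul0r addr0.
Qed.

Lemma hermite_neq0 l : exists x, hermite l x != 0.
Proof.
apply: contrapT => H; have := @hermite_free l.+1 (fun k => (k == ord_max)%:R) _ ord_max.
rewrite eqxx => /(_ _)/eqP; rewrite oner_eq0 => F; apply/notF/F => x.
apply: big1 => k _; have [->|_] := eqVneq k ord_max; last by rewrite mul0r.
by apply: contrapT => /eqP hx; apply: H; exists x; rewrite mul1r in hx.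
Qed.

End Hermite.

(** * Finite sums of Hermite components *)

Section Tame.
Variable R : realType.
Local Notation C := R[i].
Local Notation spinor := (spinor R).
Implicit Types (X Y : su2 R) (g h t : SU2 R) (f k : SU2 R -> C) (u v phi : spinor)
  (A B : spinor -> spinor).

Definition elem (l : nat) f : spinor := fun g => f g *: hermite l.

Lemma elemE l f g x : elem l f g x = f g * hermite l x.
Proof. by []. Qed.

Lemma spinor_eq u v : (forall g x, u g x = v g x) -> u = v.
Proof. by move=> uv; apply/funext => g; apply/funext => x. Qed.

Lemma spinorDE u v g x : (u + v) g x = u g x + v g x.
Proof. by []. Qed.

Lemma spinorZE (c : C) u g x : (c *: u) g x = c * u g x.
Proof. by []. Qed.

Lemma spinorNE u g x : (- u) g x = - u g x.
Proof. by []. Qed.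

Lemma elemD l f k : elem l (fun g => f g + k g) = elem l f + elem l k.
Proof. by apply: spinor_eq => g x; rewrite spinorDE !elemE mulrDl. Qed.

Lemma elemZ l (c : C) f : elem l (fun g => c * f g) = c *: elem l f.
Proof. by apply: spinor_eq => g x; rewrite spinorZE !elemE mulrA. Qed.

Lemma elem0 l : elem l (fun=> 0) = 0.
Proof. by apply: spinor_eq => g x; rewrite elemE mul0r. Qed.

Lemma elem_inj l f k : elem l f = elem l k -> f = k.
Proof.
move=> fk; apply/funext => g; have [x hx] := hermite_neq0 R l.
by apply: (mulIf hx); rewrite -!elemE fk.
Qed.

Lemma elem_free n (f : 'I_n -> SU2 R -> C) :
  \sum_(l < n) elem l (f l) = 0 -> forall l g, f l g = 0.
Proof.
move=> f0 l g; apply: (@hermite_free R n (fun l => f l g)) => x.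
have : (\sum_(l < n) elem l (f l)) g x = 0 by rewrite f0.
by rewrite !fct_sumE.
Qed.

(** The spinor fields on which all the operators are linear: derivatives are
    total functions, linear only where the limits exist. *)
Inductive tame : spinor -> Prop :=
| Tame_zero : tame 0
| Tame_cons l f u of smooth_SU2 f & tame u : tame (elem l f + u).

Lemma tame_elem l f : smooth_SU2 f -> tame (elem l f).
Proof. by move=> fs; rewrite -[elem l f]addr0; apply: Tame_cons fs Tame_zero. Qed.

Lemma tameD u v : tame u -> tame v -> tame (u + v).
Proof.
move=> ut vt; elim: ut => [|l f w fs _ IH]; first by rewrite add0r.
by rewrite -addrA; exact: Tame_cons.
Qed.

Lemma tameZ (c : C) u : tame u -> tame (c *: u).
Proof.
elim=> [|l f w fs _ IH]; first by rewrite scaler0; exact: Tame_zero.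
by rewrite scalerDr -elemZ; apply: Tame_cons => //; exact: smooth_SU2Z.
Qed.

Lemma tame_comb (I : Type) (r : seq I) (c : I -> C) (u : I -> spinor) :
  (forall i, tame (u i)) -> tame (\sum_(i <- r) c i *: u i).
Proof.
move=> ut; elim: r => [|i r IH]; first by rewrite big_nil; exact: Tame_zero.
by rewrite big_cons; apply: tameD => //; exact: tameZ.
Qed.

Lemma tame_smooth u x : tame u -> smooth_SU2 (fun g => u g x).
Proof.
elim=> [|l f w fs _ IH]; first exact: (smooth_SU2_cst 0).
apply: smooth_SU2D IH; apply: smooth_SU2M fs _; exact: smooth_SU2_cst.
Qed.

Lemma tame_cderive u g x : tame u -> is_cderive (u g) x (cderive (u g) x).
Proof.
move=> ut; suff [d ud] : exists d, is_cderive (u g) x d by rewrite (is_cderiveE ud).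
elim: ut => [|l f w _ _ [d wd]]; first by exists 0; exact: (is_cderive_cst x 0).
exists (f g * (x%:C * hermite l x + hermite l.+1 x) + d).
by apply: is_cderiveD wd; apply: is_cderiveZ; exact: is_cderive_hermite.
Qed.

Definition tame_op A : Prop := (forall u, tame u -> tame (A u)) /\ linear_on tame A.

Lemma tame_op0 A : tame_op A -> A 0 = 0.
Proof.
move=> [_ lA]; have := lA (-1) 0 0 Tame_zero Tame_zero.
by rewrite scaler0 addr0 scaleN1r addNr.
Qed.

Lemma tame_op_comb A (I : Type) (r : seq I) (c : I -> C) (u : I -> spinor) :
  tame_op A -> (forall i, tame (u i)) ->
  A (\sum_(i <- r) c i *: u i) = \sum_(i <- r) c i *: A (u i).
Proof.
move=> oA ut; elim: r => [|i r IH]; first by rewrite !big_nil tame_op0.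
rewrite !big_cons; case: (oA) => _ lA.
by rewrite lA ?IH //; exact: tame_comb.
Qed.

Lemma tame_opD A u v : tame_op A -> tame u -> tame v -> A (u + v) = A u + A v.
Proof. by move=> [_ lA] ut vt; rewrite -[u]scale1r lA // !scale1r. Qed.

Lemma tame_opZ A (c : C) u : tame_op A -> tame u -> A (c *: u) = c *: A u.
Proof.
move=> oA ut; case: (oA) => _ lA.
by rewrite -[c *: u]addr0 (lA _ _ _ ut Tame_zero) (tame_op0 oA) addr0.
Qed.

Lemma tame_op_comp A B : tame_op A -> tame_op B -> tame_op (A \o B).
Proof.
move=> [tA lA] [tB lB]; split=> [u ut|c u v ut vt] /=; first exact/tA/tB.
by rewrite lB // lA //; exact: tB.
Qed.

Lemma tame_op_lin (a c : C) A B : tame_op A -> tame_op B ->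
  tame_op (fun u => a *: A u + c *: B u).
Proof.
move=> [tA lA] [tB lB]; split=> [u ut|d u v ut vt].
  by apply: tameD; apply: tameZ; [exact: tA|exact: tB].
rewrite lA // lB // !scalerDr !scalerA ![d * _]mulrC -!scalerA.
by rewrite addrACA.
Qed.

Lemma tame_op_add A B : tame_op A -> tame_op B -> tame_op (fun u => A u + B u).
Proof.
move=> oA oB; have := tame_op_lin 1 1 oA oB; congr tame_op.
by apply/funext => u; rewrite !scale1r.
Qed.

Lemma tame_op_sub A B : tame_op A -> tame_op B -> tame_op (fun u => A u - B u).
Proof.
move=> oA oB; have := tame_op_lin 1 (-1) oA oB; congr tame_op.
by apply/funext => u; rewrite scale1r scaleN1r.
Qed.

Lemma tame_op_scale (c : C) A : tame_op A -> tame_op (fun u => c *: A u).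
Proof.
move=> oA; have := tame_op_lin c 0 oA oA; congr tame_op.
by apply/funext => u; rewrite scale0r addr0.
Qed.

Lemma tame_op_elem A : linear_on tame A ->
  (forall l f, smooth_SU2 f -> tame (A (elem l f))) -> tame_op A.
Proof.
move=> lA eA; split=> // u; elim=> [|l f w fs wt IH].
  have := lA (-1) 0 0 Tame_zero Tame_zero.
  by rewrite scaler0 addr0 scaleN1r addNr => ->; exact: Tame_zero.
rewrite -[elem l f]scale1r lA ?scale1r //; last exact: tame_elem.
by apply: tameD IH; exact: eA.
Qed.

Lemma lieder_elem X l f : smooth_SU2 f -> lieder X (elem l f) = elem l (lieD X f).
Proof.
move=> fs; apply: spinor_eq => g x; rewrite elemE mulrC -(lieDZ X _ g fs).
by rewrite /lieD /lieder; congr (cderive _ 0); apply/funext => s; rewrite elemE mulrC.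
Qed.

Lemma tame_op_lieder X : tame_op (lieder X).
Proof.
apply: tame_op_elem => [a u v ut vt|l f fs].
  apply: spinor_eq => g x; rewrite spinorDE spinorZE.
  rewrite -[lieder X u g x]/(lieD X (fun g => u g x) g).
  rewrite -[lieder X v g x]/(lieD X (fun g => v g x) g).
  have us := tame_smooth x ut; have vs := tame_smooth x vt.
  by rewrite -(lieDZ X a g us) -(lieDD X g (smooth_SU2Z a us) vs).
by rewrite lieder_elem //; exact/tame_elem/smooth_lieD.
Qed.

Definition applyE : spinor -> spinor := fun u g => sigmaE (u g).
Definition applyF : spinor -> spinor := fun u g => sigmaF (u g).

Lemma applyE_elem l f : applyE (elem l f) =
  elem l.+1 (fun g => - ('i / 2) * f g) + elem l.-1 (fun g => - ('i * l%:R) * f g).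
Proof.
apply: spinor_eq => g x; rewrite spinorDE /applyE /sigmaE !elemE.
transitivity ('i / 2 * f g * (2 * x%:C * hermite l x)); first by field.
by rewrite hermite_rec; field.
Qed.

Lemma applyF_elem l f : applyF (elem l f) =
  elem l.+1 (fun g => 2^-1 * f g) + elem l.-1 (fun g => - l%:R * f g).
Proof.
apply: spinor_eq => g x; rewrite spinorDE /applyF /sigmaF !elemE.
rewrite (is_cderiveE (is_cderiveZ (f g) (is_cderive_hermite l x))).
rewrite -(is_cderiveE (is_cderive_hermite l x)) cderive_hermite.
ring.
Qed.

Lemma tame_op_applyE : tame_op applyE.
Proof.
apply: tame_op_elem => [a u v ut vt|l f fs].
  apply: spinor_eq => g x; rewrite spinorDE spinorZE /applyE /sigmaE.
  by rewrite spinorDE spinorZE; ring.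
by rewrite applyE_elem; apply: tameD; apply: tame_elem; exact: smooth_SU2Z.
Qed.

Lemma tame_op_applyF : tame_op applyF.
Proof.
apply: tame_op_elem => [a u v ut vt|l f fs].
  apply: spinor_eq => g x; rewrite spinorDE spinorZE /applyF /sigmaF.
  apply: is_cderiveE; apply: is_cderiveD; last exact: tame_cderive.
  by apply: is_cderiveZ; exact: tame_cderive.
by rewrite applyF_elem; apply: tameD; apply: tame_elem; exact: smooth_SU2Z.
Qed.

Lemma opH_elem l f : opH (elem l f) = - (l%:R + 2^-1) *: elem l f.
Proof.
apply: spinor_eq => g x; rewrite spinorZE /opH.
rewrite -[LHS]/(2^-1 * (sigmaE (sigmaE (elem l f g)) x + sigmaF (sigmaF (elem l f g)) x)).
have -> : sigmaF (elem l f g) = fun x => f g * (x%:C * hermite l x + hermite l.+1 x).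
  by apply/funext => y; apply/is_cderiveE/is_cderiveZ/is_cderive_hermite.
have xd : is_cderive (fun x : R => x%:C) x 1.
  by apply: is_cderive_eq (is_cderive_real (is_derive_id x (1 : R))) _; rewrite rmorph1.
have := is_cderiveZ (f g) (is_cderiveD
  (is_cderiveM xd (is_cderive_hermite l x)) (is_cderive_hermite l.+1 x)).
rewrite /sigmaF => /is_cderiveE ->; rewrite /sigmaE !elemE.
have := hermite_rec l.+1 x; rewrite /= => H.
have -> : hermite l.+2 x = - (2 * x%:C * hermite l.+1 x) - 2 * l.+1%:R * hermite l x.
  by rewrite H; ring.
rewrite -natr1 !mulrA.
transitivity (2^-1 * (('i * 'i + 1) * x%:C * x%:C - 2 * l%:R - 1) * (f g * hermite l x)).
  by ring.
by rewrite mul_ii addNr !mul0r; field.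
Qed.

Lemma tame_op_opH : tame_op (@opH R).
Proof.
have oEE := tame_op_comp tame_op_applyE tame_op_applyE.
have oFF := tame_op_comp tame_op_applyF tame_op_applyF.
exact: (tame_op_scale 2^-1 (tame_op_add oEE oFF)).
Qed.

Section Operators.
Variables E F : su2 R.

Lemma tame_op_Dirac : tame_op (Dirac E F).
Proof.
apply: (tame_op_sub (tame_op_comp tame_op_applyE (tame_op_lieder F))
                    (tame_op_comp tame_op_applyF (tame_op_lieder E))).
Qed.

Lemma tame_op_Dirac_tilde : tame_op (Dirac_tilde E F).
Proof.
apply: (tame_op_add (tame_op_comp tame_op_applyE (tame_op_lieder E))
                    (tame_op_comp tame_op_applyF (tame_op_lieder F))).
Qed.

Lemma tame_op_Dolbeault : tame_op (Dolbeault E F).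
Proof.
exact: (tame_op_add tame_op_Dirac (tame_op_scale 'i tame_op_Dirac_tilde)).
Qed.

Lemma tame_op_Dolbeault_bar : tame_op (Dolbeault_bar E F).
Proof.
exact: (tame_op_sub tame_op_Dirac (tame_op_scale 'i tame_op_Dirac_tilde)).
Qed.

Lemma tame_op_opP : tame_op (opP E F).
Proof.
exact: (tame_op_scale 'i (tame_op_sub
  (tame_op_comp tame_op_Dirac_tilde tame_op_Dirac)
  (tame_op_comp tame_op_Dirac tame_op_Dirac_tilde))).
Qed.

Lemma Dirac_Dolbeault u :
  Dirac E F u = 2^-1 *: Dolbeault E F u + 2^-1 *: Dolbeault_bar E F u.
Proof.
apply: spinor_eq => g x; rewrite spinorDE !spinorZE /Dolbeault /Dolbeault_bar.
by rewrite !spinorDE spinorNE !spinorZE; field.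
Qed.

Lemma Dirac_tilde_Dolbeault u :
  Dirac_tilde E F u = - ('i / 2) *: Dolbeault E F u + ('i / 2) *: Dolbeault_bar E F u.
Proof.
apply: spinor_eq => g x; rewrite spinorDE !spinorZE /Dolbeault /Dolbeault_bar.
rewrite !spinorDE spinorNE !spinorZE.
transitivity (- ('i * 'i) * Dirac_tilde E F u g x); last by field.
by rewrite mul_ii opprK mul1r.
Qed.

(** An identity of noncommutative polynomials in [Dirac] and [Dirac_tilde],
    valid where both operators are linear. *)
Lemma opP_Dolbeault u : tame u -> opP E F u =
  2^-1 *: (Dolbeault E F (Dolbeault_bar E F u) - Dolbeault_bar E F (Dolbeault E F u)).
Proof.
move=> ut.
have tD := proj1 tame_op_Dirac _ ut; have tT := proj1 tame_op_Dirac_tilde _ ut.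
have DE w g x : Dolbeault E F w g x = Dirac E F w g x + 'i * Dirac_tilde E F w g x.
  by [].
have DbE w g x : Dolbeault_bar E F w g x =
    Dirac E F w g x - 'i * Dirac_tilde E F w g x by [].
have bar : Dolbeault_bar E F u = Dirac E F u + (- 'i) *: Dirac_tilde E F u.
  by rewrite scaleNr.
have lin (A : spinor -> spinor) (a : C) : tame_op A -> A (Dirac E F u + a *: Dirac_tilde E F u) =
    A (Dirac E F u) + a *: A (Dirac_tilde E F u).
  by move=> oA; rewrite (tame_opD oA tD (tameZ a tT)) (tame_opZ a oA tT).
have barE (A : spinor -> spinor) (oA : tame_op A) := etrans (congr1 A bar) (lin A _ oA).
have e1 := barE _ tame_op_Dirac; have e2 := barE _ tame_op_Dirac_tilde.
have dolE (A : spinor -> spinor) (oA : tame_op A) : A (Dolbeault E F u) =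
  A (Dirac E F u) + 'i%R *: A (Dirac_tilde E F u) := lin A _ oA.
have e3 := dolE _ tame_op_Dirac; have e4 := dolE _ tame_op_Dirac_tilde.
apply: spinor_eq => g x.
transitivity (2^-1 * (Dolbeault E F (Dolbeault_bar E F u) g x -
                      Dolbeault_bar E F (Dolbeault E F u) g x)); last by [].
rewrite DE DbE e1 e2 e3 e4 !spinorDE !spinorZE.
transitivity ('i * (Dirac_tilde E F (Dirac E F u) g x -
                    Dirac E F (Dirac_tilde E F u) g x)); first by [].
move: (Dirac E F (Dirac E F u) g x) (Dirac E F (Dirac_tilde E F u) g x).
move: (Dirac_tilde E F (Dirac E F u) g x) (Dirac_tilde E F (Dirac_tilde E F u) g x).
by move=> p q r s; field.
Qed.

End Operators.
End Tame.

(** * The eigenspaces of P *)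

Section Eigenspaces.
Variables (R : realType) (b : R[i]).
Hypothesis b_norm : 8 * (b * conjc b) = 1.
Local Notation C := R[i].
Local Notation spinor := (spinor R).
Local Notation E := (su2_offdiag b).
Local Notation F := (su2_offdiag ('i * b)).
Local Notation raise := (raise b).
Local Notation lower := (lower b).
Local Notation Gam := (Gamma E F).
Implicit Types (g h t : SU2 R) (f k : SU2 R -> C) (u v phi : spinor).

Lemma Dirac_elem l f : smooth_SU2 f -> Dirac E F (elem l f) =
  elem l.-1 (fun g => 2 * l%:R * raise f g) + elem l.+1 (fun g => - lower f g).
Proof.
move=> fs; apply: spinor_eq => g x.
have -> : Dirac E F (elem l f) g x =
    applyE (lieder F (elem l f)) g x - applyF (lieder E (elem l f)) g x by [].
rewrite !lieder_elem // applyE_elem applyF_elem !spinorDE !elemE (lieDE_E b) (lieDE_F b).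
move: (raise f g) (lower f g) (hermite l.-1 x) (hermite l.+1 x) => p q y z.
transitivity (- ('i * 'i) * (2^-1 * (p - q) * z + l%:R * (p - q) * y) -
  (2^-1 * (p + q) * z - l%:R * (p + q) * y)); first by field.
by rewrite mul_ii opprK mul1r; field.
Qed.

Lemma Dirac_tilde_elem l f : smooth_SU2 f -> Dirac_tilde E F (elem l f) =
  elem l.-1 (fun g => - (2 * 'i%R * l%:R) * raise f g) +
  elem l.+1 (fun g => - 'i%R * lower f g).
Proof.
move=> fs; apply: spinor_eq => g x.
have -> : Dirac_tilde E F (elem l f) g x =
    applyE (lieder E (elem l f)) g x + applyF (lieder F (elem l f)) g x by [].
rewrite !lieder_elem // applyE_elem applyF_elem !spinorDE !elemE (lieDE_E b) (lieDE_F b).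
move: (raise f g) (lower f g) (hermite l.-1 x) (hermite l.+1 x) => p q y z.
by field.
Qed.

Lemma Dolbeault_elem l f : smooth_SU2 f -> Dolbeault E F (elem l f) =
  elem l.-1 (fun g => 4 * l%:R * raise f g).
Proof.
move=> fs; apply: spinor_eq => g x.
have -> : Dolbeault E F (elem l f) g x = Dirac E F (elem l f) g x +
  'i%R * Dirac_tilde E F (elem l f) g x by [].
rewrite Dirac_elem // Dirac_tilde_elem // !spinorDE !elemE.
move: (raise f g) (lower f g) (hermite l.-1 x) (hermite l.+1 x) => p q y z.
transitivity ((1 - 'i%R * 'i%R) * (2 * l%:R * p * y) - (1 + 'i%R * 'i%R) * q * z).
  by ring.
by rewrite mul_ii; ring.
Qed.

Lemma Dolbeault_bar_elem l f : smooth_SU2 f -> Dolbeault_bar E F (elem l f) =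
  elem l.+1 (fun g => - 2 * lower f g).
Proof.
move=> fs; apply: spinor_eq => g x.
have -> : Dolbeault_bar E F (elem l f) g x = Dirac E F (elem l f) g x -
  'i%R * Dirac_tilde E F (elem l f) g x by [].
rewrite Dirac_elem // Dirac_tilde_elem // !spinorDE !elemE.
move: (raise f g) (lower f g) (hermite l.-1 x) (hermite l.+1 x) => p q y z.
transitivity ((1 + 'i%R * 'i%R) * (2 * l%:R * p * y) - (1 - 'i%R * 'i%R) * q * z).
  by ring.
by rewrite mul_ii; ring.
Qed.

(** The eigenvalue of [raise \o lower] on functions of weight [- (2 l + 1)] that
    corresponds to the eigenvalue [lambda l j] of [opP]. *)
Definition mu (l j : nat) : C :=
  - 8^-1 * ((l + j + 1)%N%:R ^+ 2 - (l + 1)%N%:R ^+ 2).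

Lemma opP_elem l f : smooth_SU2 f -> has_weight (- (2 * l + 1)%N%:Z) f ->
  opP E F (elem l f) = elem l (fun g =>
    - 4 * raise (lower f) g - (l * (2 * l + 1))%N%:R / 2 * f g).
Proof.
move=> fs fw; have rs := smooth_raise b fs; have ls := smooth_lower b fs.
rewrite opP_Dolbeault; last exact: tame_elem.
rewrite Dolbeault_bar_elem // Dolbeault_elem; last exact: smooth_SU2Z.
rewrite Dolbeault_elem // Dolbeault_bar_elem; last exact: smooth_SU2Z.
apply: spinor_eq => g x; rewrite spinorZE spinorDE spinorNE !elemE.
rewrite raiseZ // lowerZ // (raise_lower b_norm g fs fw).
rewrite rmorphN /= -pmulrn natrM natrD natrM.
case: l {fw} => [|l]; first by rewrite /= !mulr0 !mul0r; field.
by rewrite /= -!natr1; field.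
Qed.

Lemma opP_eigen l j f : smooth_SU2 f -> has_weight (- (2 * l + 1)%N%:Z) f ->
  opP E F (elem l f) = lambda R l j *: elem l f <->
  forall g, raise (lower f) g = mu l j * f g.
Proof.
move=> fs fw; rewrite opP_elem // -elemZ.
have lamE : lambda R l j = - 4 * mu l j - (l * (2 * l + 1))%N%:R / 2.
  by rewrite /lambda /mu !(natrD, natrM); field.
split=> [/elem_inj fE g|fE]; last first.
  by congr (elem l _); apply/funext => g; rewrite fE lamE; ring.
have := congr1 (fun k => k g) fE; rewrite /= lamE mulrBl => /addIr H.
have n4 : (- 4 : C) != 0 by rewrite oppr_eq0 pnatr_eq0.
by apply: (mulfI n4); exact: (etrans H (esym (mulrA _ _ _))).
Qed.

Definition eigen (l j : nat) f : Prop :=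
  [/\ smooth_SU2 f, has_weight (- (2 * l + 1)%N%:Z) f &
      forall g, raise (lower f) g = mu l j * f g].

(** Equivariance of the section [f h_l] gives [f] the weight opposite to that of
    the fibre. *)
Lemma GammaP (l j : nat) phi : Gam l j phi <-> exists2 f, eigen l j f & phi = elem l f.
Proof.
split=> [[[[f fs fE] pT] pP]|[f [fs fw fe] ->]].
  have phiE : phi = elem l f by apply/funext => g; rewrite fE.
  have fw : has_weight (- (2 * l + 1)%N%:Z) f.
    move=> g t tT; have [x hx] := hermite_neq0 R l; apply: (mulIf hx).
    rewrite -!elemE -phiE pT // /T_act.
    have -> : val (SU2_inv t) 0 0 = (val t 0 0)^-1.
      have [_ _ _ tU] := TP tT; rewrite /= !mxE.
      by apply: (mulfI (T_neq0 tT)); rewrite tU divff // T_neq0.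
    rewrite phiE -[LHS]/((val t 0 0)^-1 ^+ (2 * l + 1) * elem l f g x) elemE mulrA.
    by rewrite -exprz_inv.
  exists f => //; split=> //; apply/(opP_eigen j fs fw).
  by rewrite -phiE.
split; last exact/opP_eigen.
split; first by exists f.
move=> g t tT; rewrite /elem fw // /T_act.
have -> : val (SU2_inv t) 0 0 = (val t 0 0)^-1.
  have [_ _ _ tU] := TP tT; rewrite /= !mxE.
  by apply: (mulfI (T_neq0 tT)); rewrite tU divff // T_neq0.
by rewrite -exprz_inv scalerA.
Qed.

Lemma Gamma_tame l j u : Gam l j u -> tame u.
Proof. by case: l j => [l|l] [j|j]; try (by move=> ->; exact: Tame_zero);
  move=> /GammaP[f [fs _ _] ->]; exact: tame_elem. Qed.

Lemma eigen_comb l j (a : C) f k : eigen l j f -> eigen l j k ->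
  eigen l j (fun g => a * f g + k g).
Proof.
move=> [fs fw fe] [ks kw ke].
have afs := smooth_SU2Z a fs; split; first exact: smooth_SU2D.
  by apply: has_weightD => //; exact: has_weightZ.
move=> g; have -> : lower (fun g => a * f g + k g) = fun g => a * lower f g + lower k g.
  by apply/funext => h; rewrite lowerD // lowerZ.
have lfs := smooth_lower b fs; have lks := smooth_lower b ks.
by rewrite (raiseD b g (smooth_SU2Z a lfs) lks) (raiseZ b a g lfs) fe ke; ring.
Qed.

Lemma eigenZ l j (a : C) f : eigen l j f -> eigen l j (fun g => a * f g).
Proof.
move=> [fs fw fe]; split; [exact: smooth_SU2Z|exact: has_weightZ|move=> g].
have -> : lower (fun g => a * f g) = fun g => a * lower f g.
  by apply/funext => h; rewrite lowerZ.
by rewrite raiseZ ?fe; [ring|exact: smooth_lower].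
Qed.

Lemma Gamma0 l j : Gam l j 0.
Proof.
case: l j => [l|l] [j|j] //; apply/GammaP; exists (fun=> 0); last by rewrite elem0.
have s0 : smooth_SU2 (fun=> 0 : C) by exact: smooth_SU2_cst.
split=> // [g t _|g]; first by rewrite mulr0.
have -> : lower (fun=> 0) = fun=> 0.
  by apply/funext => h; rewrite /lower !lieD_cst mulr0 addr0 mulr0.
by rewrite raise0 mulr0.
Qed.

Lemma Gamma_comb l j (a : C) u v : Gam l j u -> Gam l j v -> Gam l j (a *: u + v).
Proof.
case: l j => [l|l] [j|j]; try by move=> -> ->; rewrite scaler0 addr0.
move=> /GammaP[f fe ->] /GammaP[k ke ->]; apply/GammaP.
exists (fun g => a * f g + k g); first exact: eigen_comb.
by rewrite elemD elemZ.
Qed.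

(** The commutator shifts the eigenvalue by the weight:
    [mu l.+1 j - (2 l + 3) / 8 = mu l j.+1]. *)
Lemma lower_raise_eigen l j f : eigen l.+1 j f ->
  forall g, lower (raise f) g = mu l j.+1 * f g.
Proof.
move=> [fs fw fe] g; have := fe g; rewrite (raise_lower b_norm g fs fw) => H.
have -> : lower (raise f) g = mu l.+1 j * f g + (- (2 * l.+1 + 1)%N%:Z)%:~R / 8 * f g.
  by rewrite -H subrK.
by rewrite rmorphN /= -pmulrn /mu !natrD natrM -!natr1; field.
Qed.

Lemma eigen_raise l j f : eigen l.+1 j f -> eigen l j.+1 (raise f).
Proof.
move=> fe; have [fs fw _] := fe; split; first exact: smooth_raise.
  have := has_weight_raise b fs fw; congr (has_weight _ _).
  by rewrite !PoszD !PoszM intS; ring.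
move=> g; have -> : lower (raise f) = fun g => mu l j.+1 * f g.
  by apply/funext => h; rewrite (lower_raise_eigen fe).
by rewrite raiseZ.
Qed.

Lemma eigen_lower l j f : eigen l j.+1 f -> eigen l.+1 j (lower f).
Proof.
move=> [fs fw fe]; have ls := smooth_lower b fs.
have lw : has_weight (- (2 * l.+1 + 1)%N%:Z) (lower f).
  have := has_weight_lower b fs fw; congr (has_weight _ _).
  by rewrite !PoszD !PoszM intS; ring.
split=> // g; rewrite (raise_lower b_norm g ls lw).
have -> : raise (lower f) = fun g => mu l j.+1 * f g by apply/funext.
by rewrite lowerZ // rmorphN /= -pmulrn /mu !natrD natrM -!natr1; field.
Qed.

(** [lower f] is killed by [raise] and has negative weight. *)
Lemma lower_eigen0 l f : eigen l 0 f -> forall g, lower f g = 0.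
Proof.
move=> [fs fw fe]; apply: (raise_weight_lt0 b_norm (smooth_lower b fs)
  (has_weight_lower b fs fw)); last first.
  by move=> g; rewrite fe /mu addn0 subrr mulr0 mul0r.
by rewrite -opprD oppr_lt0.
Qed.

Lemma mu_neq0 l j : mu l j.+1 != 0.
Proof.
rewrite /mu mulf_neq0 ?oppr_eq0 ?invr_eq0 ?pnatr_eq0 // subr_eq0 -!natrX eqr_nat.
by rewrite eqn_exp2r // eqn_add2r -[X in _ == X]addn0 eqn_add2l.
Qed.

Lemma intB1 (n : nat) : n.+1%:Z - 1 = n.
Proof. by rewrite -addn1 PoszD addrK. Qed.

Lemma intD1 (n : nat) : n%:Z + 1 = n.+1.
Proof. by rewrite -addn1 PoszD. Qed.

Lemma Dolbeault_Gamma (l j : nat) phi : Gam l j phi ->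
  Gam (l%:Z - 1) (j%:Z + 1) (Dolbeault E F phi).
Proof.
move=> /GammaP[f fe ->]; have [fs _ _] := fe; rewrite Dolbeault_elem // intD1.
case: l fe => [|l] fe.
  by under eq_fun do rewrite mulr0 mul0r; rewrite elem0; exact: (Gamma0 (Negz 0) j.+1).
rewrite intB1; apply/GammaP; exists (fun g => 4 * l.+1%:R * raise f g) => //.
exact/eigenZ/eigen_raise.
Qed.

Lemma Dolbeault_bar_Gamma (l j : nat) phi : Gam l j phi ->
  Gam (l%:Z + 1) (j%:Z - 1) (Dolbeault_bar E F phi).
Proof.
move=> /GammaP[f fe ->]; have [fs _ _] := fe; rewrite Dolbeault_bar_elem // intD1.
case: j fe => [|j] fe.
  under eq_fun do rewrite (lower_eigen0 fe) mulr0.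
  by rewrite elem0; exact: (Gamma0 l.+1 (Negz 0)).
rewrite intB1; apply/GammaP; exists (fun g => - 2 * lower f g) => //.
exact/eigenZ/eigen_lower.
Qed.

Lemma linear_on_Gamma A l j : tame_op A -> linear_on (Gam l j) A.
Proof. by move=> [_ lA] a u v ut vt; exact: (lA a u v (Gamma_tame ut) (Gamma_tame vt)). Qed.

(** Between the two spaces, [raise \o lower] and [lower \o raise] are both
    multiplication by [mu l j.+1]. *)
Lemma Dolbeault_iso (l j : nat) :
  linear_iso (Gam l.+1 j) (Gam l j.+1) (Dolbeault E F).
Proof.
split; first exact/linear_on_Gamma/tame_op_Dolbeault.
have n0 : (4 * l.+1%:R : C) != 0 by rewrite mulf_neq0 ?pnatr_eq0.
split.
- by move=> u /Dolbeault_Gamma; rewrite intB1 intD1.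
- move=> u v /set_mem/GammaP[f fe ->] /set_mem/GammaP[k ke ->].
  have [fs _ _] := fe; have [ks _ _] := ke.
  rewrite !Dolbeault_elem // => /elem_inj fk; congr elem; apply/funext => g.
  have rfk : raise f = raise k.
    by apply/funext => h; apply: (mulfI n0); exact: (congr1 (fun F => F h) fk).
  apply: (mulfI (mu_neq0 l j)); apply: (etrans (esym (lower_raise_eigen fe g))).
  by rewrite rfk; exact: lower_raise_eigen ke g.
- move=> v /GammaP[k ke ->]; have [ks _ kE] := ke.
  have ls := smooth_lower b ks.
  pose c := (4 * l.+1%:R * mu l j.+1)^-1.
  have fe : eigen l.+1 j (fun g => c * lower k g) by exact/eigenZ/eigen_lower.
  exists (elem l.+1 (fun g => c * lower k g)); first by apply/GammaP; exists (fun g => c * lower k g).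
  have [fs _ _] := fe; rewrite Dolbeault_elem //; congr elem; apply/funext => g.
  by rewrite raiseZ // kE /c; field; rewrite mu_neq0 nat1r pnatr_eq0.
Qed.

Lemma Dolbeault_bar_iso (l j : nat) :
  linear_iso (Gam l j.+1) (Gam l.+1 j) (Dolbeault_bar E F).
Proof.
split; first exact/linear_on_Gamma/tame_op_Dolbeault_bar.
have n0 : (- 2 : C) != 0 by rewrite oppr_eq0 pnatr_eq0.
split.
- by move=> u /Dolbeault_bar_Gamma; rewrite intB1 intD1.
- move=> u v /set_mem/GammaP[f fe ->] /set_mem/GammaP[k ke ->].
  have [fs _ fE] := fe; have [ks _ kE] := ke.
  rewrite !Dolbeault_bar_elem // => /elem_inj fk; congr elem; apply/funext => g.
  have lfk : lower f = lower k.
    by apply/funext => h; apply: (mulfI n0); exact: (congr1 (fun F => F h) fk).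
  apply: (mulfI (mu_neq0 l j)); apply: (etrans (esym (fE g))).
  by rewrite lfk; exact: kE.
- move=> v /GammaP[k ke ->]; have [ks _ kE] := ke.
  have rs := smooth_raise b ks.
  pose c := (- 2 * mu l j.+1)^-1.
  have fe : eigen l j.+1 (fun g => c * raise k g) by exact/eigenZ/eigen_raise.
  exists (elem l (fun g => c * raise k g)); first by apply/GammaP; exists (fun g => c * raise k g).
  have [fs _ _] := fe; rewrite Dolbeault_bar_elem //; congr elem; apply/funext => g.
  by rewrite lowerZ // (lower_raise_eigen ke) /c; field; rewrite mu_neq0.
Qed.

End Eigenspaces.

(** * Dimensions *)

Section Dimension.
Variables (R : realType) (b : R[i]).
Hypothesis b_norm : 8 * (b * conjc b) = 1.
Local Notation C := R[i].
Local Notation spinor := (spinor R).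
Local Notation E := (su2_offdiag b).
Local Notation F := (su2_offdiag ('i * b)).
Local Notation Gam := (Gamma E F).
Implicit Types (u v : spinor).

Lemma mu_lowest N : mu R N 0 = 0.
Proof. by rewrite /mu addn0 subrr mulr0. Qed.

Lemma eigen_lowest N f : eigen b N 0 f <-> lowest_weight b (2 * N + 1) f.
Proof.
split=> [fe|[fs fw lf]].
  by case: (fe) => fs fw _; split=> //; exact: lower_eigen0 fe.
split=> // g; have -> : lower b f = fun=> 0 by apply/funext.
by rewrite raise0 mu_lowest mul0r.
Qed.

(** [has_dim] with its basis exposed, so that isomorphisms can transport it. *)
Definition is_basis (A : set spinor) d (u : 'I_d -> spinor) : Prop :=
  set_bij [set: 'rV[C]_d] A (fun c => \sum_i c 0 i *: u i).

Lemma basis_mem A d (u : 'I_d -> spinor) i : is_basis A u -> A (u i).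
Proof.
case=> uA _ _; have := uA (delta_mx 0 i) I.
rewrite (bigD1 i) //= mxE !eqxx scale1r big1 ?addr0 // => k ki.
by rewrite mxE (negPf ki) andbF scale0r.
Qed.

Lemma is_basis_iso (A B : set spinor) T d (u : 'I_d -> spinor) :
  tame_op T -> (forall v, A v -> tame v) -> set_bij A B T -> is_basis A u ->
  is_basis B (fun i => T (u i)).
Proof.
move=> oT At [TA Ti Ts] bu; have ut i : tame (u i) by exact/At/(basis_mem i bu).
have [uA ui us] := bu.
have TE (c : 'rV[C]_d) : \sum_i c 0 i *: T (u i) = T (\sum_i c 0 i *: u i).
  by rewrite tame_op_comb.
split.
- by move=> c _; rewrite TE; exact/TA/uA.
- move=> c c' cT c'T; rewrite !TE => /Ti H; apply: ui => //.
  by apply: H; apply/mem_set; exact: uA.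
- move=> v Bv; have [w Aw <-] := Ts v Bv; have [c _ <-] := us w Aw.
  by exists c => //; exact: TE.
Qed.

Lemma Gamma_lowest_basis (N : nat) :
  is_basis (Gam N 0%N) (fun k : 'I_(2 * N + 1).+1 => elem N (@monom R (2 * N + 1) k)).
Proof.
have sumE (c : 'rV[C]_(2 * N + 1).+1) :
    \sum_i c 0 i *: elem N (@monom R (2 * N + 1) i) =
    elem N (fun g => \sum_(i < (2 * N + 1).+1) c 0 i * monom (2 * N + 1) i g).
  apply: spinor_eq => g x; rewrite elemE mulr_suml !fct_sumE.
  by apply: eq_bigr => i _; rewrite -mulrA.
split.
- move=> c _; rewrite sumE; apply/GammaP => //.
  exists (fun g => \sum_(i < (2 * N + 1).+1) c 0 i * monom (2 * N + 1) i g) => //.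
  apply/eigen_lowest; apply: lowest_weight_comb => k; split.
  + exact: smooth_monom.
  + by apply: weight_monom; rewrite -ltnS.
  + exact: lower_monom.
- move=> c c' _ _; rewrite !sumE => /elem_inj H.
  apply/eqP; rewrite -subr_eq0; apply/eqP; apply: monom_free => g.
  have := congr1 (fun f => f g) H; rewrite /= => /eqP; rewrite -subr_eq0 -sumrB => /eqP H0.
  by rewrite -[RHS]H0; apply: eq_bigr => k _; rewrite !mxE mulrBl.
- move=> v /(GammaP b_norm)[f /eigen_lowest fl ->].
  have [c cE] := lowest_weight_coord b_norm fl; exists c => //.
  by rewrite sumE; congr elem; apply/funext => g.
Qed.

(** Each step from [(l.+1, j)] to [(l, j.+1)] is a Dolbeault isomorphism,
    and the sum of the indices, hence the size of the basis, is kept. *)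
Lemma Gamma_basis (l j : nat) :
  exists u : 'I_(2 * (l + j + 1)) -> spinor, is_basis (Gam l j) u.
Proof.
elim: j l => [|j IH] l.
  have -> : (2 * (l + 0 + 1) = (2 * l + 1).+1)%N by rewrite addn0 mulnDr !addnS.
  by exists (fun k => elem l (@monom R (2 * l + 1) k)); exact: Gamma_lowest_basis.
have -> : (2 * (l + j.+1 + 1) = 2 * (l.+1 + j + 1))%N by rewrite (addnS l j) (addSn l j).
have [u bu] := IH l.+1; exists (fun i => Dolbeault E F (u i)).
have [_ bij] := Dolbeault_iso b_norm l j.
apply: is_basis_iso bij bu; first exact: tame_op_Dolbeault.
by move=> v; exact: Gamma_tame.
Qed.

Lemma Gamma_neq0 (l j : nat) : exists2 u, Gam l j u & u != 0.
Proof.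
have [u bu] := Gamma_basis l j.
have k : 'I_(2 * (l + j + 1)) by rewrite addn1 mulnS; exact: ord0.
exists (u k); first exact: basis_mem bu.
apply/eqP => uk; have [_ ui _] := bu.
have := ui (delta_mx 0 k) 0; rewrite !inE => /(_ I I).
rewrite (bigD1 k) //= uk scaler0 add0r !big1 => [/(_ erefl)||]; last 2 first.
- by move=> i _; rewrite mxE scale0r.
- by move=> i ik; rewrite mxE (negPf ik) andbF scale0r.
move=> /matrixP/(_ 0 k)/eqP; rewrite !mxE !eqxx oner_eq0.
by [].
Qed.

Lemma not_linear_iso_null (A : set spinor) u T :
  A 0 -> A u -> u != 0 -> ~ linear_iso A [set 0] T.
Proof.
move=> A0 Au u0 [_ [T0 Ti _]]; move/eqP: u0; apply; apply: Ti; rewrite ?inE.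
- exact: Au.
- exact: A0.
- by rewrite (T0 _ Au) (T0 _ A0).
Qed.

(** The components lie along distinct Hermite functions. *)
Lemma Gamma_components_inj N psi psi' :
  Gamma_components E F N psi -> Gamma_components E F N psi' ->
  \sum_l psi l = \sum_l psi' l -> psi = psi'.
Proof.
move=> pG pG' pp.
have [f fE] : exists f : 'I_N.+1 -> SU2 R -> C, forall l, psi l = elem l (f l).
  have H l : exists f, psi l = elem l f.
    by have /(GammaP b_norm)[f _ fE] := pG l; exists f.
  by have [f fE] := choice H; exists f.
have [k kE] : exists f : 'I_N.+1 -> SU2 R -> C, forall l, psi' l = elem l (f l).
  have H l : exists f, psi' l = elem l f.
    by have /(GammaP b_norm)[k _ kE] := pG' l; exists k.
  by have [k kE] := choice H; exists k.
apply/funext => l; rewrite fE kE; congr elem; apply/funext => g.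
have := @elem_free R N.+1 (fun l g => f l g + (-1) * k l g) _ l g.
rewrite mulN1r => fk; apply/eqP; rewrite -subr_eq0; apply/eqP; apply: fk.
transitivity (\sum_l psi l - \sum_l psi' l); last by rewrite pp subrr.
rewrite -sumrB; apply: eq_bigr => i _.
by rewrite elemD elemZ scaleN1r fE kE.
Qed.

Lemma Gamma_components_comb N (a : C) psi psi' :
  Gamma_components E F N psi -> Gamma_components E F N psi' ->
  Gamma_components E F N (fun l => a *: psi l + psi' l).
Proof. by move=> pG pG' l; exact: Gamma_comb. Qed.

Lemma Gamma_sum_dim N : has_dim (Gamma_sum E F N) (2 * (N + 1) ^ 2).
Proof.
pose d := (2 * (N + 1))%N.
have Hb (l : 'I_N.+1) : exists u : 'I_d -> spinor, is_basis (Gam l (N - l)%N) u.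
  have [u bu] := Gamma_basis l (N - l).
  have e : (2 * (l + (N - l) + 1))%N = d by rewrite subnKC // -ltnS.
  by move: u bu; rewrite e => u bu; exists u.
have [B bB] := choice Hb.
have cardK : #|{: 'I_N.+1 * 'I_d}| = (2 * (N + 1) ^ 2)%N.
  by rewrite card_prod !card_ord /d mulnCA addn1 expnS expn1.
pose e (i : 'I_(2 * (N + 1) ^ 2)) : 'I_N.+1 * 'I_d :=
  enum_val (cast_ord (esym cardK) i).
pose e' p : 'I_(2 * (N + 1) ^ 2) := cast_ord cardK (enum_rank p).
have e'K p : e (e' p) = p by rewrite /e /e' cast_ordK enum_rankK.
have eK i : e' (e i) = i by rewrite /e /e' enum_valK cast_ordKV.
exists (fun i => B (e i).1 (e i).2).
pose row (c : 'rV[C]_(2 * (N + 1) ^ 2)) l : 'rV[C]_d := \row_k c 0 (e' (l, k)).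
pose psi c (l : 'I_N.+1) := \sum_k row c l 0 k *: B l k.
have sumE (c : 'rV[C]_(2 * (N + 1) ^ 2)) :
    \sum_i c 0 i *: B (e i).1 (e i).2 = \sum_l psi c l.
  rewrite /psi pair_big /= (reindex e) /=; last first.
    by exists e' => i _; [exact: eK|exact: e'K].
  by apply: eq_bigr => i _; rewrite mxE -surjective_pairing eK.
have psiG c : Gamma_components E F N (psi c).
  by move=> l; have [uA _ _] := bB l; exact: uA.
split.
- by move=> c _; exists (psi c) => //; rewrite sumE.
- move=> c c' _ _; rewrite !sumE => /(Gamma_components_inj (psiG c) (psiG c')) pE.
  apply/rowP => i; rewrite -(eK i); case: (e i) => l k.
  have [_ ui _] := bB l.
  have : row c l = row c' l.
    by apply: ui; rewrite ?inE //; exact: (congr1 (fun p => p l) pE).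
  by move=> /rowP/(_ k); rewrite !mxE.
- move=> _ [p pG <-].
  have Hc (l : 'I_N.+1) : exists c : 'rV[C]_d, \sum_k c 0 k *: B l k = p l.
    by have [_ _ us] := bB l; have [c _ cE] := us _ (pG l); exists c.
  have [c cE] := choice Hc.
  exists (\row_i c (e i).1 0 (e i).2) => //; rewrite sumE.
  apply: eq_bigr => l _; rewrite -cE; apply: eq_bigr => k _.
  by rewrite !mxE e'K.
Qed.

Lemma Gamma_sum_tame N u : Gamma_sum E F N u -> tame u.
Proof.
move=> [psi pG <-].
have -> : \sum_l psi l = \sum_l 1 *: psi l by apply: eq_bigr => l _; rewrite scale1r.
by apply: tame_comb => l; exact: (Gamma_tame b_norm (pG l)).
Qed.

Lemma Gamma_sum_comb N (a : C) u v : Gamma_sum E F N u -> Gamma_sum E F N v ->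
  Gamma_sum E F N (a *: u + v).
Proof.
move=> [psi pG <-] [psi' pG' <-]; exists (fun l => a *: psi l + psi' l).
  exact: Gamma_components_comb.
by rewrite big_split /= scaler_sumr.
Qed.

Lemma Gamma_sum0 N : Gamma_sum E F N 0.
Proof.
by exists (fun=> 0); [move=> l; exact: Gamma0|rewrite big1].
Qed.

Lemma Gamma_sumD N u v : Gamma_sum E F N u -> Gamma_sum E F N v ->
  Gamma_sum E F N (u + v).
Proof. by move=> uG vG; rewrite -[u]scale1r; exact: Gamma_sum_comb. Qed.

Lemma Gamma_sumZ N (a : C) u : Gamma_sum E F N u -> Gamma_sum E F N (a *: u).
Proof. by move=> uG; rewrite -[a *: u]addr0; apply: Gamma_sum_comb (Gamma_sum0 N). Qed.

Lemma Gamma_in_sum N (l : nat) u : (l <= N)%N -> Gam l (N - l)%N u ->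
  Gamma_sum E F N u.
Proof.
move=> lN uG; pose l' : 'I_N.+1 := Ordinal (lN : (l < N.+1)%N).
exists (fun k => if k == l' then u else 0).
  by move=> k; case: eqP => [->|_] //; exact: Gamma0.
by rewrite -big_mkcond /= big_pred1_eq.
Qed.

Lemma Gamma_sum_stable N A : tame_op A ->
  (forall (l : 'I_N.+1) u, Gam l (N - l)%N u -> Gamma_sum E F N (A u)) ->
  forall u, Gamma_sum E F N u -> Gamma_sum E F N (A u).
Proof.
move=> oA AG u [psi pG <-].
have -> : \sum_l psi l = \sum_l 1 *: psi l by apply: eq_bigr => l _; rewrite scale1r.
rewrite tame_op_comb //; last by move=> l; exact: (Gamma_tame b_norm (pG l)).
elim: (index_enum _) => [|l r IH]; first by rewrite big_nil; exact: Gamma_sum0.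
by rewrite big_cons; apply: Gamma_sum_comb IH; exact: AG (pG l).
Qed.

Lemma Dolbeault_sum N (l : 'I_N.+1) u : Gam l (N - l)%N u ->
  Gamma_sum E F N (Dolbeault E F u).
Proof.
move=> /(Dolbeault_Gamma b_norm); rewrite intD1.
have lN : (l <= N)%N by rewrite -ltnS.
case: (nat_of_ord l) lN => [|k] lN; first by move=> ->; exact: Gamma_sum0.
rewrite intB1 -subSn // subSS => H.
by apply: (@Gamma_in_sum N k) => //; exact: ltnW.
Qed.

Lemma Dolbeault_bar_sum N (l : 'I_N.+1) u : Gam l (N - l)%N u ->
  Gamma_sum E F N (Dolbeault_bar E F u).
Proof.
move=> /(Dolbeault_bar_Gamma b_norm); rewrite intD1.
have lN : (l <= N)%N by rewrite -ltnS.
case j: (N - l)%N => [|k]; first by move=> ->; exact: Gamma_sum0.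
rewrite intB1 => H; have ltN : (l < N)%N by rewrite -subn_gt0 j.
by apply: (@Gamma_in_sum N l.+1) => //; rewrite subnS j.
Qed.

(** Linearity of a composite requires its intermediate values to remain
    [tame], so it is proved together with the stability of [tame] and of
    [Gamma_sum]. *)
Lemma algebra_tame_op N A :
  generated_algebra [set opP E F; @opH R; Dirac E F; Dirac_tilde E F] A ->
  tame_op A /\ forall u, Gamma_sum E F N u -> Gamma_sum E F N (A u).
Proof.
elim=> {A} [A [[[->|->]|->]|->]||k A B _ [oA sA] _ [oB sB]|A B _ [oA sA] _ [oB sB]].
- split; first exact: tame_op_opP.
  apply: Gamma_sum_stable => [|l u uG]; first exact: tame_op_opP.
  have [_ ->] := uG; apply: Gamma_sumZ.
  by apply: (@Gamma_in_sum N l) => //; rewrite -ltnS.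
- split; first exact: tame_op_opH.
  apply: Gamma_sum_stable => [|l u uG]; first exact: tame_op_opH.
  have /(GammaP b_norm)[f _ fE] := uG; rewrite fE opH_elem -fE; apply: Gamma_sumZ.
  by apply: (@Gamma_in_sum N l) => //; rewrite -ltnS.
- split; first exact: tame_op_Dirac.
  apply: Gamma_sum_stable => [|l u uG]; first exact: tame_op_Dirac.
  rewrite Dirac_Dolbeault; apply: Gamma_sumD; apply: Gamma_sumZ.
    exact: Dolbeault_sum uG.
  exact: Dolbeault_bar_sum uG.
- split; first exact: tame_op_Dirac_tilde.
  apply: Gamma_sum_stable => [|l u uG]; first exact: tame_op_Dirac_tilde.
  rewrite Dirac_tilde_Dolbeault; apply: Gamma_sumD; apply: Gamma_sumZ.
    exact: Dolbeault_sum uG.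
  exact: Dolbeault_bar_sum uG.
- by split=> //; split.
- split; last by move=> u uG; apply: Gamma_sumD; [exact/Gamma_sumZ/sA|exact: sB].
  have := tame_op_lin k 1 oA oB; congr tame_op.
  by apply/funext => u; rewrite scale1r.
- by split=> [|u uG]; [exact: tame_op_comp|exact/sA/sB].
Qed.

End Dimension.

Theorem proposition5p5 (R : realType) (E F : su2 R) (hEF : adapted_basis E F) :
  (forall l j : nat,
     [/\ forall phi, Gamma E F l j phi ->
           Gamma E F (l%:Z - 1) (j%:Z + 1) (Dolbeault E F phi),
         forall phi, Gamma E F l j phi ->
           Gamma E F (l%:Z + 1) (j%:Z - 1) (Dolbeault_bar E F phi),
         linear_iso (Gamma E F l j) (Gamma E F (l%:Z - 1) (j%:Z + 1))
           (Dolbeault E F) <-> l <> 0%N &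
         linear_iso (Gamma E F l j) (Gamma E F (l%:Z + 1) (j%:Z - 1))
           (Dolbeault_bar E F) <-> j <> 0%N]) /\
  (forall N : nat,
     [/\ forall psi, Gamma_components E F N psi ->
           \sum_l psi l = 0 -> forall l, psi l = 0,
         has_dim (Gamma_sum E F N) (2 * (N + 1) ^ 2)%N &
         is_representation
           (generated_algebra
              [set opP E F; @opH R; Dirac E F; Dirac_tilde E F])
           (Gamma_sum E F N)]).
Proof.
have [b [b_norm -> ->]] := adapted_basisP hEF.
split=> [l j|N]; split.
- by move=> phi; exact: Dolbeault_Gamma.
- by move=> phi; exact: Dolbeault_bar_Gamma.
- split=> [|]; last first.
    case: l => [|l] l0; first by case: l0.
    rewrite intB1 intD1; exact: (Dolbeault_iso b_norm).
  move=> T_iso l0; rewrite l0 in T_iso.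
  have [u uG u0] := Gamma_neq0 b_norm 0 j.
  exact: (not_linear_iso_null (Gamma0 b_norm 0 j) uG u0 T_iso).
- split=> [|]; last first.
    case: j => [|j] j0; first by case: j0.
    rewrite intB1 intD1; exact: (Dolbeault_bar_iso b_norm).
  move=> T_iso j0; rewrite j0 intD1 in T_iso.
  have [u uG u0] := Gamma_neq0 b_norm l 0.
  exact: (not_linear_iso_null (Gamma0 b_norm l 0) uG u0 T_iso).
- move=> psi pG p0 l; have G0 : Gamma_components (su2_offdiag b) (su2_offdiag ('i * b)) N (fun=> 0).
    by move=> k; exact: Gamma0.
  have := Gamma_components_inj b_norm pG G0; rewrite p0 big1 // => /(_ erefl) ->.
  by [].
- exact: Gamma_sum_dim.
- move=> A /(algebra_tame_op b_norm N)[[_ lA] sA]; split=> // a u v uG vG.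
  have u_tame := Gamma_sum_tame b_norm uG; have v_tame := Gamma_sum_tame b_norm vG.
  exact: lA u_tame v_tame.
Qed.
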